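(* Let $0<\alpha\le 1$ and let $Z\in\mathbb{R}^{p_1\times p_2}$ have independent mean-zero entries with $\mathrm{Var}(Z_{ij})\le\sigma_{ij}^2$ and $\|Z_{ij}/\sigma_{ij}\|_{\psi_\alpha}\le\kappa$ for all $i,j$. Then there is a constant $C>0$ depending only on $\alpha$ and $\kappa$ such that \[ \mathbb{E}\|ZZ^\top-\mathbb{E}ZZ^\top\|\le C\left\{\left(\sigma_C+\sigma_R+\sigma_*(\log(p_1\wedge p_2))^{1/2}(\log(p_1\vee p_2))^{1/\alpha-1/2}\right)^2-\sigma_R^2\right\}. \]
   Context: $\|\cdot\|$ is the spectral norm. $\|X\|_{\psi_\alpha}=\inf\{x>0:\mathbb{E}\exp((|X|/x)^\alpha)\le 2\}$. $\sigma_C^2=\max_{j}\sum_{i}\sigma_{ij}^2$, $\sigma_R^2=\max_i\sum_{j}\sigma_{ij}^2$, $\sigma_*^2=\max_{i,j}\sigma_{ij}^2$; $a\wedge b=\min(a,b)$, $a\vee b=\max(a,b)$. *)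

(* Defs.v *)
From HB Require Import structures.
From mathcomp Require Import all_boot all_order all_algebra.
From mathcomp Require Import all_classical all_reals all_analysis.
Set Implicit Arguments. Unset Strict Implicit. Unset Printing Implicit Defensive.
Import Order.TTheory GRing.Theory Num.Theory.
Import numFieldNormedType.Exports.
Local Open Scope classical_set_scope.
Local Open Scope ring_scope.

Definition enorm {R : realType} {n : nat} (v : 'cV[R]_n) : R :=
  Num.sqrt (\sum_(i < n) v i 0 ^+ 2).

Definition specnorm {R : realType} {m n : nat} (A : 'M[R]_(m, n)) : R :=
  sup [set enorm (A *m x) | x in [set x : 'cV[R]_n | enorm x = 1]].

(* Orlicz psi_alpha (quasi-)norm:
   inf { x > 0 : E exp((|X|/x)^alpha) <= 2 }, valued in \bar R (inf of empty = +oo) *)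
Definition psi_norm {d} {T : measurableType d} {R : realType}
  (P : probability T R) (alpha : R) (X : T -> R) : \bar R :=
  ereal_inf [set x%:E | x in [set x : R | 0 < x /\
     (\int[P]_w (expR ((`|X w| / x) `^ alpha))%:E <= 2%:E)%E]].

Definition mutually_independent {d} {T : measurableType d} {R : realType}
  (P : probability T R) {I : finType} (X : I -> T -> R) : Prop :=
  forall B : I -> set R, (forall k, measurable (B k)) ->
    P (\bigcap_(k in [set: I]) (X k @^-1` B k)) = (\prod_(k : I) P (X k @^-1` B k))%E.

Definition sigmaC {R : realType} {p1 p2 : nat} (s : 'I_p1 -> 'I_p2 -> R) : R :=
  Num.sqrt (\big[Num.max/0]_(j < p2) \sum_(i < p1) s i j ^+ 2).
Definition sigmaR {R : realType} {p1 p2 : nat} (s : 'I_p1 -> 'I_p2 -> R) : R :=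
  Num.sqrt (\big[Num.max/0]_(i < p1) \sum_(j < p2) s i j ^+ 2).
Definition sigmaStar {R : realType} {p1 p2 : nat} (s : 'I_p1 -> 'I_p2 -> R) : R :=
  Num.sqrt (\big[Num.max/0]_(i < p1) \big[Num.max/0]_(j < p2) s i j ^+ 2).

Definition ZZt {d} {T : measurableType d} {R : realType} {p1 p2 : nat}
  (Z : 'I_p1 -> 'I_p2 -> T -> R) (w : T) : 'M[R]_p1 :=
  let M := \matrix_(i < p1, j < p2) Z i j w in M *m M^T.
Definition EZZt {d} {T : measurableType d} {R : realType} {p1 p2 : nat}
  (P : probability T R) (Z : 'I_p1 -> 'I_p2 -> T -> R) : 'M[R]_p1 :=
  \matrix_(i < p1, k < p1) fine ('E_P[fun w => ZZt Z w i k]).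

(* Main.v *)
(* Write M = Z Z^T - E Z Z^T and let q be an even exponent of order log (p1 /\ p2).
   E tr M^q is a sum over closed bipartite walks of products over edges of mixed
   moments E Z_e^a (Z_e^2 - E Z_e^2)^b, which vanish for a + b = 1 and otherwise are
   at most (C B)^n (sigma_e / B)^2 g(a, b), where n = a + 2 b,
   B = sigma_* (2q)^(1/alpha - 1/2) and g(a, b) = E Y^a (Y^2 - E Y^2)^b for a fixed
   subgaussian law of Y all of whose moments g(a, b) are nonnegative. Summing the
   sigma's over the vertices of a walk in the order of first visit compares the sum
   over walks of a given shape with the corresponding sum in an m1 x m2 matrix H with
   independent entries distributed as Y, with m1 of order sigma_C^2 / B^2 + q and m2
   of order (sigma_C^2 + sigma_R^2) / B^2 + q; the ratio of the two is at most p1 / m1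
   or p2 / m2 according to the side of the root. For H a lattice net and the moment
   generating function of |H^T x|^2 - E |H^T x|^2 give
   E tr (H H^T - E H H^T)^q <= m1 (C sqrt (m1 m2))^q. Since the moments of order at
   most 2q are the only ones used, log (p1 /\ p2) appears where the statement
   allows log (p1 \/ p2). *)
Require Import Defs.
From HB Require Import structures.
From mathcomp Require Import all_boot all_order all_algebra.
From mathcomp Require Import all_classical all_reals all_analysis.
From mathcomp Require Import measurable_realfun ring lra zify finmap.
Import Order.TTheory GRing.Theory Num.Theory.
Import numFieldNormedType.Exports.
Local Open Scope classical_set_scope.
Local Open Scope ring_scope.
Set Implicit Arguments. Unset Strict Implicit. Unset Printing Implicit Defensive.

(** * Shapes of walks and comparison of walk sums *)

(** The right-hand side is x (x + 2 sigma_R) with x = sigma_C + ..., so no term sigma_R^2 may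
    survive: this is why the diagonal of Z Z^T is centered inside every step of a walk and why the
    target is the geometric mean of m1 and m2. The entries need not be symmetric, so mixed moments
    with odd a can be nonzero; a symmetric comparison law, Gaussian for instance, has none to set
    against them. Hence Y is skewed, with g(a, b) > 0 whenever a + b >= 2 and with subgaussian
    growth up to order 2q; its support is finite, so all expectations over H are finite sums. Each
    vertex but the root is paid for by the edge of its first visit. That edge carries at least two
    powers of sigma, hence the factor (sigma_e / B)^2, whose row and column sums are sigma_R^2 / B^2
    and sigma_C^2 / B^2. The extra q in m1 and m2 makes up for vertices already visited. The term
    sigma_C^2 in m2 ensures m1 <= m2: the moment generating function of the quadratic form is
    controlled only near 0, and the parameter used is of order sqrt (m1 / m2). Rooting walks at rows
    or at columns gives a prefactor p1 or p2, hence the logarithm of the smaller one. *)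

(* Two sequences have the same [canon] exactly when one is obtained from the
   other by an injective relabelling. *)
Definition canon {T : eqType} (x : seq T) : seq nat := [seq index i x | i <- x].

Lemma mem_zip (T U : eqType) (x : seq T) (y : seq U) e :
  e \in zip x y -> e.1 \in x /\ e.2 \in y.
Proof.
elim: x y => [|a x IH] [|b y] //=; rewrite inE => /orP[/eqP -> /=|/IH[ex ey]].
  by split; rewrite ?inE eqxx.
by split; rewrite ?inE ?ex ?ey orbT.
Qed.

Lemma zip_rcons_trunc (T U : Type) (x : seq T) (y : seq U) l :
  size x = size y -> zip x (rcons y l) = zip x y.
Proof. by move=> sxy; rewrite -[x]cats0 -cats1 zip_cat //= !cats0. Qed.

Lemma canon_rcons (T : eqType) (x : seq T) i :
  canon (rcons x i) = rcons (canon x) (index i x).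
Proof.
rewrite /canon map_rcons; congr rcons; last first.
  by rewrite -cats1 index_cat; case: ifP => // /negbT /memNindex -> /=; rewrite eqxx addn0.
by apply/eq_in_map => k kx; rewrite -cats1 index_cat kx.
Qed.

Lemma canon_size (T T' : eqType) (x : seq T) (x' : seq T') :
  canon x = canon x' -> size x = size x'.
Proof. by move=> /(congr1 size); rewrite !size_map. Qed.

Lemma nth_canon_id (T : eqType) (x : seq T) i : i \in x ->
  nth 0%N (canon x) (index i x) = index i x.
Proof. by move=> ix; rewrite (nth_map i) ?index_mem // nth_index. Qed.

Section OneStep.
Context {R : realType}.

(* Vertices of x are matched with those of x' by index; every new vertex of I is
   compared with the cheapest new vertex of I'. *)
Lemma sum_new_vertex_le (I I' : finType) (x : seq I) (x' : seq I')
    (s a : I -> R) (a' : I' -> R) :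
  (forall i, 0 <= s i) -> (forall i, 0 <= a' i) ->
  canon x = canon x' -> (size x < #|I'|)%N ->
  \sum_i s i <= #|I'|%:R - (size x)%:R ->
  (forall i i', index i x = index i' x' ->
    a i <= (if i \in x then 1 else s i) * a' i') ->
  \sum_i a i <= \sum_i' a' i'.
Proof.
move=> s0 a'0 cxx xI sI aa'.
have sxx := canon_size cxx.
have cardx' : (#|[pred i | i \in x']| <= size x)%N by rewrite sxx card_size.
have [i1 i1P] : exists i1, i1 \notin x'.
  apply/existsP; rewrite -negb_forall; apply/negP => /forallP xall.
  suff : (#|I'| <= size x)%N by rewrite leqNgt xI.
  apply: leq_trans cardx'; apply: subset_leq_card; apply/fintype.subsetP => i _.
  by rewrite inE.
pose i0 := [arg min_(i < i1 | i \notin x') a' i]%O.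
have [i0x' i0min] : i0 \notin x' /\ forall i, i \notin x' -> a' i0 <= a' i.
  by rewrite /i0; case: arg_minP.
rewrite (bigID [pred i | i \in x]) /= [leRHS](bigID [pred i | i \in x']) /=.
apply: lerD; last first.
  apply: (@le_trans _ _ ((#|I'|%:R - (size x)%:R) * a' i0)).
    apply: (@le_trans _ _ (\sum_(i | i \notin x) s i * a' i0)).
      apply: ler_sum => i ix; have /negbTE ix' : i \notin x := ix.
      by have := aa' i i0; rewrite ix'; apply; rewrite !memNindex ?ix' // sxx.
    rewrite -mulr_suml; apply: ler_wpM2r => //; apply: le_trans sI.
    by rewrite [leRHS](bigID [pred i | i \in x]) /= lerDr sumr_ge0.
  apply: (@le_trans _ _ (\sum_(i | i \notin x') a' i0)); last exact: ler_sum.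
  rewrite sumr_const -[leRHS]mulr_natl; apply: ler_wpM2r => //.
  rewrite -(@cardC _ [pred i | i \in x']) natrD lerBlDl lerD2r.
  by rewrite ler_nat.
pose h i := nth i0 x' (index i x).
have hx' i : i \in x -> h i \in x' by move=> ix; rewrite mem_nth // -sxx index_mem.
have hidx i : i \in x -> index (h i) x' = index i x.
  move=> ix; have := nth_canon_id ix; rewrite cxx (nth_map i0) //.
  by rewrite -sxx index_mem.
have hinj : {in [pred i | i \in x] &, injective h}.
  move=> i j; rewrite !inE => ix jx hij.
  have : index i x = index j x by rewrite -hidx // hij hidx.
  by move=> /(congr1 (nth i x)); rewrite !nth_index.
apply: (@le_trans _ _ (\sum_(i | i \in x) a' (h i))).
  apply: ler_sum => i ix; have ix' : i \in x := ix.
  by have := aa' i (h i); rewrite ix' mul1r hidx //; apply.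
rewrite -(@big_imset _ _ _ _ _ h [pred i | i \in x] a' hinj) /=.
set X := imset _ _.
rewrite [leRHS](bigID [pred i | i \in X]) /=.
rewrite [leLHS](eq_bigl (fun i => (i \in x') && (i \in X))).
  by rewrite lerDl sumr_ge0.
move=> i /=; case: imsetP => [[k kx ->]|//=]; last by rewrite andbF.
by rewrite hx'.
Qed.

End OneStep.

(** Vertices are appended in the order of visit, one of [I] and one of [J] in turn, so that two such
    sums can be compared vertex by vertex. *)
Fixpoint walk_sum {R : nmodType} {I J : finType} (f : seq I -> seq J -> R) (n : nat)
    (x : seq I) (y : seq J) : R :=
  if n is n'.+1 then
    \sum_i \sum_j walk_sum f n' (rcons x i) (rcons y j)
  else f x y.

(** The walk visits x_0, y_0, x_1, y_1, ...; the edge that closes it leads to no new vertex and is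
    left out. *)
Definition open_edges {T U : eqType} (x : seq T) (y : seq U) : seq (T * U) :=
  zip x y ++ zip (behead x) y.

Lemma open_edges_rcons (T U : eqType) (x : seq T) (y : seq U) i j l :
  size x = (size y).+1 ->
  open_edges (rcons x i) (rcons (rcons y l) j) =i
  [:: (i, l), (i, j) & open_edges x (rcons y l)].
Proof.
case: x => // a x /= [sxy] e; rewrite /open_edges /=.
rewrite -rcons_cons zip_rcons ?size_rcons /= ?sxy //.
have -> : zip (rcons x i) (rcons (rcons y l) j) = rcons (zip x y) (i, l).
  rewrite -[rcons x i]cats0 -[rcons _ j]cats1 zip_cat ?size_rcons ?sxy //=.
  by rewrite cats0 zip_rcons.
rewrite (@zip_rcons_trunc _ _ x y) //.
rewrite !inE !(mem_cat, mem_rcons, inE).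
by case: (_ == (i, l)); case: (_ == (i, j)); rewrite ?orbT.
Qed.

Definition edge_weight {R : realType} {I J : finType} (s : I -> J -> R)
    (E : seq (I * J)) : R := \prod_(e : I * J | e \in E) s e.1 e.2.

Section Comparison.
Context {R : realType} {I J : finType}.
Variable s : I -> J -> R.
Hypothesis s0 : forall i j, 0 <= s i j.
Hypothesis s1 : forall i j, s i j <= 1.

Lemma edge_weight_ge0 E : 0 <= edge_weight s E.
Proof. exact: prodr_ge0. Qed.

Lemma edge_weight_sub E E' : {subset E <= E'} -> edge_weight s E' <= edge_weight s E.
Proof.
move=> sub; rewrite /edge_weight (bigID [pred e | e \in E]) /=.
rewrite (eq_bigl [pred e | e \in E]) => [|e /=]; last first.
  by case: (boolP (e \in E)) => [/sub ->|]; rewrite ?andbF.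
by rewrite ler_piMr ?prodr_ge0 // prodr_ile1 // => e _; rewrite s0 s1.
Qed.

Lemma edge_weight_cons e E : e \notin E ->
  edge_weight s (e :: E) = s e.1 e.2 * edge_weight s E.
Proof.
move=> eE; rewrite /edge_weight (bigD1 e) ?mem_head //=; congr (_ * _).
apply: eq_bigl => k; rewrite in_cons.
by case: eqP => [->|] /=; rewrite ?andbT ?(negbTE eE).
Qed.

Lemma mem_open_edges (x : seq I) (y : seq J) e :
  e \in open_edges x y -> e.1 \in x /\ e.2 \in y.
Proof. by rewrite mem_cat => /orP[] /mem_zip[] // /mem_behead. Qed.

(** A vertex is charged once, through the edge of its first visit: (i, l) for a new [i], (i, j) for
    a new [j]. Other edges weigh at most 1 and are dropped. *)
Lemma edge_weight_rcons (x : seq I) (y : seq J) i j l :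
  size x = (size y).+1 ->
  edge_weight s (open_edges (rcons x i) (rcons (rcons y l) j)) <=
  edge_weight s (open_edges x (rcons y l)) * (if i \in x then 1 else s i l) *
    (if j \in rcons y l then 1 else s i j).
Proof.
move=> sxy; set E := open_edges x _.
pose E1 := if i \in x then E else (i, l) :: E.
pose E2 := if j \in rcons y l then E1 else (i, j) :: E1.
have -> : edge_weight s E * (if i \in x then 1 else s i l) = edge_weight s E1.
  rewrite /E1; case: (boolP (i \in x)) => ix; first by rewrite mulr1.
  by rewrite edge_weight_cons 1?mulrC //; apply: contra ix => /mem_open_edges[].
have -> : edge_weight s E1 * (if j \in rcons y l then 1 else s i j)
    = edge_weight s E2.
  rewrite /E2; case: (boolP (j \in rcons y l)) => jy; first by rewrite mulr1.
  rewrite edge_weight_cons 1?mulrC //; apply: contra jy; rewrite /E1.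
  case: ifP => _; first by move=> /mem_open_edges[].
  rewrite inE => /orP[/eqP[->]|/mem_open_edges[] //].
  by rewrite mem_rcons mem_head.
apply: edge_weight_sub => e; rewrite open_edges_rcons // -/E /E2 /E1.
by case: ifP => _; case: ifP => _; rewrite !inE;
  case: (e \in E); rewrite ?orbT //; case: eqP; rewrite ?orbT.
Qed.

Context {I' J' : finType}.
Variables (N : nat) (F : seq nat -> seq nat -> R).
Hypothesis F0 : forall x y, 0 <= F x y.
Hypothesis NI : (N <= #|I'|)%N.
Hypothesis NJ : (N <= #|J'|)%N.
Hypothesis sI : forall j, \sum_i s i j <= #|I'|%:R - N%:R.
Hypothesis sJ : forall i, \sum_j s i j <= #|J'|%:R - N%:R.

Let F' (x : seq I') (y : seq J') := F (canon x) (canon y).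

Lemma walk_sum_ge0 n x y : 0 <= walk_sum F' n x y.
Proof.
elim: n x y => [|n IH] x y /=; first exact: F0.
by apply: sumr_ge0 => i _; apply: sumr_ge0.
Qed.

(** Induction on the steps still to be summed, for prefixes of the same shape on both sides. A
    prefix with steps left has fewer than [N] vertices on each side, so the bounds by [#|I'| - N]
    and [#|J'| - N] count only unvisited ones. *)
Lemma walk_sum_le (f : seq I -> seq J -> R) L n x y l x' y' :
  (forall x y, size x = size y -> size x = L ->
    f x y <= edge_weight s (open_edges x y) * F (canon x) (canon y)) ->
  size x = (size y).+1 -> (size x + n = L)%N -> (L <= N)%N ->
  canon x = canon x' -> canon (rcons y l) = canon y' ->
  walk_sum f n x (rcons y l) <=
  edge_weight s (open_edges x (rcons y l)) * walk_sum F' n x' y'.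
Proof.
move=> fF; elim: n x y l x' y' => [|n IH] x y l x' y' sxy xn LN cx cy /=.
  by rewrite /F' -cx -cy fF // ?size_rcons // -xn addn0.
have sN : (size x < N)%N by apply: leq_trans LN; rewrite -xn addnS ltnS leq_addr.
have sN' : (size (rcons y l) < N)%N by rewrite size_rcons -sxy.
set V := edge_weight s _.
have V0 : 0 <= V by exact: edge_weight_ge0.
rewrite mulr_sumr; apply: (@sum_new_vertex_le _ _ _ x x' (s ^~ l)) => //.
- by move=> i'; rewrite mulr_ge0 ?sumr_ge0 // => j' _; exact: walk_sum_ge0.
- exact: leq_trans sN NI.
- by apply: le_trans (sI l) _; rewrite lerD2l lerN2 ler_nat ltnW.
move=> i i' ii'; rewrite !mulr_sumr.
have w0 : 0 <= (if i \in x then 1 else s i l) by case: ifP.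
apply: (@sum_new_vertex_le _ _ _ (rcons y l) y' (s i)) => //.
- by move=> j'; rewrite !mulr_ge0 ?walk_sum_ge0.
- exact: leq_trans sN' NJ.
- by apply: le_trans (sJ i) _; rewrite lerD2l lerN2 ler_nat ltnW.
move=> j j' jj'.
apply: (@le_trans _ _ (edge_weight s (open_edges (rcons x i) (rcons (rcons y l) j))
    * walk_sum F' n (rcons x' i') (rcons y' j'))).
  apply: IH.
  - by rewrite !size_rcons sxy.
  - by rewrite size_rcons addSnnS.
  - exact: LN.
  - by rewrite !canon_rcons cx ii'.
  - by rewrite canon_rcons cy jj' -canon_rcons.
rewrite !mulrA ler_wpM2r ?walk_sum_ge0 //.
apply: le_trans (edge_weight_rcons _ _ _ sxy) _.
by rewrite [_ * V]mulrC (mulrC (if j \in _ then _ else _)) mulrA.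
Qed.

(** No edge pays for the root. The estimate holds for every pair of roots, and summing over both
    produces the two cardinals. *)
Lemma walk_sum_comparison (f : seq I -> seq J -> R) n :
  (forall x y, size x = size y -> size x = n.+1 ->
    f x y <= edge_weight s (open_edges x y) * F (canon x) (canon y)) ->
  (n < N)%N ->
  #|I'|%:R * (\sum_i \sum_j walk_sum f n [:: i] [:: j]) <=
  #|I|%:R * (\sum_i \sum_j walk_sum F' n [:: i] [:: j]).
Proof.
move=> fF nN.
suff H i i' : \sum_j walk_sum f n [:: i] [:: j] <=
    \sum_j walk_sum F' n [:: i'] [:: j].
  rewrite !mulr_natl -sumr_const -sumrMnl; apply: ler_sum => i' _.
  by rewrite -sumr_const; apply: ler_sum.
apply: (@sum_new_vertex_le _ _ _ [::] [::] (s i)) => //.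
- by move=> j'; exact: walk_sum_ge0.
- by rewrite (leq_trans _ NJ) // (leq_ltn_trans _ nN).
- by rewrite subr0; apply: le_trans (sJ i) _; rewrite lerBlDr lerDl.
move=> j j' _; rewrite in_nil.
apply: le_trans (@walk_sum_le f n.+1 n [:: i] [::] j [:: i'] [:: j'] fF _ _ _ _ _) _ => //=.
- by rewrite /canon /= !eqxx.
- by rewrite /canon /= !eqxx.
rewrite ler_wpM2r ?walk_sum_ge0 //.
by rewrite /edge_weight (big_pred1 (i, j)) // => e; rewrite inE.
Qed.

End Comparison.

(** * Expansion of traces over closed walks *)

Definition triples {T U : Type} (x : seq T) (y : seq U) (x' : seq T) : seq (T * U * T) :=
  zip (zip x y) x'.

Lemma triples_rcons (T U : Type) (x : seq T) (y : seq U) x' i j k :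
  size x = size y -> size x = size x' ->
  triples (rcons x i) (rcons y j) (rcons x' k) = rcons (triples x y x') (i, j, k).
Proof.
by move=> sxy sxx'; rewrite /triples !zip_rcons // size_zip -sxx' -sxy minnn.
Qed.

Section Counts.
Context {T U : eqType}.
Implicit Types (t : T * U * T) (s : seq (T * U * T)) (e : T * U).

Definition edges_of s : seq (T * U) :=
  [seq t.1 | t <- s] ++ [seq (t.2, t.1.2) | t <- s].
(* A triple (i, j, k) is a step of the walk in [A *m A^T]: it uses the edges (i, j)
   and (k, j) once each if i != k, and contributes a centered square if i = k. *)
Definition nsingle s e : nat :=
  \sum_(t <- s) (t.1.1 != t.2) * ((e == t.1) + (e == (t.2, t.1.2))).
Definition ndouble s e : nat := \sum_(t <- s) ((t.1.1 == t.2) && (e == t.1)).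

Lemma counts_notin s e : e \notin edges_of s -> nsingle s e = 0%N /\ ndouble s e = 0%N.
Proof.
rewrite mem_cat negb_or => /andP[/mapP e1 /mapP e2].
rewrite /nsingle /ndouble; split; apply: big1_seq => t /= ts.
  case: (e =P t.1) => [?|_]; first by case: e1; exists t.
  case: (e =P (t.2, t.1.2)) => [?|_]; first by case: e2; exists t.
  by rewrite muln0.
by case: (e =P t.1) => [?|_]; [case: e1; exists t|rewrite andbF].
Qed.

Lemma counts_in s e : e \in edges_of s -> (1 <= nsingle s e + ndouble s e)%N.
Proof.
move=> es; rewrite lt0n addn_eq0; apply/negP => /andP[].
rewrite /nsingle /ndouble !sum_nat_seq_eq0 => /allP H1 /allP H2.
move: es; rewrite mem_cat => /orP[]/mapP[t ts te]; have := H1 _ ts; have := H2 _ ts;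
  rewrite /= te eqxx ?andbT.
- by case: (t.1.1 =P t.2).
- case: (t.1.1 =P t.2) => [tt|_] /=; last by rewrite addn1.
  by rewrite -tt -surjective_pairing eqxx.
Qed.

Definition shape_prod {R : realType} (g : nat -> nat -> R) s : R :=
  \prod_(e <- undup (edges_of s)) g (nsingle s e) (ndouble s e).

Lemma shape_prod_ge0 {R : realType} (g : nat -> nat -> R) s :
  (forall a b, 0 <= g a b) -> 0 <= shape_prod g s.
Proof. by move=> g0; apply: prodr_ge0. Qed.

End Counts.

Lemma shape_prod_fin {R : realType} (T U : finType) (g : nat -> nat -> R)
    (s : seq (T * U * T)) :
  g 0%N 0%N = 1 ->
  \prod_(e : T * U) g (nsingle s e) (ndouble s e) = shape_prod g s.
Proof.
move=> g00; rewrite /shape_prod [RHS]big_uniq ?undup_uniq //=.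
rewrite (bigID [pred e | e \in undup (edges_of s)]) /= [X in _ * X]big1 ?mulr1 //.
by move=> e; rewrite mem_undup => /counts_notin[-> ->].
Qed.

(** Applied with [index], this shows that the product depends on a walk through its [canon] only. *)
Lemma shape_prod_map {R : realType} (T U T' U' : eqType) (g : nat -> nat -> R)
    (f : T -> T') (f' : U -> U') (x : seq T) (y : seq U) (s : seq (T * U * T)) :
  {in x &, injective f} -> {in y &, injective f'} ->
  (forall t, t \in s -> [/\ t.1.1 \in x, t.1.2 \in y & t.2 \in x]) ->
  shape_prod g [seq (f t.1.1, f' t.1.2, f t.2) | t <- s] = shape_prod g s.
Proof.
move=> finj f'inj sxy.
pose F (e : T * U) := (f e.1, f' e.2).
have sE e : e \in edges_of s -> e.1 \in x /\ e.2 \in y.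
  by rewrite mem_cat => /orP[] /mapP[t /sxy[? ? ?] ->].
have Einj : {in edges_of s &, injective F}.
  move=> [a b] [c d] /sE[/= ax b_y] /sE[/= cx dy] [fac fbd].
  by rewrite (finj _ _ ax cx fac) (f'inj _ _ b_y dy fbd).
have Fin1 t e : t \in s -> e \in edges_of s -> (F e == F t.1) = (e == t.1).
  move=> ts es; apply/eqP/eqP => [|->//]; apply: Einj => //.
  by rewrite mem_cat map_f.
have Fin2 t e : t \in s -> e \in edges_of s ->
    (F e == F (t.2, t.1.2)) = (e == (t.2, t.1.2)).
  move=> ts es; apply/eqP/eqP => [|->//]; apply: Einj => //.
  by rewrite mem_cat (map_f (fun t => (t.2, t.1.2))) ?orbT.
have Fin3 t : t \in s -> (f t.1.1 == f t.2) = (t.1.1 == t.2).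
  by move=> /sxy[? ? ?]; apply/eqP/eqP => [|->//]; apply: finj.
rewrite /shape_prod.
have -> : edges_of [seq (f t.1.1, f' t.1.2, f t.2) | t <- s] = map F (edges_of s).
  by rewrite /edges_of map_cat -!map_comp.
have -> : undup (map F (edges_of s)) = map F (undup (edges_of s)).
  elim: (edges_of s) Einj => //= e E IH Einj.
  rewrite IH; last by move=> ? ? h1 h2; apply: Einj; rewrite inE ?h1 ?h2 orbT.
  rewrite [F e \in _](_ : _ = (e \in E)); first by case: ifP.
  apply/mapP/idP => [[e' e'E /Einj ->//]|eE]; last by exists e.
  - by rewrite mem_head.
  - by rewrite inE e'E orbT.
rewrite big_map; apply: eq_big_seq => e; rewrite mem_undup => es.
congr g; rewrite /nsingle /ndouble big_map; apply: eq_big_seq => t ts /=.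
  by rewrite Fin3 // -(Fin1 t) // -(Fin2 t).
by rewrite Fin3 // -(Fin1 t).
Qed.

Lemma prod_triples_edges {R : comPzRingType} (T U : finType) (z mu : T -> U -> R)
    (s : seq (T * U * T)) :
  \prod_(t <- s) (if t.1.1 == t.2 then z t.1.1 t.1.2 ^+ 2 - mu t.1.1 t.1.2
                  else z t.1.1 t.1.2 * z t.2 t.1.2) =
  \prod_(e : T * U) (z e.1 e.2 ^+ nsingle s e *
                     (z e.1 e.2 ^+ 2 - mu e.1 e.2) ^+ ndouble s e).
Proof.
have E (G : T * U -> R) e0 : G e0 = \prod_e G e ^+ (e == e0).
  by rewrite (bigD1 e0) //= eqxx expr1 big1 ?mulr1 // => e /negbTE ->.
rewrite /nsingle /ndouble.
elim: s => [|t s IH].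
  by rewrite big_nil big1 // => e _; rewrite !big_nil !expr0 mulr1.
rewrite big_cons IH.
under [RHS]eq_bigr => e _ do rewrite !big_cons !exprD mulrACA.
rewrite [RHS]big_split /=; congr (_ * _).
case: eqP => [_|_] /=.
  rewrite (E (fun e => z e.1 e.2 ^+ 2 - mu e.1 e.2) t.1).
  by apply: eq_bigr => e _; rewrite mul0n expr0 mul1r.
rewrite (E (fun e => z e.1 e.2) t.1) (E (fun e => z e.1 e.2) (t.2, t.1.2)).
rewrite -big_split /=; apply: eq_bigr => e _.
by rewrite mul1n exprD expr0 mulr1.
Qed.

(** A step uses two edges once each or squares one edge, so it has degree 2 in any case. The total
    degree is therefore the same for all walks, and a constant to that power can be taken out of the
    walk sum. *)
Lemma sum_counts (T U : finType) (s : seq (T * U * T)) :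
  (\sum_(e : T * U) (nsingle s e + (ndouble s e).*2) = (size s).*2)%N.
Proof.
have E e0 : (\sum_(e : T * U) (e == e0) = 1)%N.
  by rewrite (bigD1 e0) //= eqxx big1 // => e /negbTE ->.
rewrite /nsingle /ndouble; elim: s => [|t s IH].
  by rewrite big1 // => e _; rewrite !big_nil.
under eq_bigr => e _ do rewrite !big_cons doubleD addnACA.
rewrite big_split /= IH doubleS -addn2 [RHS]addnC; congr addn.
case: eqP => _ /=.
  by under eq_bigr => e _ do rewrite mul0n add0n -muln2; rewrite -big_distrl /= E.
under eq_bigr => e _ do rewrite mul1n addn0.
by rewrite big_split /= !E.
Qed.

Section Trace.
Context {R : comPzRingType} (m n : nat) (h : 'I_m -> 'I_n -> 'I_m -> R).
Let M := \matrix_(i < m, k < m) \sum_j h i j k.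

Lemma trace_exp_walk_row q :
  \tr (M ^+ q.+1) = \sum_i \sum_j walk_sum (fun x y =>
    \prod_(t <- triples x y (rot 1 x)) h t.1.1 t.1.2 t.2) q [:: i] [:: j].
Proof.
pose f (x : seq 'I_m) (y : seq 'I_n) := \prod_(t <- triples x y (rot 1 x)) h t.1.1 t.1.2 t.2.
rewrite -/f.
(* Once a prefix is fixed, the next row vertex [k] is left free and the remaining [p] steps from [k]
   back to the root [a] add up to an entry of [M ^+ p]. *)
have claim p a x y : size (a :: x) = size y ->
    walk_sum f p (a :: x) y =
    \sum_k (\prod_(t <- triples (a :: x) y (rcons x k)) h t.1.1 t.1.2 t.2) * (M ^+ p) k a.
  elim: p x y => [|p IH] x y sxy.
    rewrite /= /f rot1_cons (bigD1 a) //= [X in _ = _ + X]big1.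
      by rewrite addr0 mxE eqxx mulr1.
    by move=> k /negbTE ka; rewrite mxE ka mulr0.
  have sz i j : size (a :: rcons x i) = size (rcons y j).
    by rewrite /= !size_rcons -sxy.
  rewrite [LHS]/=; under eq_bigr => i _ do under eq_bigr => j _ do rewrite IH //.
  under [RHS]eq_bigr => k _ do rewrite exprS mxE mulr_sumr.
  apply: eq_bigr => i _.
  rewrite exchange_big /=; apply: eq_bigr => k _.
  rewrite mxE mulr_suml mulr_sumr; apply: eq_bigr => j _.
  rewrite -rcons_cons triples_rcons ?size_rcons //.
  rewrite -cats1 big_cat big_seq1 /= mulrA. done.
rewrite /mxtrace; apply: eq_bigr => i _; rewrite exprS mxE.
under [RHS]eq_bigr => j _ do rewrite claim //.
rewrite exchange_big /=; apply: eq_bigr => k _.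
by rewrite mxE mulr_suml; apply: eq_bigr => j _; rewrite /triples /= big_seq1.
Qed.

(** The same closed walks read from a column vertex, as y_0, x_0, y_1, x_1, ...; the row vertex
    before y_0 is then the last one, hence [rotr]. This root gives the bound with [p2] in front. *)
Lemma trace_exp_walk_col q :
  \tr (M ^+ q.+1) = \sum_j \sum_i walk_sum (fun y x =>
    \prod_(t <- triples (rotr 1 x) y x) h t.1.1 t.1.2 t.2) q [:: j] [:: i].
Proof.
pose f (y : seq 'I_n) (x : seq 'I_m) := \prod_(t <- triples (rotr 1 x) y x) h t.1.1 t.1.2 t.2.
rewrite -/f.
have claim p x y l : size (rcons x l) = size y ->
    walk_sum f p y (rcons x l) =
    \sum_k (\prod_(t <- triples (k :: x) y (rcons x l)) h t.1.1 t.1.2 t.2) * (M ^+ p) l k.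
  elim: p x y l => [|p IH] x y l sxy.
    rewrite /= /f rotr1_rcons (bigD1 l) //= [X in _ = _ + X]big1.
      by rewrite addr0 mxE eqxx mulr1.
    by move=> k /negbTE ka; rewrite mxE eq_sym ka mulr0.
  have sz i j : size (rcons (rcons x l) i) = size (rcons y j).
    by rewrite !size_rcons -sxy size_rcons.
  rewrite [LHS]/= exchange_big /=.
  under eq_bigr => i _ do under eq_bigr => j _ do rewrite IH //.
  under [RHS]eq_bigr => k _ do rewrite exprS mxE mulr_sumr.
  rewrite [RHS]exchange_big /=; apply: eq_bigr => i _.
  rewrite exchange_big /=; apply: eq_bigr => k _.
  rewrite mxE mulr_suml mulr_sumr; apply: eq_bigr => j _.
  rewrite -rcons_cons triples_rcons ?size_rcons //=; last by rewrite -sxy size_rcons.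
  by rewrite -cats1 big_cat big_seq1 /= mulrA.
rewrite exchange_big /mxtrace /=.
under eq_bigr => i _ do rewrite exprS mxE.
rewrite exchange_big /=; apply: eq_bigr => i _.
under [RHS]eq_bigr => j _ do rewrite (claim q [::] [:: j] i) //.
rewrite exchange_big /=; apply: eq_bigr => k _.
by rewrite mxE mulr_suml; apply: eq_bigr => j _; rewrite /triples /= big_seq1.
Qed.

End Trace.

Lemma walk_sum_eq {R : nmodType} {I J : finType} (f f' : seq I -> seq J -> R) n x y :
  (forall x y, f x y = f' x y) -> walk_sum f n x y = walk_sum f' n x y.
Proof.
move=> ff; elim: n x y => [|n IH] x y //=.
by apply: eq_bigr => i _; apply: eq_bigr => j _.
Qed.

Lemma mem_triples (T U : eqType) (x : seq T) (y : seq U) (x' : seq T) t :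
  t \in triples x y x' -> [/\ t.1.1 \in x, t.1.2 \in y & t.2 \in x'].
Proof. by move=> /mem_zip[/mem_zip[]]. Qed.

Lemma map_triples (T U T' U' : Type) (f : T -> T') (f' : U -> U') x y x' :
  triples (map f x) (map f' y) (map f x') =
  [seq (f t.1.1, f' t.1.2, f t.2) | t <- triples x y x'].
Proof.
rewrite /triples; elim: x y x' => [|a x IH] [|b y] [|c x'] //=.
by rewrite IH.
Qed.

Lemma index_inj_in (T : eqType) (x : seq T) : {in x &, injective (index ^~ x)}.
Proof.
by move=> a b ax bx /(congr1 (nth a x)); rewrite !nth_index.
Qed.

Lemma edges_of_triples (T U : eqType) (x : seq T) (y : seq U) x' :
  size x = size y -> size x' = size y ->
  edges_of (triples x y x') = zip x y ++ zip x' y.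
Proof.
rewrite /edges_of /triples => sx sx'; rewrite -/unzip1 unzip1_zip; last first.
  by rewrite size_zip sx sx' minnn.
congr cat; elim: x y x' sx sx' => [|a x IH] [|b y] [|c x'] //= [sx] [sx'].
by rewrite IH.
Qed.

Lemma zip_swap (T U : Type) (x : seq T) (y : seq U) :
  [seq (e.2, e.1) | e <- zip x y] = zip y x.
Proof. by elim: x y => [|a x IH] [|b y] //=; rewrite IH. Qed.

Lemma edge_weight_swap {R : realType} (I J : finType) (s : I -> J -> R) E :
  edge_weight s E = edge_weight (fun j i => s i j) [seq (e.2, e.1) | e <- E].
Proof.
rewrite /edge_weight (reindex (fun e : J * I => (e.2, e.1))) /=; last first.
  by exists (fun e : I * J => (e.2, e.1)) => -[].
apply: eq_bigl => -[j i] /=; apply/idP/mapP => [ijE|[[i' j'] ijE [-> ->]] //].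
by exists (i, j).
Qed.

(** * Comparison of closed walks rooted at a row or at a column *)

Section ShapeComparison.
Context {R : realType} (p1 p2 m1 m2 : nat).
Variables (s : 'I_p1 -> 'I_p2 -> R) (g : nat -> nat -> R) (N q : nat).
Hypothesis s0 : forall i j, 0 <= s i j.
Hypothesis s1 : forall i j, s i j <= 1.
Hypothesis g0 : forall a b, 0 <= g a b.
Hypothesis N1 : (N <= m1)%N.
Hypothesis N2 : (N <= m2)%N.
Hypothesis sum_col : forall j, \sum_i s i j <= m1%:R - N%:R.
Hypothesis sum_row : forall i, \sum_j s i j <= m2%:R - N%:R.
Hypothesis qN : (q < N)%N.

Lemma shape_comparison_row (f : seq 'I_p1 -> seq 'I_p2 -> R) :
  (forall x y, size x = size y -> size x = q.+1 ->
    f x y <= edge_weight s (edges_of (triples x y (rot 1 x))) *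
             shape_prod g (triples x y (rot 1 x))) ->
  m1%:R * (\sum_i \sum_j walk_sum f q [:: i] [:: j]) <=
  p1%:R * (\sum_(i < m1) \sum_(j < m2)
    walk_sum (fun x y => shape_prod g (triples x y (rot 1 x))) q [:: i] [:: j]).
Proof.
move=> ff; pose F (x y : seq nat) := shape_prod g (triples x y (rot 1 x)).
have FE (T U : eqType) (x : seq T) (y : seq U) :
    F (canon x) (canon y) = shape_prod g (triples x y (rot 1 x)).
  rewrite /F /canon -map_rot map_triples.
  apply: (shape_prod_map g (@index_inj_in _ x) (@index_inj_in _ y)).
  by move=> t /mem_triples[? ?]; rewrite mem_rot.
have := @walk_sum_comparison R _ _ s s0 s1 'I_m1 'I_m2 N F _ _ _ _ _ f q.
rewrite !card_ord => H; apply: le_trans (H _ _ _ _ _ _ qN) _ => //.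
- by move=> x y; apply: shape_prod_ge0.
- move=> x y sxy sxq; apply: le_trans (ff _ _ sxy sxq) _.
  rewrite FE ler_wpM2r ?shape_prod_ge0 // edge_weight_sub //.
  (* The open edges lie among those of the closed walk, and a larger set of edges has smaller
     weight. *)
  move=> e; rewrite edges_of_triples ?size_rot // !mem_cat.
  case/orP => [->//|]; case: x {ff} sxy sxq => [|a x] //= sxy _ ex.
  apply/orP; right; rewrite rot1_cons.
  case: (lastP y) sxy ex => [|y' l] //=; rewrite size_rcons => -[sxy].
  by rewrite zip_rcons_trunc // zip_rcons // mem_rcons inE => ->; rewrite orbT.
- rewrite ler_wpM2l //; apply: ler_sum => i _; apply: ler_sum => j _.
  by rewrite (walk_sum_eq _ _ _ (fun x y => FE _ _ x y)).
Qed.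

Lemma shape_comparison_col (f : seq 'I_p2 -> seq 'I_p1 -> R) :
  (forall y x, size y = size x -> size y = q.+1 ->
    f y x <= edge_weight s (edges_of (triples (rotr 1 x) y x)) *
             shape_prod g (triples (rotr 1 x) y x)) ->
  m2%:R * (\sum_j \sum_i walk_sum f q [:: j] [:: i]) <=
  p2%:R * (\sum_(j < m2) \sum_(i < m1)
    walk_sum (fun y x => shape_prod g (triples (rotr 1 x) y x)) q [:: j] [:: i]).
Proof.
move=> ff; pose F (y x : seq nat) := shape_prod g (triples (rotr 1 x) y x).
have FE (T U : eqType) (x : seq T) (y : seq U) :
    F (canon y) (canon x) = shape_prod g (triples (rotr 1 x) y x).
  rewrite /F /canon -map_rotr map_triples.
  apply: (shape_prod_map g (@index_inj_in _ x) (@index_inj_in _ y)).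
  by move=> t /mem_triples[]; rewrite mem_rotr.
have := @walk_sum_comparison R _ _ (fun j i => s i j) _ _ 'I_m2 'I_m1 N F _ _ _ _ _ f q.
rewrite !card_ord => H; apply: le_trans (H _ _ _ _ _ _ _ _ qN) _ => //.
- by move=> x y; apply: shape_prod_ge0.
- move=> y x sxy sxq; apply: le_trans (ff _ _ sxy sxq) _.
  rewrite FE ler_wpM2r ?shape_prod_ge0 //.
  rewrite edge_weight_swap edge_weight_sub // => e.
  rewrite edges_of_triples ?size_rotr // map_cat !zip_swap !mem_cat orbC.
  case/orP => [ex|->]; last by rewrite orbT.
  apply/orP; left; case: y {ff} sxy sxq ex => [|b y] //= sxy _.
  case: (lastP x) sxy => [|x' l] //=; rewrite size_rcons => -[sxy].
  by rewrite zip_rcons_trunc // rotr1_rcons /= inE => ->; rewrite orbT.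
- rewrite ler_wpM2l //; apply: ler_sum => i _; apply: ler_sum => j _.
  by rewrite (walk_sum_eq _ _ _ (fun x y => FE _ _ y x)).
Qed.

End ShapeComparison.

(** * Quadratic forms and a lattice net *)

Section QuadraticForms.
Context {R : realType}.
Implicit Types m n : nat.

Definition nrm2 {n} (x : 'cV[R]_n) : R := \sum_i x i 0 ^+ 2.
Definition bil {m n} (M : 'M[R]_(m, n)) (x : 'cV[R]_m) (y : 'cV[R]_n) : R :=
  (x^T *m M *m y) 0 0.

Lemma nrm2_ge0 n (x : 'cV[R]_n) : 0 <= nrm2 x.
Proof. by apply: sumr_ge0 => i _; exact: sqr_ge0. Qed.

Lemma nrm2_eq0 n (x : 'cV[R]_n) : nrm2 x = 0 -> x = 0.
Proof.
move=> /eqP; rewrite psumr_eq0 => [/allP x0|i _]; last exact: sqr_ge0.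
apply/colP => i; rewrite mxE.
by have /(_ i (mem_index_enum _)) := x0; rewrite /= sqrf_eq0 => /eqP.
Qed.

Lemma nrm2Z n a (x : 'cV[R]_n) : nrm2 (a *: x) = a ^+ 2 * nrm2 x.
Proof. by rewrite /nrm2 mulr_sumr; apply: eq_bigr => i _; rewrite mxE exprMn. Qed.

Lemma nrm2_parallelogram n (x y : 'cV[R]_n) :
  nrm2 (x + y) + nrm2 (x - y) = 2 * nrm2 x + 2 * nrm2 y.
Proof.
rewrite /nrm2 !mulr_sumr -!big_split /=; apply: eq_bigr => i _.
by rewrite !mxE; ring.
Qed.

Lemma nrm2E n (x : 'cV[R]_n) : nrm2 x = (x^T *m x) 0 0.
Proof. by rewrite mxE; apply: eq_bigr => i _; rewrite mxE expr2. Qed.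

Lemma bilE m n (M : 'M[R]_(m, n)) x y : bil M x y = \sum_i \sum_j x i 0 * M i j * y j 0.
Proof.
rewrite /bil -mulmxA mxE; apply: eq_bigr => i _.
by rewrite !mxE mulr_sumr; apply: eq_bigr => j _; rewrite mulrA.
Qed.

Lemma bilZl m n (M : 'M[R]_(m, n)) a x y : bil M (a *: x) y = a * bil M x y.
Proof. by rewrite /bil linearZ /= -!scalemxAl mxE. Qed.

Lemma bilZr m n (M : 'M[R]_(m, n)) a x y : bil M x (a *: y) = a * bil M x y.
Proof. by rewrite /bil -scalemxAr mxE. Qed.

Lemma bilC n (M : 'M[R]_n) x y : M^T = M -> bil M x y = bil M y x.
Proof.
move=> Ms; rewrite !bilE exchange_big /=; apply: eq_bigr => i _; apply: eq_bigr => j _.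
by rewrite -{1}Ms mxE; ring.
Qed.

Lemma bilDl m n (M : 'M[R]_(m, n)) x x' y : bil M (x + x') y = bil M x y + bil M x' y.
Proof. by rewrite /bil linearD /= !mulmxDl mxE. Qed.

Lemma bilDr m n (M : 'M[R]_(m, n)) x y y' : bil M x (y + y') = bil M x y + bil M x y'.
Proof. by rewrite /bil mulmxDr mxE. Qed.

Lemma bilNl m n (M : 'M[R]_(m, n)) x y : bil M (- x) y = - bil M x y.
Proof. by rewrite -scaleN1r bilZl mulN1r. Qed.

Lemma bilNr m n (M : 'M[R]_(m, n)) x y : bil M x (- y) = - bil M x y.
Proof. by rewrite -scaleN1r bilZr mulN1r. Qed.

Lemma nrm2_mulmx n (M : 'M[R]_n) x : M^T = M -> nrm2 (M *m x) = bil M x (M *m x).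
Proof. by move=> Ms; rewrite nrm2E /bil trmx_mul Ms !mulmxA. Qed.

(** The sum of the squares of [A * b i - S * a i] equals [A * (A * B - S ^+ 2)]; if [A] is 0, all
    [a i] vanish. *)
Lemma sum_mul_sqr_le (I : finType) (a b : I -> R) :
  (\sum_i a i * b i) ^+ 2 <= (\sum_i a i ^+ 2) * (\sum_i b i ^+ 2).
Proof.
set A := \sum_i a i ^+ 2; set B := \sum_i b i ^+ 2; set S := \sum_i _.
have A0 : 0 <= A by apply: sumr_ge0 => i _; exact: sqr_ge0.
have H : \sum_i (A * b i - S * a i) ^+ 2 = A * (A * B - S ^+ 2).
  have -> : A * (A * B - S ^+ 2) = A ^+ 2 * B - 2 * A * S * S + S ^+ 2 * A by ring.
  have -> : A ^+ 2 * B = \sum_i A ^+ 2 * b i ^+ 2 by rewrite mulr_sumr.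
  have -> : 2 * A * S * S = \sum_i 2 * A * S * (a i * b i) by rewrite mulr_sumr.
  have -> : S ^+ 2 * A = \sum_i S ^+ 2 * a i ^+ 2 by rewrite mulr_sumr.
  by rewrite -sumrB -big_split /=; apply: eq_bigr => i _; ring.
have H0 : 0 <= A * (A * B - S ^+ 2).
  by rewrite -H; apply: sumr_ge0 => i _; exact: sqr_ge0.
move: A0; rewrite le_eqVlt => /orP[/eqP A0|A0]; last first.
  by move: H0; rewrite pmulr_rge0 // subr_ge0.
have a0 i : a i = 0.
  move/esym/eqP: A0; rewrite psumr_eq0 => [/allP a0|j _]; last exact: sqr_ge0.
  by have /(_ i (mem_index_enum _)) := a0; rewrite /= sqrf_eq0 => /eqP.
rewrite [S]big1 => [|i _]; last by rewrite a0 mul0r.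
by rewrite expr0n /= -A0 mul0r.
Qed.

Lemma nrm2_mulmx_le m n (M : 'M[R]_(m, n)) (x : 'cV[R]_n) :
  nrm2 (M *m x) <= (\sum_i \sum_j M i j ^+ 2) * nrm2 x.
Proof.
rewrite /nrm2 mulr_suml; apply: ler_sum => i _; rewrite mxE.
exact: sum_mul_sqr_le.
Qed.

Lemma trmx_exp n (M : 'M[R]_n) k : M^T = M -> (M ^+ k)^T = M ^+ k.
Proof.
move=> Ms; elim: k => [|k IH]; first by rewrite expr0 trmx1.
by rewrite exprSr -[in LHS]mulmxE trmx_mul Ms IH mulmxE -exprS exprSr.
Qed.

Lemma trace_exp_double n (M : 'M[R]_n) k : M^T = M ->
  \tr (M ^+ k.*2) = \sum_i \sum_j (M ^+ k) i j ^+ 2.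
Proof.
move=> Ms; rewrite -addnn exprD -mulmxE; apply: eq_bigr => i _.
rewrite mxE; apply: eq_bigr => j _.
by rewrite -[in X in _ * X](trmx_exp k Ms) mxE expr2.
Qed.

(* Cauchy-Schwarz makes k |-> |M^k x| log-convex along powers of two. *)
Lemma nrm2_mulmx_exp2_le n (M : 'M[R]_n) (x : 'cV[R]_n) j : M^T = M -> nrm2 x = 1 ->
  nrm2 (M *m x) ^+ (2 ^ j) <= nrm2 (M ^+ (2 ^ j) *m x).
Proof.
move=> Ms x1; elim: j M Ms => [|j IH] M Ms; first by rewrite expn0 !expr1.
have MMs : (M *m M)^T = M *m M by rewrite trmx_mul Ms.
rewrite expnS mulnC [in leRHS]mulnC exprM.
have step : nrm2 (M *m x) ^+ 2 <= nrm2 (M *m M *m x).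
  have -> : nrm2 (M *m x) = \sum_i x i 0 * (M *m M *m x) i 0.
    rewrite nrm2E trmx_mul Ms -!mulmxA mxE; apply: eq_bigr => i _.
    by rewrite mxE.
  by apply: le_trans (sum_mul_sqr_le _ _) _; rewrite -/(nrm2 x) x1 mul1r.
rewrite -exprM mulnC !exprM; apply: le_trans (_ : nrm2 (M *m M *m x) ^+ (2 ^ j) <= _).
  by rewrite lerXn2r ?nnegrE ?exprn_ge0 ?nrm2_ge0.
by have := IH _ MMs; rewrite mulmxE -expr2.
Qed.

(** The squared Frobenius norm of M^(2^j) bounds |M^(2^j) x|^2 and equals the trace of M^(2^(j+1)),
    so no eigenvalues are involved. *)
Lemma nrm2_mulmx_trace n (M : 'M[R]_n) (x : 'cV[R]_n) j : M^T = M -> nrm2 x = 1 ->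
  nrm2 (M *m x) ^+ (2 ^ j) <= \tr (M ^+ (2 ^ j.+1)).
Proof.
move=> Ms x1; apply: le_trans (nrm2_mulmx_exp2_le j Ms x1) _.
by rewrite expnS mul2n trace_exp_double // -[leRHS]mulr1 -x1 nrm2_mulmx_le.
Qed.

Section QuadBound.
Context {n : nat} (M : 'M[R]_n).
Hypothesis Ms : M^T = M.
Variable t : R.
Hypothesis quad_le : forall x, `|bil M x x| <= t * nrm2 x.
Hypothesis t0 : 0 <= t.

Lemma bil_le x y : `|bil M x y| <= t * (nrm2 x + nrm2 y) / 2.
Proof.
have -> : bil M x y = (bil M (x + y) (x + y) - bil M (x - y) (x - y)) / 4.
  by rewrite !(bilDl, bilDr, bilNl, bilNr) (bilC y x Ms); field.
rewrite normrM [X in _ * X]ger0_norm ?invr_ge0 // ler_pdivrMr //.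
apply: le_trans (ler_normB _ _) _.
apply: le_trans (lerD (quad_le _) (quad_le _)) _.
by rewrite -mulrDr nrm2_parallelogram; rewrite le_eqVlt; apply/orP; left; apply/eqP; field.
Qed.

Lemma nrm2_mulmx_quad x : nrm2 (M *m x) <= t ^+ 2 * nrm2 x.
Proof.
(* With [x] scaled by [t] the bound reads t w <= t (t^2 |x|^2 + w) / 2, and [w] can be absorbed on
   the left when t > 0. *)
have H := bil_le (t *: x) (M *m x).
move: H; rewrite bilZl -nrm2_mulmx // nrm2Z.
set w := nrm2 (M *m x); have w0 : 0 <= w := nrm2_ge0 _.
rewrite ger0_norm ?mulr_ge0 // -mulrA.
move: t0; rewrite le_eqVlt => /orP[/eqP t00 _|tp]; last first.
  by rewrite ler_pM2l //; lra.
have := bil_le x (M *m x); rewrite -nrm2_mulmx // -/w -t00 !mul0r normr_le0.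
by move=> /eqP ->; rewrite expr0n mul0r.
Qed.

Lemma nrm2_exp_quad k x : nrm2 (M ^+ k *m x) <= t ^+ k.*2 * nrm2 x.
Proof.
elim: k => [|k IH]; first by rewrite expr0 mul1mx double0 expr0 mul1r.
rewrite exprS -mulmxE -mulmxA; apply: le_trans (nrm2_mulmx_quad _) _.
have -> : t ^+ k.+1.*2 = t ^+ 2 * t ^+ k.*2 by rewrite -exprD doubleS.
by rewrite -mulrA ler_wpM2l ?sqr_ge0.
Qed.

(** The trace is the sum of |M^k e_j|^2 over the basis vectors, each at most t^(2k). *)
Lemma trace_exp_quad k : \tr (M ^+ k.*2) <= n%:R * t ^+ k.*2.
Proof.
rewrite trace_exp_double // exchange_big /=.
rewrite mulr_natl -[X in _ *+ X]card_ord -sumr_const; apply: ler_sum => j _.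
have := nrm2_exp_quad k (delta_mx j 0).
have -> : nrm2 (delta_mx j 0) = 1.
  rewrite /nrm2 (bigD1 j) //= big1 ?addr0 => [|i /negbTE ij]; rewrite mxE ?eqxx ?expr1n //.
  by rewrite ij expr0n.
rewrite mulr1; apply: le_trans; rewrite le_eqVlt; apply/orP; left; apply/eqP; apply: eq_bigr => i _.
by rewrite -colE mxE.
Qed.

End QuadBound.

(* Rounding towards zero keeps the lattice points inside the unit ball. *)
Definition lattice_point {m : nat} (z : {ffun 'I_m -> bool * 'I_(4 * m).+1}) : 'cV[R]_m :=
  \col_i ((-1) ^+ (z i).1 * (z i).2%:R / (4 * Num.sqrt m%:R)).

(** The mesh is 1 / (4 sqrt m), so the m squared errors, each at most 1 / (16 m), add up to 1/16.
    Coordinates are at most 1 in absolute value, so the integers needed do not exceed 4 sqrt m <= 4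
    m. *)
Lemma lattice_approx m (u : 'cV[R]_m) : (0 < m)%N -> nrm2 u <= 1 ->
  exists z, nrm2 (lattice_point z) <= 1 /\ nrm2 (u - lattice_point z) <= 16^-1.
Proof.
move=> m0 u1; set s : R := Num.sqrt m%:R.
have s2 : s ^+ 2 = m%:R by rewrite sqr_sqrtr.
have sp : 0 < s by rewrite sqrtr_gt0 ltr0n.
have m1 : (1 : R) <= m%:R by rewrite ler1n.
have s1 : 1 <= s by rewrite leNgt; apply/negP => s1; nra.
have sm : s <= m%:R by nra.
have ui i : `|u i 0| <= 1.
  rewrite -(@ler_pXn2r _ 2) ?nnegrE // expr1n -normrX ger0_norm ?sqr_ge0 //.
  by apply: le_trans u1; rewrite /nrm2 (bigD1 i) //= lerDl sumr_ge0 // => j _; exact: sqr_ge0.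
pose a i := 4 * s * `|u i 0|.
have a0 i : 0 <= a i by rewrite !mulr_ge0 // ltW.
have am i : (Num.truncn (a i) < (4 * m).+1)%N.
  rewrite ltnS -(ler_nat R); apply: le_trans (_ : a i <= _).
    by have /andP[] := truncn_itv (a0 i).
  rewrite natrM /a -mulrA ler_wpM2l //; apply: le_trans sm.
  by rewrite ler_piMr // ltW.
pose z := [ffun i => (u i 0 < 0, Ordinal (am i))].
have zE i : lattice_point z i 0 = (-1) ^+ (u i 0 < 0)%R * (Num.truncn (a i))%:R / (4 * s).
  by rewrite mxE ffunE.
have uE i : u i 0 = (-1) ^+ (u i 0 < 0)%R * a i / (4 * s).
  by rewrite /a [4 * s * _]mulrC mulrA mulfK ?mulf_neq0 ?gt_eqF // -numEsign.
have tr i : 0 <= a i - (Num.truncn (a i))%:R <= 1 /\ (0 <= (Num.truncn (a i))%:R :> R).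
  have /andP[h1 h2] := truncn_itv (a0 i); split; last exact: ler0n.
  by rewrite subr_ge0 h1 /= lerBlDr addrC natr1 ltW.
exists z; split.
  apply: le_trans u1; apply: ler_sum => i _; rewrite zE [in leRHS]uE.
  rewrite !exprMn ler_wpM2r ?sqr_ge0 // ler_wpM2l ?sqr_ge0 //.
  rewrite -!exprMn -/(a i).
  by have [/andP[h1 h2] h3] := tr i; rewrite lerXn2r ?nnegrE // -subr_ge0.
apply: (@le_trans _ _ (\sum_(i < m) (16 * s ^+ 2)^-1)); last first.
  rewrite sumr_const card_ord s2 -[leLHS]mulr_natr invfM -mulrA mulVf ?mulr1 //.
  by rewrite pnatr_eq0 -lt0n.
apply: ler_sum => i _; rewrite mxE [in leLHS]mxE zE {1}uE -mulrBl -mulrBr.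
rewrite !exprMn sqrr_sign mul1r exprVn exprMn.
have -> : 4 ^+ 2 = 16 :> R by ring.
rewrite ler_piMl ?invr_ge0 ?mulr_ge0 ?sqr_ge0 ?(ltW sp) //.
by have [/andP[h1 h2] h3] := tr i; rewrite exprn_ile1.
Qed.

(** The supremum [t] of the form over the unit ball satisfies t <= b + 5/8 t. Since [t] is finite,
    this yields t <= 8/3 b. *)
Lemma quad_le_lattice m (M : 'M[R]_m) (b : R) : (0 < m)%N -> M^T = M -> 0 <= b ->
  (forall z, nrm2 (lattice_point z) <= 1 ->
     `|bil M (lattice_point z) (lattice_point z)| <= b) ->
  forall x, `|bil M x x| <= 3 * b * nrm2 x.
Proof.
move=> m0 Ms b0 Hz.
pose A := [set `|bil M x x| | x in [set x | nrm2 x <= 1]].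
have supA : has_sup A.
  split; first by exists `|bil M 0 0|; exists 0 => //=; rewrite /nrm2 big1 // => i _; rewrite mxE expr0n.
  exists (\sum_i \sum_j `|M i j|) => _ [x /= x1 <-].
  have xi i : `|x i 0| <= 1.
    rewrite -(@ler_pXn2r _ 2) ?nnegrE // expr1n -normrX ger0_norm ?sqr_ge0 //.
    by apply: le_trans x1; rewrite /nrm2 (bigD1 i) //= lerDl sumr_ge0 // => j _; exact: sqr_ge0.
  rewrite bilE; apply: le_trans (ler_norm_sum _ _ _) _; apply: ler_sum => i _.
  apply: le_trans (ler_norm_sum _ _ _) _; apply: ler_sum => j _.
  rewrite !normrM; apply: le_trans (ler_piMr _ (xi j)) _; first by rewrite mulr_ge0.
  exact: ler_piMl.
pose t := sup A.
have tub x : nrm2 x <= 1 -> `|bil M x x| <= t.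
  by move=> x1; apply: (ub_le_sup supA.2); exists x.
have t0 : 0 <= t by apply: le_trans (tub 0 _) => //; rewrite /nrm2 big1 // => i _; rewrite mxE expr0n.
have tq x : `|bil M x x| <= t * nrm2 x.
  have [/eqP/nrm2_eq0 ->|nx] := boolP (nrm2 x == 0).
    by rewrite -[X in bil _ X _](scale0r (0 : 'cV[R]_m)) bilZl mul0r normr0 mulr_ge0 ?nrm2_ge0.
  have np : 0 < nrm2 x by rewrite lt_def nx nrm2_ge0.
  set r := Num.sqrt (nrm2 x); have r2 : r ^+ 2 = nrm2 x by rewrite sqr_sqrtr ?nrm2_ge0.
  have := tub (r^-1 *: x); rewrite nrm2Z exprVn r2 mulVf // lexx => /(_ isT).
  rewrite bilZl bilZr mulrA -expr2 exprVn r2 normrM [X in X * _]ger0_norm ?invr_ge0 ?nrm2_ge0 //.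
  by rewrite mulrC ler_pdivrMr.
suff tb : t <= 3 * b.
  by move=> x; apply: le_trans (tq x) _; rewrite ler_wpM2r ?nrm2_ge0.
suff H : t <= b + 5 / 8 * t by lra.
apply: ge_sup; first exact: supA.1.
move=> _ [u /= u1 <-]; have [z [z1 uz]] := lattice_approx m0 u1.
set x := lattice_point z in z1 uz.
(* The factors 2 and 1/2 bring |u - x| <= 1/4 and |u + x| <= 2 closer in size: (4 / 16 + 4 / 4) / 2
   = 5/8. *)
have -> : bil M u u = bil M x x + bil M (2 *: (u - x)) (2^-1 *: (u + x)).
  rewrite bilZl bilZr mulrA divff // mul1r !(bilDl, bilDr, bilNl) (bilC x u Ms).
  by ring.
apply: le_trans (ler_normD _ _) _; apply: lerD; first exact: Hz.
apply: le_trans (bil_le Ms tq _ _) _; rewrite !nrm2Z.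
have := nrm2_parallelogram u x; have := nrm2_ge0 (u - x).
set A1 := nrm2 (u - x) in uz *; set A2 := nrm2 (u + x) => h1 h2.
nra.
Qed.

End QuadraticForms.

(** * The comparison law *)

Section Elementary.
Context {R : realType}.

(** For a centered variable the linear term averages to 0, which leaves a quadratic error; both
    bounds on moment generating functions start here. *)
Lemma expR_le_quad (t : R) : expR t <= 1 + t + t ^+ 2 * expR `|t|.
Proof.
have h1 := expR_ge1Dx (- t); have e0 := expR_gt0 t; have e1 := expR_gt0 (- t).
have ee : expR t * expR (- t) = 1 by rewrite -expRD subrr expR0.
have [t0|t0] := leP 0 t.
  have h2 := expR_ge1Dx t; rewrite ger0_norm //.
  have h3 : expR t - 1 <= t * expR t by nra.
  nra.
rewrite ltr0_norm //; have h2 := expR_ge1Dx t.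
have h3 : 1 <= expR (- t) by nra.
have h4 : expR t * (1 - t) <= 1 by nra.
have h5 : expR t <= 1 + t + t ^+ 2 by nra.
by apply: le_trans h5 _; rewrite lerD2l ler_peMr ?sqr_ge0.
Qed.

Lemma geometric_sum_le (c : R) n : 0 <= c -> c < 1 -> (1 - c) * \sum_(i < n) c ^+ i <= 1.
Proof.
move=> c0 c1; have := subrX1 c n; set S := \sum_(i < n) _ => H.
have cn : 0 <= c ^+ n by exact: exprn_ge0.
nra.
Qed.

Lemma expR_quarter_le : expR (4^-1 : R) <= 4 / 3.
Proof.
have h1 := expR_ge1Dx (- 4^-1 : R); have e0 := expR_gt0 (4^-1 : R).
have ee : expR (4^-1 : R) * expR (- 4^-1) = 1 by rewrite -expRD subrr expR0.
nra.
Qed.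

End Elementary.

(* The comparison law: value -1, and values r = 2, ..., L + 1 with weights
   proportional to 2^-(r^2), the weight of -1 being set by centering. *)
Section ComparisonLaw.
Context {R : realType} (L : nat).

Definition law_weight (j : nat) : R := 2^-1 ^+ (j.+2 ^ 2).
Definition law_total : R := \sum_(j < L) law_weight j * (1 + j.+2%:R).
Definition law_prob (k : nat) : R :=
  (if k is j.+1 then law_weight j else \sum_(j < L) law_weight j * j.+2%:R) / law_total.
Definition law_val (k : nat) : R := if k is j.+1 then j.+2%:R else - 1.
Definition law_mean (f : R -> R) : R := \sum_(k < L.+1) law_prob k * f (law_val k).
Definition law_var : R := law_mean (fun y => y ^+ 2).
Definition law_moment (a b : nat) : R :=
  law_mean (fun y => y ^+ a * (y ^+ 2 - law_var) ^+ b).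

Local Notation u := law_weight.
Local Notation W := law_total.
Local Notation v := law_var.

Lemma law_meanE f :
  law_mean f = (\sum_(j < L) u j * (f j.+2%:R + j.+2%:R * f (- 1))) / W.
Proof.
rewrite /law_mean big_ord_recl /= /law_prob; set w := W^-1.
rewrite !mulr_suml -big_split /=; apply: eq_bigr => j _.
by rewrite /=; ring.
Qed.

Hypothesis L0 : (0 < L)%N.

Lemma law_weight_gt0 j : 0 < u j.
Proof. by rewrite exprn_gt0. Qed.

Lemma law_weight_le j n : (n <= j.+2 ^ 2)%N -> u j <= 2^-1 ^+ n.
Proof. by move=> h; rewrite ler_wiXn2l // ?invf_le1 // ler1n. Qed.

Lemma law_total_ge : 3 / 16 <= W.
Proof.
rewrite /law_total; case: L L0 => // L' _; rewrite big_ord_recl /=.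
apply: le_trans (_ : u 0 * (1 + 2%:R) <= _); last first.
  by rewrite lerDl sumr_ge0 // => j _; rewrite mulr_ge0 ?ltW ?law_weight_gt0 // addr_ge0.
rewrite /law_weight; lra.
Qed.

Lemma law_total_gt0 : 0 < W.
Proof. by apply: lt_le_trans law_total_ge; lra. Qed.

Lemma law_total_le1 : W <= 1.
Proof.
apply: le_trans (_ : \sum_(j < L) (3 / 16) * (8^-1 : R) ^+ j <= _); last first.
  rewrite -mulr_sumr; have := @geometric_sum_le R 8^-1 L ltac:(lra) ltac:(lra); lra.
apply: ler_sum => j _.
have h1 : (1 + j.+2%:R : R) <= 3 * 2 ^+ j.
  rewrite nat1r -natrX -(natrM R 3) ler_nat.
  elim: (nat_of_ord j) => // i; rewrite expnS; lia.
have h2 : u j <= 2^-1 ^+ (4 + 4 * j) by apply: law_weight_le; lia.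
apply: le_trans (ler_pM _ _ h2 h1) _; [exact/ltW/law_weight_gt0|exact: addr_ge0|].
rewrite exprD exprM.
have -> : (2^-1 : R) ^+ 4 = 16^-1 by field.
rewrite mulrACA -exprMn; have -> : 16^-1 * 2 = 8^-1 :> R by field.
by rewrite [16^-1 * 3]mulrC.
Qed.

Lemma law_prob_ge0 k : 0 <= law_prob k.
Proof.
rewrite /law_prob divr_ge0 ?(ltW law_total_gt0) //.
case: k => [|j]; last exact/ltW/law_weight_gt0.
by apply: sumr_ge0 => j _; rewrite mulr_ge0 // ltW // law_weight_gt0.
Qed.

Lemma law_prob_sum : \sum_(k < L.+1) law_prob k = 1.
Proof.
have := law_meanE (fun _ => 1); rewrite /law_mean.
under eq_bigr => k _ do rewrite mulr1.
by move=> ->; under eq_bigr => j _ do rewrite mulr1; rewrite divff // gt_eqF // law_total_gt0.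
Qed.

Lemma law_centered : law_mean id = 0.
Proof. by rewrite law_meanE big1 ?mul0r // => j _; rewrite mulrN1 subrr mulr0. Qed.

(** The atom r together with its share of the atom -1 is, after normalization, a centered two-point
    law of variance r, so [v] is an average of the values r >= 2. *)
Lemma law_var_ge2 : 2 <= v.
Proof.
rewrite /law_var law_meanE ler_pdivlMr ?law_total_gt0 // /law_total mulr_sumr.
apply: ler_sum => j _; rewrite mulrCA ler_wpM2l ?(ltW (law_weight_gt0 _)) //.
have : (2 : R) <= j.+2%:R by rewrite (ler_nat R 2).
nra.
Qed.

(** The value r = 2 dominates the average. The bound 9/4 is what [law_gap] needs: it gives v - 1 <=
    5/4 and r^2 - v >= 7/4. *)
Lemma law_var_le : v <= 9 / 4.
Proof.
rewrite /law_var law_meanE ler_pdivrMr ?law_total_gt0 // /law_total mulr_sumr.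
rewrite -subr_ge0 -sumrB.
case: L L0 => // L' _; rewrite big_ord_recl /=.
set S := \sum_(i < L') _.
suff HS : - S <= 3 / 512 * (8 / 7) by rewrite /law_weight; lra.
rewrite /S -sumrN.
apply: le_trans (_ : \sum_(i < L') (3 / 512) * (8^-1 : R) ^+ i <= _); last first.
  rewrite -mulr_sumr; have := @geometric_sum_le R 8^-1 L' ltac:(lra) ltac:(lra); lra.
apply: ler_sum => i _; rewrite /bump /= add1n.
set x : R := i%:R; have x0 : 0 <= x by exact: ler0n.
have -> : i.+3%:R = x + 3 :> R by rewrite -addn3 natrD.
have h1 : (x + 4) * (x + 3 / 4) <= 3 * 8 ^+ i.
  rewrite /x; elim: (nat_of_ord i) => [|k IH]; first by rewrite expr0; lra.
  rewrite exprS -natr1; have : 0 <= k%:R :> R by []. 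
  nra.
have h2 : u i.+1 <= 2^-1 ^+ (9 + 6 * i) by apply: law_weight_le; lia.
apply: le_trans (_ : u i.+1 * ((x + 4) * (x + 3 / 4)) <= _).
  by rewrite le_eqVlt; apply/orP; left; apply/eqP; field.
apply: le_trans (ler_pM _ _ h2 h1) _; [exact/ltW/law_weight_gt0|nra|].
rewrite exprD exprM.
have -> : (2^-1 : R) ^+ 9 = 512^-1 by field.
have -> : (2^-1 : R) ^+ 6 = 64^-1 by field.
rewrite mulrACA -exprMn; have -> : 64^-1 * 8 = 8^-1 :> R by field.
by rewrite [512^-1 * 3]mulrC.
Qed.

(** The weight 2^-(r^2) against exp(r^2 / 4) leaves at most (2/3)^(r^2), as exp(1/4) <= 4/3. *)
Lemma law_exp_sqr_le : law_mean (fun y => expR (y ^+ 2 / 4)) <= 9.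
Proof.
rewrite law_meanE ler_pdivrMr ?law_total_gt0 //.
have W1 := law_total_ge.
apply: le_trans (_ : 4 / 3 + 4 / 3 * W <= _); last by lra.
have -> : 4 / 3 * W = \sum_(j < L) 4 / 3 * (u j * (1 + j.+2%:R)) by rewrite mulr_sumr.
have : \sum_(j < L) (4 / 9) * (2 / 3 : R) ^+ j <= 4 / 3.
  rewrite -mulr_sumr; have := @geometric_sum_le R (2 / 3) L ltac:(lra) ltac:(lra); lra.
move=> h; apply: le_trans (_ : \sum_(j < L) _ + _ <= _); last exact: (lerD h (lexx _)).
rewrite -big_split /=; apply: ler_sum => j _; rewrite mulrDr; apply: lerD.
  have -> : expR (j.+2%:R ^+ 2 / 4) = expR (4^-1 : R) ^+ (j.+2 ^ 2).
    by rewrite -expRM_natl natrX.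
  rewrite -exprMn; apply: (@le_trans _ _ ((2 / 3) ^+ (j.+2 ^ 2))).
    rewrite lerXn2r ?nnegrE ?mulr_ge0 ?expR_ge0 //.
    by have := expR_quarter_le (R := R); lra.
  have -> : 4 / 9 * (2 / 3) ^+ j = (2 / 3) ^+ j.+2 :> R by rewrite !exprS; field.
  by rewrite ler_wiXn2l //; [lra|lia].
rewrite [leRHS]mulrCA sqrrN expr1n mul1r ler_wpM2l ?(ltW (law_weight_gt0 _)) //.
have := expR_quarter_le (R := R); have : (2 : R) <= j.+2%:R by rewrite (ler_nat R 2).
nra.
Qed.

Lemma law_gap (j : nat) : (v - 1) <= 5 / 7 * (j.+2%:R ^+ 2 - v).
Proof.
have := law_var_ge2; have := law_var_le; have : (2 : R) <= j.+2%:R by rewrite (ler_nat R 2).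
nra.
Qed.

(* The atom -1 carries the only negative contribution. Centering turns its mass into
   sums over the atoms r >= 2, where r^2 - v exceeds v - 1 by a factor 7/5. *)
Lemma law_moment_ge a b : (2 <= a + b)%N ->
  2 / 7 * (\sum_(j < L) u j * (j.+2%:R ^+ a * (j.+2%:R ^+ 2 - v) ^+ b)) <=
  law_moment a b.
Proof.
move=> ab; have v2 := law_var_ge2; have v3 := law_var_le.
have u0 j := ltW (law_weight_gt0 j).
have r2 j : (2 : R) <= j.+2%:R by rewrite (ler_nat R 2).
have gap0 j : 0 <= j.+2%:R ^+ 2 - v by have := r2 j; nra.
have gapb c j : (0 < c)%N -> (v - 1) ^+ c <= 5 / 7 * (j.+2%:R ^+ 2 - v) ^+ c.
  case: c => // c _; apply: (@le_trans _ _ ((5 / 7 * (j.+2%:R ^+ 2 - v)) ^+ c.+1)).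
    by rewrite lerXn2r ?nnegrE ?law_gap //; [lra|rewrite mulr_ge0 //; lra].
  rewrite exprMn ler_wpM2r ?exprn_ge0 // exprS ler_piMr ?exprn_ile1 //; lra.
have sgn : - (v - 1) ^+ b <= (- 1) ^+ a * (1 - v) ^+ b.
  rewrite -[1 - v]opprB (exprNn (v - 1)) mulrA -exprD lerNl -mulNr ler_piMl ?exprn_ge0 //; first lra.
  by rewrite -signr_odd; case: odd; rewrite ?expr0 ?expr1; lra.
have key : 2 / 7 * (\sum_(j < L) u j * (j.+2%:R ^+ a * (j.+2%:R ^+ 2 - v) ^+ b)) <=
    \sum_(j < L) u j * (j.+2%:R ^+ a * (j.+2%:R ^+ 2 - v) ^+ b +
      j.+2%:R * ((- 1) ^+ a * ((- 1) ^+ 2 - v) ^+ b)).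
  rewrite expr2 mulrNN mulr1.
  case: a ab sgn => [|a] ab sgn.
    (* For a = 0 the atom r brings no power of r to set against the factor r of its share of the
       atom -1. The vanishing mean of Y^2 - v, times v - 1 to one power less than the moment, is
       subtracted to compensate. *)
    have zero : \sum_(j < L) u j * ((j.+2%:R ^+ 2 - v) + j.+2%:R * (1 - v)) = 0.
      have : law_mean (fun y => y ^+ 2 - v) = 0.
        rewrite /law_mean; under eq_bigr => k _ do rewrite mulrBr.
        by rewrite sumrB -mulr_suml law_prob_sum mul1r subrr.
      rewrite law_meanE expr2 mulrNN mulr1 => /eqP; rewrite mulf_eq0 invr_eq0.
      by rewrite (gt_eqF law_total_gt0) orbF => /eqP.
    case: b ab sgn => [|b] // ab sgn; have b0 : (0 < b)%N by case: b ab {sgn}.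
    rewrite -subr_ge0 mulr_sumr -sumrB.
    have zero' : \sum_(j < L) (v - 1) ^+ b *
        (u j * ((j.+2%:R ^+ 2 - v) + j.+2%:R * (1 - v))) = 0.
      by rewrite -mulr_sumr zero mulr0.
    rewrite -[leRHS]subr0 -[X in _ - X]zero' -sumrB; apply: sumr_ge0 => j _.
    rewrite !expr0 !mul1r.
    have h1 := gapb b j b0; have h2 := sgn; rewrite expr0 mul1r in h2.
    have -> : u j * ((j.+2%:R ^+ 2 - v) ^+ b.+1 + j.+2%:R * (1 - v) ^+ b.+1) -
      2 / 7 * (u j * (j.+2%:R ^+ 2 - v) ^+ b.+1) -
      (v - 1) ^+ b * (u j * (j.+2%:R ^+ 2 - v + j.+2%:R * (1 - v))) =
      u j * ((j.+2%:R ^+ 2 - v) * (5 / 7 * (j.+2%:R ^+ 2 - v) ^+ b - (v - 1) ^+ b) +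
        j.+2%:R * ((1 - v) ^+ b.+1 + (v - 1) ^+ b.+1)).
      by rewrite !exprS; field.
    apply: mulr_ge0 => //; apply: addr_ge0; apply: mulr_ge0 => //; lra.
  rewrite mulr_sumr; apply: ler_sum => j _; rewrite mulrCA ler_wpM2l //.
  suff : j.+2%:R * (v - 1) ^+ b <= 5 / 7 * (j.+2%:R ^+ a.+1 * (j.+2%:R ^+ 2 - v) ^+ b).
    have := sgn; have := r2 j; nra.
  case: b ab {sgn} => [|b] ab.
    rewrite !expr0 !mulr1; case: a ab => [|a] // _.
    have : 1 <= (j.+2%:R : R) ^+ a by rewrite exprn_ege1 // ler1n.
    rewrite !exprS; have := r2 j; nra.
  have h := gapb b.+1 j isT.
  have : j.+2%:R <= (j.+2%:R : R) ^+ a.+1 by rewrite exprS ler_peMr // exprn_ege1 // ler1n.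
  have : 0 <= (j.+2%:R ^+ 2 - v) ^+ b.+1 by rewrite exprn_ge0.
  have := r2 j; nra.
rewrite /law_moment law_meanE ler_pdivlMr ?law_total_gt0 //; apply: le_trans key.
rewrite ler_piMr ?law_total_le1 // mulr_ge0 //; apply: sumr_ge0 => j _.
by rewrite mulr_ge0 // mulr_ge0 // exprn_ge0.
Qed.

(** With n = a + 2b, a single atom r with r^2 <= 4n has weight at least 16^-n, and r^2 - v >= 7/16
    r^2. The constant is 1/128 = 2/7 * 1/16 * 7/16. Taking r of order sqrt n gives the subgaussian
    growth from below. *)
Lemma law_moment_ge_term a b j : (2 <= a + b)%N -> (j < L)%N ->
  (j.+2 ^ 2 <= 4 * (a + b.*2))%N ->
  (j.+2%:R / 128) ^+ (a + b.*2) <= law_moment a b.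
Proof.
move=> ab jL hi; apply: le_trans (law_moment_ge ab).
have v2 := law_var_ge2; have v3 := law_var_le.
have r2 i : (2 : R) <= i.+2%:R by rewrite (ler_nat R 2).
have gap i : 7 / 16 * i.+2%:R ^+ 2 <= i.+2%:R ^+ 2 - v by have := r2 i; nra.
have gap0 i : 0 <= i.+2%:R ^+ 2 - v by have := r2 i; nra.
rewrite (bigD1 (Ordinal jL)) //= mulrDr.
apply: (@le_trans _ _ (2 / 7 * (u j * (j.+2%:R ^+ a * (j.+2%:R ^+ 2 - v) ^+ b)))); last first.
  rewrite lerDl mulr_ge0 //; apply: sumr_ge0 => i _.
  by rewrite mulr_ge0 ?(ltW (law_weight_gt0 _)) // mulr_ge0 // exprn_ge0.
have h1 : 2^-1 ^+ (4 * (a + b.*2)) <= u j by rewrite ler_wiXn2l // ?invf_le1 // ler1n.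
have h2 : (7 / 16 * j.+2%:R ^+ 2) ^+ b <= (j.+2%:R ^+ 2 - v) ^+ b.
  by rewrite lerXn2r ?nnegrE // mulr_ge0.
have h3 : (7 / 16 : R) ^+ (a + b.*2) <= (7 / 16) ^+ b by rewrite ler_wiXn2l //; [lra|lia].
have h4 : (2 / 7 : R) ^+ (a + b.*2) <= 2 / 7.
  by rewrite -[leRHS]expr1 ler_wiXn2l //; [lra|lia].
set n := (a + b.*2)%N in h1 h3 h4 *.
have -> : (j.+2%:R / 128) ^+ n =
    (2 / 7) ^+ n * (2^-1 ^+ (4 * n) * (j.+2%:R ^+ n * (7 / 16) ^+ n)) :> R.
  rewrite exprM -!exprMn; congr (_ ^+ n).
  have -> : (2^-1 : R) ^+ 4 = 16^-1 by field.
  by field.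
rewrite ler_pM ?mulr_ge0 ?exprn_ge0 ?invr_ge0 //.
rewrite ler_pM ?mulr_ge0 ?exprn_ge0 ?invr_ge0 //.
rewrite /n exprD -mulrA ler_wpM2l ?exprn_ge0 //.
apply: le_trans h2; rewrite (exprMn b (7 / 16)) mulrC -mul2n exprM ler_wpM2r ?exprn_ge0 //.
by rewrite mul2n.
Qed.

Lemma law_moment_ge0 a b : 0 <= law_moment a b.
Proof.
have [ab|ab] := leqP 2 (a + b).
  apply: le_trans (law_moment_ge ab); rewrite mulr_ge0 //; apply: sumr_ge0 => j _.
  have r2 : (2 : R) <= j.+2%:R by rewrite (ler_nat R 2).
  have v3 := law_var_le.
  rewrite mulr_ge0 ?(ltW (law_weight_gt0 _)) // mulr_ge0 ?exprn_ge0 //.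
  nra.
have sum1 := law_prob_sum.
case: a b ab => [|[|a]] [|[|b]] // _; rewrite /law_moment /law_mean.
- by under eq_bigr => k _ do rewrite !expr0 !mulr1; rewrite sum1.
- under eq_bigr => k _ do rewrite expr0 expr1 mul1r mulrBr.
  by rewrite sumrB -mulr_suml sum1 mul1r subrr.
- under eq_bigr => k _ do rewrite expr0 expr1 mulr1.
  by have := law_centered; rewrite /law_mean => ->.
Qed.

Lemma law_moment00 : law_moment 0 0 = 1.
Proof.
rewrite /law_moment /law_mean.
by under eq_bigr => k _ do rewrite !expr0 !mulr1; rewrite law_prob_sum.
Qed.

End ComparisonLaw.

(** * The homogeneous model *)

Section FiniteMean.
Context {R : realType} {Om : finType}.
Variable p : Om -> R.
Hypothesis p0 : forall w, 0 <= p w.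
Hypothesis p1 : \sum_w p w = 1.

Lemma mean_ge0 (f : Om -> R) : (forall w, 0 <= f w) -> 0 <= \sum_w p w * f w.
Proof. by move=> f0; apply: sumr_ge0 => w _; rewrite mulr_ge0. Qed.

Lemma mean_le (f g : Om -> R) : (forall w, f w <= g w) ->
  \sum_w p w * f w <= \sum_w p w * g w.
Proof. by move=> fg; apply: ler_sum => w _; rewrite ler_wpM2l. Qed.

(** The tangent at [s] lies below the power; averaged with [s] the mean, it gives Jensen's
    inequality. *)
Lemma exprn_tangent (s t : R) k : 0 <= s -> 0 <= t ->
  s ^+ k + k%:R * s ^+ k.-1 * (t - s) <= t ^+ k.
Proof.
move=> s0 t0; elim: k => [|k IH]; first by rewrite !expr0 !mul0r addr0.
have := ler_wpM2l t0 IH; rewrite -exprS; apply: le_trans; rewrite -subr_ge0.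
case: k {IH} => [|k] /=; first by rewrite !expr0 expr1; lra.
rewrite -[in X in _ - X]natr1.
rewrite [leRHS](_ : _ = k.+1%:R * s ^+ k * (t - s) ^+ 2); last by rewrite !exprS; ring.
by rewrite mulr_ge0 ?sqr_ge0 // mulr_ge0 // exprn_ge0.
Qed.

Lemma mean_exprn_le (f : Om -> R) k : (forall w, 0 <= f w) ->
  (\sum_w p w * f w) ^+ k <= \sum_w p w * f w ^+ k.
Proof.
move=> f0; set s := \sum_w _; have s0 : 0 <= s by exact: mean_ge0.
apply: le_trans (mean_le (fun w => exprn_tangent k s0 (f0 w))).
under eq_bigr => w _ do rewrite mulrDr mulrCA mulrBr.
rewrite big_split /= -mulr_suml p1 mul1r -mulr_sumr sumrB -mulr_suml p1 mul1r.
by rewrite -/s subrr mulr0 addr0.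
Qed.

Lemma mean_prod (I : finType) (F : I -> Om -> R) :
  \sum_(c : {ffun I -> Om}) (\prod_i p (c i)) * \prod_i F i (c i) =
  \prod_i \sum_w p w * F i w.
Proof.
by rewrite bigA_distr_bigA /=; apply: eq_bigr => c _; rewrite -big_split.
Qed.

Lemma mean_prod_total (I : finType) :
  \sum_(c : {ffun I -> Om}) (\prod_i p (c i)) = 1.
Proof. by rewrite -(bigA_distr_bigA (fun _ => p)) /= big1. Qed.

End FiniteMean.

(** * Exponential moments of a random column and of the centered Gram matrix *)

Section SubGaussian.
Context {R : realType} {Om : finType}.
Variables (p y : Om -> R) (v : R).
Hypothesis p0 : forall w, 0 <= p w.
Hypothesis p1 : \sum_w p w = 1.
Hypothesis y0 : \sum_w p w * y w = 0.
Hypothesis yv : \sum_w p w * y w ^+ 2 = v.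
Hypothesis v_le : v <= 9 / 4.
Hypothesis yexp : \sum_w p w * expR (y w ^+ 2 / 4) <= 9.

Lemma var_ge0 : 0 <= v.
Proof. by rewrite -yv; apply: mean_ge0 => // w; exact: sqr_ge0. Qed.

(** The quadratic error is controlled by exp(y^2 / 4) through |l y| <= 2 l^2 + y^2 / 8. The exponent
    that comes out is 74 l^2; 81 is a square, which makes the later scaling by 18 rational. *)
Lemma mgf_le (l : R) : \sum_w p w * expR (l * y w) <= expR (81 * l ^+ 2).
Proof.
apply: (@le_trans _ _ (\sum_w p w * (1 + l * y w +
    8 * l ^+ 2 * expR (2 * l ^+ 2) * expR (y w ^+ 2 / 4)))).
  apply: mean_le => // w; apply: le_trans (expR_le_quad _) _; rewrite lerD2l.
  set x := y w.
  have h1 : `|l * x| <= 2 * l ^+ 2 + x ^+ 2 / 8.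
    have ha := sqr_ge0 (4 * l - x); have hb := sqr_ge0 (4 * l + x).
    by rewrite ler_norml; apply/andP; split; nra.
  have h2 : x ^+ 2 <= 8 * expR (x ^+ 2 / 8) by have := expR_ge1Dx (x ^+ 2 / 8); lra.
  have h3 : expR `|l * x| <= expR (2 * l ^+ 2) * expR (x ^+ 2 / 8) by rewrite -expRD ler_expR.
  have -> : x ^+ 2 / 4 = x ^+ 2 / 8 + x ^+ 2 / 8 by field.
  have key := ler_pM (sqr_ge0 x) (expR_ge0 _) h2 h3.
  rewrite expRD exprMn -[leLHS]mulrA; apply: le_trans (ler_wpM2l (sqr_ge0 l) key) _.
  by rewrite le_eqVlt; apply/orP; left; apply/eqP; ring.
under eq_bigr => w _ do rewrite !mulrDr mulr1 [p w * (l * _)]mulrCA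
  [p w * (_ * expR (_ / 4))]mulrCA.
rewrite !big_split /= -!mulr_sumr p1 y0 mulr0 addr0.
set A := 8 * l ^+ 2 * expR (2 * l ^+ 2).
have e1 := expR_ge1Dx (2 * l ^+ 2).
have A0 : 0 <= A by rewrite mulr_ge0 ?expR_ge0 // mulr_ge0 // sqr_ge0.
apply: le_trans (_ : 1 + A * 9 <= _); first by rewrite lerD2l ler_wpM2l.
apply: (@le_trans _ _ (expR (2 * l ^+ 2) * (1 + 72 * l ^+ 2))).
  by rewrite /A; have := sqr_ge0 l; nra.
have e2 := expR_ge1Dx (72 * l ^+ 2).
apply: le_trans (ler_wpM2l (expR_ge0 _) e2) _; rewrite -expRD ler_expR.
by have := sqr_ge0 l; lra.
Qed.

Section Column.
Context {m : nat}.
Implicit Types (x : 'cV[R]_m) (c : {ffun 'I_m -> Om}).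
(** A coordinate of H^T x, when [c] is the corresponding column of H. *)
Definition lincomb x c : R := \sum_i x i 0 * y (c i).

Definition col_prob c : R := \prod_i p (c i).

Local Notation P := col_prob.

Lemma col_ge0 c : 0 <= P c.
Proof. exact: prodr_ge0. Qed.

Lemma col_mgf_le x l : \sum_c P c * expR (l * lincomb x c) <= expR (81 * l ^+ 2 * nrm2 x).
Proof.
under eq_bigr => c _ do rewrite /lincomb mulr_sumr expR_sum.
rewrite /col_prob (mean_prod p (fun i w => expR (l * (x i 0 * y w)))) /nrm2 mulr_sumr expR_sum.
apply: ler_prod => i _; apply/andP; split.
  by apply: mean_ge0 => // w; exact: expR_ge0.
under eq_bigr => w _ do rewrite mulrA.
by apply: le_trans (mgf_le _) _; rewrite exprMn mulrA.
Qed.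

Lemma col_second_moment x : \sum_c P c * lincomb x c ^+ 2 = v * nrm2 x.
Proof.
rewrite /col_prob; pose F (i j k : 'I_m) (w : Om) := (if k == i then y w else 1) * (if k == j then y w else 1).
have yF (i j : 'I_m) c : y (c i) * y (c j) = \prod_k F i j k (c k).
  rewrite big_split /= (bigD1 i) //= eqxx big1 ?mulr1 => [|k /negbTE ->//].
  by rewrite (bigD1 j) //= eqxx big1 ?mulr1 // => k /negbTE ->.
have EF i j : \prod_k (\sum_w p w * F i j k w) = (i == j)%:R * v.
  have [<-|ij] := eqVneq i j.
    rewrite (bigD1 i) //= [X in _ * X]big1 ?mulr1 ?mul1r => [|k /negbTE ki].
      by rewrite -yv; apply: eq_bigr => w _; rewrite /F eqxx expr2.
    by under eq_bigr => w _ do rewrite /F ki mulr1 mulr1.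
  rewrite (bigD1 i) //= mul0r [X in X * _](_ : _ = 0) ?mul0r //.
  by under eq_bigr => w _ do rewrite /F eqxx (negbTE ij) mulr1.
transitivity (\sum_i \sum_j x i 0 * x j 0 * ((i == j)%:R * v)).
  under eq_bigr => c _ do rewrite expr2 /lincomb mulr_suml mulr_sumr.
  rewrite exchange_big /=; apply: eq_bigr => i _.
  under eq_bigr => c _ do rewrite mulr_sumr mulr_sumr.
  rewrite exchange_big /=; apply: eq_bigr => j _.
  rewrite -EF -mean_prod mulr_sumr; apply: eq_bigr => c _; rewrite -yF; ring.
rewrite /nrm2 mulr_sumr; apply: eq_bigr => i _.
rewrite (bigD1 i) //= eqxx big1 ?addr0 => [|j /negbTE ji]; first by rewrite mul1r expr2 mulrC.
by rewrite eq_sym ji mul0r mulr0.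
Qed.

(** With t = U / 18 for U = [lincomb x c], the exponent 2 * [mgf_radius] * U^2 is t^2 / 2, while 81
    / 18^2 = 1/4 is half the Gaussian exponent of the mixture below. *)
Definition mgf_radius : R := 36^-1 ^+ 2.

Lemma mgf_radius_gt0 : 0 < mgf_radius.
Proof. by rewrite exprn_gt0. Qed.

(* exp(t^2/2) is dominated by a discrete Gaussian mixture of the exp(k t), which
   transfers the bound on the moment generating function to exp of the square. *)
Lemma expR_sqr_mixture (t : R) N : (Num.truncn `|t| < N)%N ->
  expR (t ^+ 2 / 2) <=
  2 * \sum_(k < N) expR (- (k%:R ^+ 2 / 2)) * (expR (k%:R * t) + expR (- k%:R * t)).
Proof.
(* With k the integer part of |t|, (|t| - k)^2 <= 1 gives t^2 / 2 <= 1/2 - k^2 / 2 + k |t|: one term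
   of the mixture suffices. *)
move=> kN; pose k := Ordinal kN; have /andP[k1 k2] := truncn_itv (normr_ge0 t).
have e12 : expR (2^-1 : R) <= 2.
  have -> : (2^-1 : R) = 4^-1 + 4^-1 by field.
  by rewrite expRD; have := expR_quarter_le (R := R); have := expR_ge0 (4^-1 : R); nra.
have h : expR (t ^+ 2 / 2) <= expR 2^-1 * (expR (- (k%:R ^+ 2 / 2)) * expR (k%:R * `|t|)).
  rewrite -!expRD ler_expR -[t ^+ 2]ger0_norm ?sqr_ge0 // normrX.
  rewrite -natr1 in k2; rewrite /=; nra.
have habs (a : R) : expR (a * `|t|) <= expR (a * t) + expR (- a * t).
  case: (ger0P t) => _; first by rewrite lerDl expR_ge0.
  by rewrite mulrN mulNr lerDr expR_ge0.
apply: le_trans h _; apply: ler_pM e12 _; rewrite ?expR_ge0 ?mulr_ge0 ?expR_ge0 //.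
rewrite (bigD1 k) //=.
apply: le_trans (_ : expR (- (k%:R ^+ 2 / 2)) * (expR (k%:R * t) + expR (- k%:R * t)) <= _).
  by rewrite ler_wpM2l ?expR_ge0 // habs.
rewrite lerDl; apply: sumr_ge0 => i _.
by rewrite mulr_ge0 ?addr_ge0 ?expR_ge0.
Qed.

Lemma discrete_gaussian_le N : \sum_(k < N) expR (- (k%:R ^+ 2 / 4)) <= 5 :> R.
Proof.
apply: (@le_trans _ _ (\sum_(k < N) (4 / 5) ^+ k)); last first.
  by have := @geometric_sum_le R (4 / 5) N ltac:(lra) ltac:(lra); lra.
apply: ler_sum => k _.
have h : expR (- 4^-1 : R) <= 4 / 5.
  have h1 := expR_ge1Dx (4^-1 : R); have e0 := expR_gt0 (- 4^-1 : R).
  have ee : expR (4^-1 : R) * expR (- 4^-1) = 1 by rewrite -expRD subrr expR0.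
  nra.
apply: (@le_trans _ _ (expR (- 4^-1) ^+ k)); last by rewrite lerXn2r ?nnegrE ?expR_ge0.
rewrite -expRM_natl ler_expR mulrN lerN2 ler_wpM2r // -natrX ler_nat.
by case: (nat_of_ord k) => // j; rewrite expnS expn1 leq_pmulr.
Qed.

Lemma col_exp_sqr_le x : nrm2 x <= 1 ->
  \sum_c P c * expR (2 * mgf_radius * lincomb x c ^+ 2) <= 20.
Proof.
move=> x1; pose t c := lincomb x c / 18.
(* There are finitely many columns, so one length of the mixture serves them all. *)
pose N := (\sum_c Num.truncn `|t c|).+1.
have tN c : (Num.truncn `|t c| < N)%N by rewrite ltnS (bigD1 c) //= leq_addr.
apply: (@le_trans _ _ (\sum_c P c * (2 * \sum_(k < N) expR (- (k%:R ^+ 2 / 2)) *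
    (expR (k%:R * t c) + expR (- k%:R * t c))))).
  apply: mean_le => [c|c]; first exact: col_ge0.
  apply: le_trans (expR_sqr_mixture (tN c)); rewrite ler_expR le_eqVlt.
  by apply/orP; left; apply/eqP; rewrite /t /mgf_radius; field.
under eq_bigr => c _ do rewrite mulrCA mulr_sumr.
rewrite -mulr_sumr exchange_big /=.
have e (s : R) k : s ^+ 2 = k%:R ^+ 2 ->
    \sum_c P c * expR (s * t c) <= expR (k%:R ^+ 2 / 4).
  move=> sk; have E c : s * t c = s / 18 * lincomb x c by rewrite /t; field.
  under eq_bigr => c _ do rewrite E.
  apply: le_trans (col_mgf_le _ _) _; rewrite ler_expR exprMn sk.
  rewrite [leLHS](_ : _ = k%:R ^+ 2 / 4 * nrm2 x); last by field.
  by rewrite ler_piMr // mulr_ge0 // sqr_ge0.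
apply: (@le_trans _ _ (2 * \sum_(k < N) 2 * expR (- (k%:R ^+ 2 / 4)))); last first.
  by rewrite -mulr_sumr; have := discrete_gaussian_le N; lra.
rewrite ler_wpM2l //; apply: ler_sum => k _.
under eq_bigr => c _ do rewrite mulrCA mulrDr.
rewrite -mulr_sumr big_split /=.
have -> : expR (- (k%:R ^+ 2 / 4)) = expR (- (k%:R ^+ 2 / 2)) * expR (k%:R ^+ 2 / 4) :> R.
  by rewrite -expRD; congr expR; field.
rewrite mulrCA ler_wpM2l ?expR_ge0 // mulr2n mulrDl mul1r; apply: lerD; apply: e => //.
by rewrite sqrrN.
Qed.

Lemma expR_ge_sqr_half (t : R) : 0 <= t -> t ^+ 2 / 2 <= expR t.
Proof. by move=> t0; have := @expR_ge1Dxn R t 1 t0; rewrite (_ : 2`!%:R = 2) //; lra. Qed.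

Lemma col_centered_mgf_le x l : nrm2 x <= 1 -> `|l| <= mgf_radius ->
  \sum_c P c * expR (l * (lincomb x c ^+ 2 - v * nrm2 x)) <=
  expR (80 / mgf_radius ^+ 2 * l ^+ 2).
Proof.
move=> x1 lc; have c10 := mgf_radius_gt0; have v0 := var_ge0.
have nx0 := nrm2_ge0 x.
set U := lincomb x.
(* With w = U^2 + v and rho = [mgf_radius], the error is at most l^2 w^2 exp(rho w), and w^2 <= 2 /
   rho^2 exp(rho w). The constant 80 is 2 * 2 * 20, from this, exp(2 rho v) <= 2 and
   [col_exp_sqr_le]. *)
apply: (@le_trans _ _ (\sum_c P c * (1 + l * (U c ^+ 2 - v * nrm2 x) +
    2 / mgf_radius ^+ 2 * l ^+ 2 * expR (2 * mgf_radius * v) * expR (2 * mgf_radius * U c ^+ 2)))).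
  apply: mean_le => [c|c]; first exact: col_ge0.
  apply: le_trans (expR_le_quad _) _; rewrite lerD2l.
  set w := U c ^+ 2 + v; have U0 := sqr_ge0 (U c).
  have w0 : 0 <= w by rewrite addr_ge0.
  have h1 : `|U c ^+ 2 - v * nrm2 x| <= w.
    by rewrite ler_norml /w; apply/andP; split; nra.
  have h2 : (l * (U c ^+ 2 - v * nrm2 x)) ^+ 2 <= l ^+ 2 * w ^+ 2.
    rewrite exprMn ler_wpM2l ?sqr_ge0 // -[leLHS]ger0_norm ?sqr_ge0 // normrX.
    by rewrite lerXn2r ?nnegrE.
  have h3 : expR `|l * (U c ^+ 2 - v * nrm2 x)| <= expR (mgf_radius * w).
    by rewrite ler_expR normrM ler_pM.
  have h4 : w ^+ 2 <= 2 / mgf_radius ^+ 2 * expR (mgf_radius * w).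
    have := expR_ge_sqr_half (mulr_ge0 (ltW c10) w0); rewrite exprMn => h.
    rewrite mulrAC ler_pdivlMr ?exprn_gt0 //; lra.
  have -> : 2 / mgf_radius ^+ 2 * l ^+ 2 * expR (2 * mgf_radius * v) * expR (2 * mgf_radius * U c ^+ 2) =
      l ^+ 2 * (2 / mgf_radius ^+ 2 * expR (mgf_radius * w)) * expR (mgf_radius * w).
    have -> : expR (2 * mgf_radius * v) = expR (mgf_radius * v) * expR (mgf_radius * v).
      by rewrite -expRD; congr expR; ring.
    have -> : expR (2 * mgf_radius * U c ^+ 2) = expR (mgf_radius * U c ^+ 2) * expR (mgf_radius * U c ^+ 2).
      by rewrite -expRD; congr expR; ring.
    by rewrite /w mulrDr expRD; set z := _^-1; ring.
  apply: ler_pM; rewrite ?sqr_ge0 ?expR_ge0 //.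
  by apply: le_trans h2 _; rewrite ler_wpM2l ?sqr_ge0.
under eq_bigr => c _ do rewrite mulrDr [P c * (1 + _)]mulrDr mulr1 [P c * (l * _)]mulrCA [P c * (_ * expR _)]mulrCA mulrBr.
rewrite !big_split /= -!mulr_sumr sumrB -[X in _ - X]mulr_suml col_second_moment.
have -> : \sum_c P c = 1 by exact: mean_prod_total.
rewrite mul1r subrr mulr0 addr0.
have e2 : expR (2 * mgf_radius * v) <= 2.
  have c18 : mgf_radius <= 18^-1 by rewrite /mgf_radius expr2; lra.
  have h : 2 * mgf_radius * v <= 4^-1.
    apply: le_trans (_ : 2 * (18^-1 * (9 / 4)) <= _); last by lra.
    by rewrite -mulrA ler_wpM2l // ler_pM // ltW.
  by apply: le_trans (_ : expR 4^-1 <= _); [rewrite ler_expR|have := expR_quarter_le (R := R); lra].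
have e3 := col_exp_sqr_le x1; rewrite -/U in e3.
apply: le_trans (expR_ge1Dx _); rewrite lerD2l.
set A := mgf_radius ^+ 2; have A0 : 0 < A by exact: exprn_gt0.
have -> : 80 / A * l ^+ 2 = 2 / A * l ^+ 2 * 2 * 20 by ring.
have B0 : 0 <= 2 / A * l ^+ 2 by rewrite mulr_ge0 ?sqr_ge0 // divr_ge0 // ltW.
apply: ler_pM => //.
- by rewrite mulr_ge0 // expR_ge0.
- by apply: mean_ge0 => [c|c]; [exact: col_ge0|exact: expR_ge0].
by rewrite ler_wpM2l.
Qed.

End Column.
Section RandomMatrix.
Context {m n : nat}.
Implicit Type w : {ffun 'I_n -> {ffun 'I_m -> Om}}.

Definition mx_prob w : R := \prod_j col_prob (w j).

(** This is H H^T - E H H^T, for H with columns [w j]. *)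
Definition centered_gram w : 'M[R]_m := \matrix_(i, k) \sum_j
  (if i == k then y (w j i) ^+ 2 - v else y (w j i) * y (w j k)).

Lemma mx_prob_ge0 w : 0 <= mx_prob w.
Proof. by apply: prodr_ge0 => j _; exact: col_ge0. Qed.

Lemma mx_prob_sum : \sum_w mx_prob w = 1.
Proof. by apply: mean_prod_total; exact: mean_prod_total. Qed.

Lemma centered_gram_sym w : (centered_gram w)^T = centered_gram w.
Proof.
apply/matrixP => i k; rewrite !mxE; apply: eq_bigr => j _.
by rewrite eq_sym; case: eqP => [->//|_]; rewrite mulrC.
Qed.

Lemma bil_centered_gram w x :
  bil (centered_gram w) x x = \sum_j (lincomb x (w j) ^+ 2 - v * nrm2 x).
Proof.
rewrite bilE.
have E j : lincomb x (w j) ^+ 2 - v * nrm2 x = \sum_i \sum_k x i 0 *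
    (if i == k then y (w j i) ^+ 2 - v else y (w j i) * y (w j k)) * x k 0.
  rewrite expr2 /lincomb mulr_suml /nrm2 mulr_sumr -sumrB; apply: eq_bigr => i _.
  rewrite mulr_sumr (bigD1 i) //= [RHS](bigD1 i) //= eqxx addrAC; congr (_ + _).
    by ring.
  by apply: eq_bigr => k ki; rewrite eq_sym (negbTE ki); ring.
under [RHS]eq_bigr => j _ do rewrite E.
rewrite [RHS]exchange_big /=; apply: eq_bigr => i _.
rewrite [RHS]exchange_big /=; apply: eq_bigr => k _.
by rewrite mxE mulr_sumr mulr_suml.
Qed.

Lemma gram_mgf_le x l : nrm2 x <= 1 -> `|l| <= mgf_radius ->
  \sum_w mx_prob w * expR (l * bil (centered_gram w) x x) <=
  expR (80 / mgf_radius ^+ 2 * l ^+ 2 * n%:R).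
Proof.
move=> x1 lc.
under eq_bigr => w _ do rewrite bil_centered_gram mulr_sumr expR_sum.
rewrite /mx_prob (mean_prod col_prob
  (fun _ c => expR (l * (lincomb x c ^+ 2 - v * nrm2 x)))).
rewrite prodr_const card_ord [_ * n%:R]mulrC expRM_natl; apply: lerXn2r; rewrite ?nnegrE ?expR_ge0 //.
  by apply: mean_ge0 => c; [exact: col_ge0|exact: expR_ge0].
exact: col_centered_mgf_le.
Qed.

Definition gram_const : R := 2 * expR 80 / mgf_radius.

Lemma gram_moment_le x : (0 < m)%N -> (m <= n)%N -> ~~ odd m -> nrm2 x <= 1 ->
  \sum_w mx_prob w * bil (centered_gram w) x x ^+ m <=
  (gram_const * Num.sqrt (m * n)%:R) ^+ m.
Proof.
move=> m0 mn me x1; set D := Num.sqrt _.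
have D2 : D ^+ 2 = m%:R * n%:R by rewrite sqr_sqrtr // natrM.
have n0 : 0 < n%:R :> R by rewrite ltr0n; exact: leq_trans mn.
have Dp : 0 < D by rewrite sqrtr_gt0 ltr0n muln_gt0 m0 (leq_trans m0 mn).
have c10 := mgf_radius_gt0.
(* D / n = sqrt (m / n) is at most 1 because m <= n, so [l] is admissible. It makes the exponent of
   the generating function equal to 80 m and m / l proportional to D. *)
pose l := mgf_radius * (D / n%:R).
have lp : 0 < l by rewrite mulr_gt0 // divr_gt0.
have lc : l <= mgf_radius.
  rewrite ler_piMr ?(ltW c10) // ler_pdivrMr // mul1r.
  rewrite -(@ler_pXn2r _ 2) ?nnegrE ?(ltW Dp) ?(ltW n0) // D2 expr2.
  by rewrite ler_wpM2r ?(ltW n0) // ler_nat.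
have l2 : 80 / mgf_radius ^+ 2 * l ^+ 2 * n%:R = 80 * m%:R.
  have nn : n%:R != 0 :> R by rewrite gt_eqF.
  have c1n : mgf_radius != 0 by rewrite gt_eqF.
  have -> : l ^+ 2 = mgf_radius ^+ 2 * D ^+ 2 / n%:R ^+ 2 by rewrite /l; field.
  by rewrite D2; field; apply/andP; split.
have ml : m%:R / l = D / mgf_radius.
  have nn : n%:R != 0 :> R by rewrite gt_eqF.
  have c1n : mgf_radius != 0 by rewrite gt_eqF.
  have Dn : D != 0 by rewrite gt_eqF.
  have -> : m%:R = D ^+ 2 / n%:R by rewrite D2 mulfK.
  by rewrite /l; field; do ?[apply/andP; split].
have pw (t : R) : t ^+ m <= m`!%:R * (expR t + expR (- t)).
  apply: (@le_trans _ _ (m`!%:R * expR `|t|)).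
    have := @expR_ge1Dxn R `|t| m.-1 (normr_ge0 _); rewrite prednK // => h.
    rewrite -ler_pdivrMl ?ltr0n ?fact_gt0 // mulrC.
    have -> : t ^+ m = `|t| ^+ m by rewrite -normrX ger0_norm // exprn_even_ge0.
    by apply: le_trans h; rewrite lerDr.
  by rewrite ler_wpM2l //; case: (ger0P t) => _; rewrite ?lerDl ?lerDr expR_ge0.
have main : l ^+ m * (\sum_w mx_prob w * bil (centered_gram w) x x ^+ m) <=
    m`!%:R * (2 * expR (80 * m%:R)).
  rewrite mulr_sumr; under eq_bigr => w _ do rewrite mulrCA -exprMn.
  apply: le_trans (mean_le mx_prob_ge0 (fun w => pw _)) _.
  under eq_bigr => w _ do rewrite mulrCA mulrDr -mulNr.
  rewrite -mulr_sumr big_split /= ler_wpM2l // mulr2n mulrDl mul1r -l2.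
  apply: lerD; first by apply: gram_mgf_le => //; rewrite gtr0_norm.
  by rewrite -[l ^+ 2]sqrrN; apply: gram_mgf_le => //; rewrite normrN gtr0_norm.
have -> : gram_const * D = m%:R / l * (2 * expR 80) by rewrite ml /gram_const; ring.
have lm : 0 < l ^+ m by exact: exprn_gt0.
rewrite -(ler_pM2l lm); apply: le_trans main _.
rewrite -exprMn; have -> : l * (m%:R / l * (2 * expR 80)) = m%:R * (2 * expR 80).
  by field; rewrite gt_eqF.
rewrite exprMn.
apply: ler_pM; [exact: ler0n|by rewrite mulr_ge0 ?expR_ge0| |].
  rewrite -natrX ler_nat; elim: (m) => // k IH; rewrite factS expnS leq_mul //.
  by case: k IH => // k IH; apply: leq_trans IH _; rewrite leq_exp2r.
rewrite exprMn [80 * _]mulrC expRM_natl ler_wpM2r ?exprn_ge0 ?expR_ge0 //.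
by case: (m) m0 => // k _; rewrite exprS ler_peMr // exprn_ege1 // ler1n.
Qed.

End RandomMatrix.
End SubGaussian.

(** The condition says that the squares k_i^2 sum to at most 16 m, so its indicator is at most the
    product of the exp(16 - k_i^2). This factorizes over coordinates, with two signs and a sum over
    k of at most 2 for each. *)
Lemma lattice_count {R : realType} m : (0 < m)%N ->
  \sum_(z | nrm2 (lattice_point z : 'cV[R]_m) <= 1) 1 <= (4 * expR 16) ^+ m :> R.
Proof.
move=> m0.
pose F (b : bool * 'I_(4 * m).+1) : R := expR 16 * expR (- (b.2%:R ^+ 2)).
have F0 b : 0 <= F b by rewrite mulr_ge0 ?expR_ge0.
apply: (@le_trans _ _ (\sum_(z : {ffun 'I_m -> bool * 'I_(4 * m).+1}) \prod_i F (z i))).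
  rewrite big_mkcond /=; apply: ler_sum => z _; case: ifP => [z1|_]; last exact: prodr_ge0.
  have -> : \prod_i F (z i) = expR (\sum_i (16 - ((z i).2%:R : R) ^+ 2)).
    by rewrite expR_sum; apply: eq_bigr => i _; rewrite /F -expRD.
  rewrite sumrB sumr_const card_ord -[leLHS](expR0 R) ler_expR subr_ge0.
  have mR : 0 < m%:R :> R by rewrite ltr0n.
  have : nrm2 (lattice_point z : 'cV[R]_m) = (\sum_i ((z i).2%:R : R) ^+ 2) / (16 * m%:R).
    rewrite /nrm2 mulr_suml; apply: eq_bigr => i _; rewrite mxE !exprMn sqrr_sign mul1r.
    congr (_ * _); rewrite exprVn exprMn sqr_sqrtr //; congr (_ * _)^-1.
    by rewrite expr2; ring.
  by move=> E; move: z1; rewrite E ler_pdivrMr ?mulr_gt0 // mul1r mulr_natr.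
rewrite [leLHS](_ : _ = \prod_(i < m) \sum_b F b); last by rewrite bigA_distr_bigA.
rewrite prodr_const card_ord.
apply: lerXn2r; rewrite ?nnegrE ?mulr_ge0 ?expR_ge0 ?sumr_ge0 //.
rewrite -(pair_bigA _ (fun b k => F (b, k))) big_bool /= /F /=.
have h : \sum_(k < (4 * m).+1) expR (- (k%:R ^+ 2)) <= 2 :> R.
  apply: (@le_trans _ _ (\sum_(k < (4 * m).+1) 2^-1 ^+ k)); last first.
    by have := @geometric_sum_le R 2^-1 (4 * m).+1 ltac:(lra) ltac:(lra); lra.
  apply: ler_sum => k _.
  have e1 : expR (-1 : R) <= 2^-1.
    have h1 := expR_ge1Dx (1 : R); have e0 := expR_gt0 (-1 : R).
    have ee : expR (1 : R) * expR (-1) = 1 by rewrite -expRD subrr expR0.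
    nra.
  apply: (@le_trans _ _ (expR (-1) ^+ k)); last by rewrite lerXn2r ?nnegrE ?expR_ge0.
  rewrite -expRM_natl ler_expR mulrN1 lerN2 -natrX ler_nat.
  by case: (nat_of_ord k) => // j; rewrite expnS expn1 leq_pmulr.
by rewrite -mulr_sumr; have := expR_ge0 (16 : R); nra.
Qed.

Section HomogeneousTrace.
Context {R : realType} {Om : finType}.
Variables (p y : Om -> R) (v : R).
Hypothesis p0 : forall w, 0 <= p w.
Hypothesis p1 : \sum_w p w = 1.
Hypothesis y0 : \sum_w p w * y w = 0.
Hypothesis yv : \sum_w p w * y w ^+ 2 = v.
Hypothesis v_le : v <= 9 / 4.
Hypothesis yexp : \sum_w p w * expR (y w ^+ 2 / 4) <= 9.

(** 3 comes from passing from the net to the ball, 4 exp(16) from the size of the net, the last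
    factor from a single point of it. *)
Definition trace_const : R := 3 * (4 * expR 16 * gram_const).

Lemma gram_const_ge0 : 0 <= @gram_const R.
Proof. by rewrite /gram_const divr_ge0 ?mulr_ge0 ?expR_ge0 // ltW // mgf_radius_gt0. Qed.

Lemma trace_const_ge0 : 0 <= trace_const.
Proof.
apply: mulr_ge0 => //; apply: mulr_ge0; last exact: gram_const_ge0.
by rewrite mulr_ge0 // expR_ge0.
Qed.

(* The moments are taken at the exponent m, of the order of the logarithm of the
   size of the net, and interpolated down to q by convexity. *)
Lemma trace_centered_gram_le m n q k : (0 < k)%N -> (0 < q)%N -> ~~ odd q ->
  m = (q * k)%N -> (m <= n)%N ->
  \sum_w mx_prob p w * \tr (@centered_gram _ _ y v m n w ^+ q) <=
  m%:R * (trace_const * Num.sqrt (m * n)%:R) ^+ q.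
Proof.
move=> k0 q0 qe mqk mn.
have m0 : (0 < m)%N by rewrite mqk muln_gt0 q0.
have me : ~~ odd m by rewrite mqk oddM negb_and qe.
set D := Num.sqrt _; have D0 : 0 <= D by exact: sqrtr_ge0.
pose M w := @centered_gram _ _ y v m n w.
pose Q w z := bil (M w) (lattice_point z) (lattice_point z).
pose net z := nrm2 (lattice_point z : 'cV[R]_m) <= 1.
pose b w : R := \big[Num.max/0]_(z | net z) `|Q w z|.
have b0 w : 0 <= b w by rewrite /b; elim/big_ind: _ => // ? ? ? ?; rewrite le_max; apply/orP; left.
have Qb w z : net z -> `|Q w z| <= b w by move=> zn; rewrite /b; exact: le_bigmax_cond.
have bm w : b w ^+ m <= \sum_(z | net z) Q w z ^+ m.
  rewrite /b; apply: (big_ind (fun t => t ^+ m <= \sum_(z | net z) Q w z ^+ m)).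
  - rewrite expr0n (gtn_eqF m0); apply: sumr_ge0 => z _; exact: exprn_even_ge0.
  - by move=> s t hs ht; rewrite /Num.max; case: ifP.
  - move=> z zn; rewrite -normrX ger0_norm ?exprn_even_ge0 // (bigD1 z) //= lerDl.
    by apply: sumr_ge0 => z' _; exact: exprn_even_ge0.
have trb w : \tr (M w ^+ q) <= m%:R * (3 * b w) ^+ q.
  have Ms := centered_gram_sym y v w.
  have qq : q = q./2.*2 by rewrite -[LHS]odd_double_half (negbTE qe).
  rewrite qq; apply: trace_exp_quad => //; last by rewrite mulr_ge0.
  by apply: quad_le_lattice => // z zn; exact: Qb.
have g0 := gram_const_ge0.
set K := 4 * expR 16 * gram_const * D.
have K0 : 0 <= K.
  by apply: mulr_ge0 D0; apply: mulr_ge0 g0; apply: mulr_ge0 (expR_ge0 _).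
have Eb : \sum_w mx_prob p w * b w ^+ m <= K ^+ m.
  apply: le_trans (mean_le (mx_prob_ge0 p0) bm) _.
  under eq_bigr => w _ do rewrite mulr_sumr.
  rewrite exchange_big /=.
  apply: le_trans (_ : \sum_(z | net z) (gram_const * D) ^+ m <= _).
    apply: ler_sum => z zn.
    exact: (gram_moment_le p0 p1 y0 yv v_le yexp m0 mn me zn).
  rewrite /K -mulrA [leRHS]exprMn.
  under eq_bigr => z _ do rewrite -[X in X ^+ m]mul1r exprMn expr1n.
  rewrite -mulr_suml ler_wpM2r ?exprn_ge0 ?(mulr_ge0 g0 D0) //. exact: lattice_count.
have Ebq : \sum_w mx_prob p w * b w ^+ q <= K ^+ q.
  have E0 : 0 <= \sum_w mx_prob p w * b w ^+ q.
    by apply: mean_ge0 => w; [exact: mx_prob_ge0|exact: exprn_ge0].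
  (* Jensen's inequality for the power k takes [b w ^+ q] to the exponent q k = m: this is why m is
     a multiple of q. *)
  rewrite -(@ler_pXn2r _ k) ?nnegrE ?exprn_ge0 // -[leRHS]exprM -mqk.
  apply: le_trans Eb; apply: le_trans (mean_exprn_le _ _ _ _) _.
  - exact: mx_prob_ge0.
  - exact: mx_prob_sum.
  - by move=> w; exact: exprn_ge0.
  - by apply: ler_sum => w _; rewrite -exprM -mqk.
apply: le_trans (mean_le (mx_prob_ge0 p0) trb) _.
under eq_bigr => w _ do rewrite mulrCA exprMn [mx_prob p w * _]mulrCA.
rewrite -mulr_sumr -mulr_sumr ler_wpM2l //.
have -> : trace_const * D = 3 * K by rewrite /trace_const /K; ring.
by rewrite exprMn ler_wpM2l // exprn_ge0.
Qed.

End HomogeneousTrace.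

(** * Expectation of products of independent variables *)

Section WeightedIntegral.
Local Open Scope ereal_scope.
Context d (T : measurableType d) (R : realType) (mu : {measure set T -> \bar R}).
Variables (X : T -> R) (G : T -> R) (c : R).
Hypothesis mX : measurable_fun setT X.
Hypothesis mG : measurable_fun setT G.
Hypothesis G0 : forall w, (0 <= G w)%R.
Hypothesis c0 : (0 <= c)%R.
Hypothesis indic_eq : forall B, measurable B ->
  \int[mu]_w (\1_B (X w) * G w)%:E = c%:E * \int[mu]_w (\1_B (X w))%:E.

Import HBNNSimple.

Lemma nnsfun_indic_sum (h : {nnsfun R >-> R}) : exists N (a : 'I_N -> R) (A : 'I_N -> set R),
  [/\ forall i, (0 <= a i)%R, forall i, measurable (A i) &
      forall x, h x = (\sum_(i < N) a i * \1_(A i) x)%R].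
Proof.
pose s := fset_set (range h).
exists (size (enum_fset s)), (fun i => nth 0%R (enum_fset s) i), (fun i => h @^-1` [set nth 0%R (enum_fset s) i]); split => [i|i|x].
- have : nth 0%R (enum_fset s) i \in s by rewrite mem_nth.
  by rewrite in_fset_set; [move=> /set_mem[t _ <-]|exact: fimfunP].
- exact: measurable_sfunP.
- exact: fimfunEord.
Qed.

Lemma integral_nnsfun_weighted (h : {nnsfun R >-> R}) :
  \int[mu]_w (h (X w) * G w)%:E = c%:E * \int[mu]_w (h (X w))%:E.
Proof.
have [N [a [A [a0 mA hE]]]] := nnsfun_indic_sum h.
have mI i : measurable_fun setT (fun w => \1_(A i) (X w) : R).
  exact: measurableT_comp.
under eq_integral => w _ do rewrite hE mulr_suml -sumEFin.
rewrite ge0_integral_sum //; last 2 first.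
- by move=> i; apply/measurable_EFinP; apply: measurable_funM => //; apply: measurable_funM.
- by move=> i w _; rewrite lee_fin !mulr_ge0.
under [in RHS]eq_integral => w _ do rewrite hE -sumEFin.
rewrite [in RHS]ge0_integral_sum //; last 2 first.
- by move=> i; apply/measurable_EFinP; apply: measurable_funM.
- by move=> i w _; rewrite lee_fin !mulr_ge0.
rewrite ge0_sume_distrr; last first.
  by move=> i _; apply: integral_ge0 => w _; rewrite lee_fin mulr_ge0.
apply: eq_bigr => i _.
under eq_integral => w _ do rewrite -mulrA EFinM.
rewrite ge0_integralZl_EFin //; last 2 first.
- by move=> w _; rewrite lee_fin mulr_ge0.
- by apply/measurable_EFinP; apply: measurable_funM.
under [in RHS]eq_integral => w _ do rewrite EFinM.
rewrite [in RHS]ge0_integralZl_EFin //; last exact/measurable_EFinP.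
by rewrite indic_eq // muleCA.
Qed.

(** Simple functions and monotone convergence carry the identity from indicators to nonnegative
    measurable [h]. The weight [G] will be the product over the other coordinates. *)
Lemma integral_weighted (h : R -> R) :
  measurable_fun setT h -> (forall x, (0 <= h x)%R) ->
  \int[mu]_w (h (X w) * G w)%:E = c%:E * \int[mu]_w (h (X w))%:E.
Proof.
move=> mh h0.
have mEh : measurable_fun setT (EFin \o h) by exact/measurable_EFinP.
pose hn := nnsfun_approx measurableT mEh.
have hcv x : EFin \o hn^~ x @ \oo --> (h x)%:E.
  by apply: (cvg_nnsfun_approx measurableT mEh) => // t _; rewrite lee_fin.
have hnd x m n : (m <= n)%N -> (hn m x <= hn n x)%R.
  by move=> mn; have /lefP := nd_nnsfun_approx measurableT mEh mn; exact.
have mhX n : measurable_fun setT (fun w => hn n (X w)) by exact: measurableT_comp.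
have cv1 : \int[mu]_w (hn n (X w) * G w)%:E @[n --> \oo] -->
    \int[mu]_w (h (X w) * G w)%:E.
  rewrite (_ : \int[mu]_w (h (X w) * G w)%:E =
      \int[mu]_w limn (fun n => (hn n (X w) * G w)%:E)).
    apply: cvg_monotone_convergence => //.
    - by move=> n; apply/measurable_EFinP; exact: measurable_funM.
    - by move=> n w _; rewrite lee_fin mulr_ge0.
    - by move=> w _ m n mn; rewrite lee_fin ler_wpM2r // hnd.
  apply: eq_integral => w _; apply/esym/cvg_lim => //.
  under eq_fun => n do rewrite EFinM.
  rewrite EFinM; apply: cvgeZr => //; exact: hcv.
have cv2 : \int[mu]_w (hn n (X w))%:E @[n --> \oo] --> \int[mu]_w (h (X w))%:E.
  rewrite (_ : \int[mu]_w (h (X w))%:E = \int[mu]_w limn (fun n => (hn n (X w))%:E)).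
    apply: cvg_monotone_convergence => //.
    - by move=> n; apply/measurable_EFinP.
    - by move=> n w _; rewrite lee_fin.
    - by move=> w _ m n mn; rewrite lee_fin hnd.
  by apply: eq_integral => w _; apply/esym/cvg_lim => //; exact: hcv.
have cv3 : \int[mu]_w (hn n (X w) * G w)%:E @[n --> \oo] -->
    c%:E * \int[mu]_w (h (X w))%:E.
  by under eq_fun => n do rewrite integral_nnsfun_weighted; apply: cvgeZl.
by have := cvg_unique _ cv1 cv3; apply.
Qed.

End WeightedIntegral.

Section IndependentProduct.
Context d (T : measurableType d) (R : realType) (P : probability T R).
Context (I : finType) (X : I -> T -> R).
Hypothesis mX : forall i, measurable_fun setT (X i).
Hypothesis indep : mutually_independent P X.

Lemma prod_indic (J : finType) (B : J -> set R) (x : J -> R) :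
  \prod_j \1_(B j) (x j) = \1_[set x | forall j, B j (x j)] x :> R.
Proof.
rewrite indicE; case: (boolP (x \in _)) => [/set_mem/= xB|/negP xB].
  by rewrite big1 // => j _; rewrite indicE mem_set.
have /existsP[j jB] : [exists j, x j \notin B j].
  rewrite -negb_forall; apply/negP => /forallP H; apply: xB.
  by apply/mem_set => j; apply/set_mem.
by rewrite (bigD1 j) //= indicE (negbTE jB) mul0r.
Qed.

Local Open Scope ereal_scope.

Lemma integral_indic_comp (B : set R) i : measurable B ->
  \int[P]_w (\1_B (X i w))%:E = P (X i @^-1` B).
Proof.
move=> mB; rewrite -[X in P X]setIT -integral_indic //.
by rewrite -[X in measurable X]setTI; exact: mX.
Qed.

Lemma prod_fine_EFin (J : finType) (Q : pred J) (e : J -> \bar R) :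
  (forall j, e j \is a fin_num) ->
  \prod_(j | Q j) e j = (\prod_(j | Q j) fine (e j))%:E.
Proof.
by move=> ef; rewrite -prodEFin; apply: eq_bigr => j _; rewrite fineK.
Qed.

(* The indicators for which independence is assumed are replaced by the f i one
   coordinate at a time. *)
Lemma ge0_integral_prod (f : I -> R -> R) :
  (forall i, measurable_fun setT (f i)) -> (forall i x, (0 <= f i x)%R) ->
  (forall i, \int[P]_w (f i (X i w))%:E < +oo) ->
  \int[P]_w (\prod_i f i (X i w))%:E = \prod_i \int[P]_w (f i (X i w))%:E.
Proof.
move=> mf f0 ffin.
(* Induction on the list [s] of coordinates with an arbitrary factor; outside [s] the factors are
   indicators. *)
suff H (s : seq I) : forall f : I -> R -> R,
  (forall i, measurable_fun setT (f i)) -> (forall i x, (0 <= f i x)%R) ->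
  (forall i, \int[P]_w (f i (X i w))%:E < +oo) ->
  (forall i, i \notin s -> exists2 B, measurable B & f i = \1_B) ->
  \int[P]_w (\prod_i f i (X i w))%:E = \prod_i \int[P]_w (f i (X i w))%:E.
  by apply: (H (index_enum I)) => // i; rewrite mem_index_enum.
elim: s => {mf f0 ffin f} [|a s IH] f mf f0 ffin fB.
  have {fB} fB i : exists B, measurable B /\ f i = \1_B.
    by have [B mB fE] := fB i isT; exists B.
  have [B HB] := choice fB.
  have E w : (\prod_i f i (X i w) = \1_(\bigcap_(k in [set: I]) X k @^-1` B k) w :> R)%R.
    rewrite (eq_bigr (fun i => \1_(B i) (X i w))) => [|i _]; last by rewrite (HB i).2.
    rewrite (prod_indic B (X^~ w)) !indicE; congr (_%:R); congr nat_of_bool.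
    apply/idP/idP => /set_mem h; apply/mem_set; first by move=> i _; exact: h.
    by move=> i; exact: (h i).
  under eq_integral => w _ do rewrite E.
  rewrite integral_indic //; last first.
    apply: fin_bigcap_measurable => // i _.
    by rewrite -[X in measurable X]setTI; apply: mX => //; exact: (HB i).1.
  rewrite setIT; transitivity (\prod_i P (X i @^-1` B i)).
    by apply: indep => i; exact: (HB i).1.
  by apply: eq_bigr => i _; rewrite (HB i).2 integral_indic_comp //; exact: (HB i).1.
have ffin_num i : \int[P]_w (f i (X i w))%:E \is a fin_num.
  by rewrite ge0_fin_numE // integral_ge0 // => w _; rewrite lee_fin.
have mfX i : measurable_fun setT (fun w => f i (X i w)) by exact: measurableT_comp.
under eq_integral => w _ do rewrite (bigD1 a) //=.
rewrite (bigD1 a) //= prod_fine_EFin // muleC.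
apply: integral_weighted => //.
- by under eq_fun do rewrite -big_filter; apply: measurable_prod => i _; exact: mfX.
- by move=> w; apply: prodr_ge0.
(* Putting an indicator at [a] brings the product back to the induction hypothesis, which supplies
   the identity required by [integral_weighted]. *)
move=> B mB; pose f' i := if i == a then \1_B else f i.
have f'ne i : i != a -> f' i = f i by rewrite /f' => /negbTE ->.
have f'a : f' a = \1_B by rewrite /f' eqxx.
have fE : \int[P]_w (\1_B (X a w) * \prod_(i | i != a) f i (X i w))%:E =
    \int[P]_w (\prod_i f' i (X i w))%:E.
  apply: eq_integral => w _; rewrite [in RHS](bigD1 a) //= f'a.
  by congr (_ * _)%:E; apply: eq_bigr => i ia; rewrite f'ne.
rewrite fE IH.
- rewrite (bigD1 a) //= f'a -prod_fine_EFin // muleC; congr (_ * _).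
  by apply: eq_bigr => i ia; rewrite f'ne.
- by move=> i; rewrite /f'; case: eqP.
- by move=> i x; rewrite /f'; case: eqP.
- move=> i; rewrite /f'; case: eqP => [->|_]; last exact: ffin.
  rewrite integral_indic_comp // (le_lt_trans (probability_le1 _ _)) ?ltry //.
  by rewrite -[X in measurable X]setTI; exact: mX.
- move=> i ins; rewrite /f'; case: eqP => [_|/eqP ia]; first by exists B.
  by apply: fB; rewrite inE negb_or ia.
Qed.

End IndependentProduct.

Section RintegralFacts.
Context d (T : measurableType d) (R : realType) (P : probability T R).

Lemma integrable_sum_EFin (J : Type) (s : seq J) (Q : pred J) (f : J -> T -> R) :
  (forall k, P.-integrable setT (EFin \o f k)) ->
  P.-integrable setT (EFin \o (fun w => \sum_(k <- s | Q k) f k w)).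
Proof.
move=> fi; rewrite (_ : _ \o _ = fun w => (\sum_(k <- s | Q k) (f k w)%:E)%E).
  by apply: integrable_sum => // k _; exact: fi.
by apply/funext => w; rewrite /= sumEFin.
Qed.

Lemma Rintegral_sum (J : Type) (s : seq J) (Q : pred J) (f : J -> T -> R) :
  (forall k, P.-integrable setT (EFin \o f k)) ->
  \int[P]_w (\sum_(k <- s | Q k) f k w) = \sum_(k <- s | Q k) \int[P]_w f k w.
Proof.
move=> fi; elim: s => [|k s IH].
  under eq_Rintegral => w _ do rewrite big_nil.
  by rewrite big_nil /Rintegral integral0.
rewrite big_cons -IH; under eq_Rintegral => w _ do rewrite big_cons.
case: (Q k) => //; rewrite RintegralD //.
exact: integrable_sum_EFin.
Qed.

Lemma integrable_scale (c : R) (f : T -> R) :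
  P.-integrable setT (EFin \o f) -> P.-integrable setT (EFin \o (fun w => c * f w)).
Proof.
move=> fi; rewrite (_ : _ \o _ = fun w => (c%:E * (f w)%:E)%E); first exact: integrableZl.
by apply/funext => w; rewrite /= EFinM.
Qed.

Lemma integrable_dominated (f g : T -> R) :
  measurable_fun setT f -> (forall w, `|f w| <= g w) ->
  P.-integrable setT (EFin \o g) -> P.-integrable setT (EFin \o f).
Proof.
move=> mf fg; apply: le_integrable => //; first exact/measurable_EFinP.
by move=> w _ /=; rewrite lee_fin; apply: le_trans (fg w) (ler_norm _).
Qed.

Lemma integrable_normr (f : T -> R) :
  P.-integrable setT (EFin \o f) -> P.-integrable setT (EFin \o (fun w => `|f w|)).
Proof. by move=> /integrable_abse. Qed.

Lemma integrable_add (f g : T -> R) :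
  P.-integrable setT (EFin \o f) -> P.-integrable setT (EFin \o g) ->
  P.-integrable setT (EFin \o (fun w => f w + g w)).
Proof.
move=> fi gi; rewrite (_ : _ \o _ = (EFin \o f) \+ (EFin \o g))%E; first exact: integrableD.
by apply/funext => w; rewrite /= EFinD.
Qed.

End RintegralFacts.

Section IndependentExpectation.
Context d (T : measurableType d) (R : realType) (P : probability T R).
Context (I : finType) (X : I -> T -> R).
Hypothesis mX : forall i, measurable_fun setT (X i).
Hypothesis indep : mutually_independent P X.
Variable f : I -> R -> R.
Hypothesis mf : forall i, measurable_fun setT (f i).
Hypothesis fi : forall i, P.-integrable setT (EFin \o (fun w => f i (X i w))).

Let mfX (g : I -> R -> R) i : measurable_fun setT (g i) ->
  measurable_fun setT (fun w => g i (X i w)).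
Proof. by move=> mg; exact: measurableT_comp. Qed.

Let Rintegral_prod_ge0 (g : I -> R -> R) :
  (forall i, measurable_fun setT (g i)) -> (forall i x, 0 <= g i x) ->
  (forall i, P.-integrable setT (EFin \o (fun w => g i (X i w)))) ->
  P.-integrable setT (EFin \o (fun w => \prod_i g i (X i w))) /\
  \int[P]_w (\prod_i g i (X i w)) = \prod_i \int[P]_w g i (X i w).
Proof.
move=> mg g0 gi.
have gfin i : (\int[P]_w (g i (X i w))%:E < +oo)%E by exact: integrable_lty (gi i).
have E := ge0_integral_prod mX indep mg g0 gfin.
have ef i : (\int[P]_w (g i (X i w))%:E)%E \is a fin_num by exact: integrable_fin_num (gi i).
rewrite (prod_fine_EFin predT ef) in E; split.
  apply/integrableP; split.
    by apply/measurable_EFinP; apply: measurable_prod => i _; exact: mfX.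
  under eq_integral => w _ do rewrite /= ger0_norm ?prodr_ge0 //.
  by rewrite E ltry.
by rewrite /Rintegral E.
Qed.

Lemma integrable_prod_indep :
  P.-integrable setT (EFin \o (fun w => \prod_i f i (X i w))).
Proof.
have m1 i : measurable_fun setT (fun x => `|f i x|) by exact: measurableT_comp.
have m2 i : P.-integrable setT (EFin \o (fun w => `|f i (X i w)|)).
  exact: integrable_normr.
have [H _] := Rintegral_prod_ge0 m1 (fun i x => normr_ge0 _) m2.
apply: integrable_dominated H => [|w]; last by rewrite normr_prod.
by apply: measurable_prod => i _; exact: mfX.
Qed.

(** Each factor is the difference of its positive part [a] and negative part [b]; the product
    expands over the set [J] of coordinates that take the positive part, and the nonnegative case
    applies to each term. *)
Lemma Rintegral_prod_indep :
  \int[P]_w (\prod_i f i (X i w)) = \prod_i \int[P]_w f i (X i w).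
Proof.
pose a i x := 2^-1 * (`|f i x| + f i x); pose b i x := 2^-1 * (`|f i x| - f i x).
pose g (J : {set I}) i := if i \in J then a i else b i.
have a0 i x : 0 <= a i x by rewrite mulr_ge0 // -lerBlDr sub0r -normrN ler_norm.
have b0 i x : 0 <= b i x by rewrite mulr_ge0 // subr_ge0 ler_norm.
have ma i : measurable_fun setT (a i).
  by apply: measurable_funM => //; apply: measurable_funD => //; exact: measurableT_comp.
have mb i : measurable_fun setT (b i).
  by apply: measurable_funM => //; apply: measurable_funB => //; exact: measurableT_comp.
have ai i : P.-integrable setT (EFin \o (fun w => a i (X i w))).
  by apply: integrable_scale; apply: integrable_add => //; exact: integrable_normr.
have bi i : P.-integrable setT (EFin \o (fun w => b i (X i w))).
  apply: integrable_scale; apply: integrable_add; first exact: integrable_normr.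
  rewrite (_ : _ \o _ = EFin \o (fun w => -1 * f i (X i w))).
    exact: integrable_scale.
  by apply/funext => w; rewrite /= mulN1r.
have gE J := @Rintegral_prod_ge0 (g J).
have {}gE J : P.-integrable setT (EFin \o (fun w => \prod_i g J i (X i w))) /\
    \int[P]_w (\prod_i g J i (X i w)) = \prod_i \int[P]_w g J i (X i w).
  by apply: gE => i; rewrite /g; case: ifP.
pose sg (J : {set I}) : R := \prod_i (if i \in J then 1 else -1).
have sgn (J : {set I}) (u : I -> R) (v : I -> R) :
    \prod_i (if i \in J then u i else - v i) =
    sg J * \prod_i (if i \in J then u i else v i).
  rewrite -big_split /=; apply: eq_bigr => i _.
  by case: ifP => _; rewrite ?mul1r ?mulN1r.
have fE w : \prod_i f i (X i w) = \sum_(J : {set I}) sg J * \prod_i g J i (X i w).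
  transitivity (\prod_i (a i (X i w) + - b i (X i w))).
    by apply: eq_bigr => i _; rewrite /a /b; field.
  rewrite bigA_distr; apply: eq_bigr => J _; rewrite sgn; congr (_ * _).
  by apply: eq_bigr => i _; rewrite /g; case: ifP.
under eq_Rintegral => w _ do rewrite fE.
rewrite Rintegral_sum; last by move=> J; apply: integrable_scale; exact: (gE J).1.
transitivity (\prod_i (\int[P]_w a i (X i w) + - \int[P]_w b i (X i w))).
  rewrite bigA_distr; apply: eq_bigr => J _.
  rewrite RintegralZl //; last exact: (gE J).1.
  rewrite sgn (gE J).2; congr (_ * _); apply: eq_bigr => i _.
  by rewrite /g; case: ifP.
apply: eq_bigr => i _; rewrite -RintegralB //.
by apply: eq_Rintegral => w _; rewrite /a /b; field.
Qed.

End IndependentExpectation.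

(** * Moments of the entries *)

Section RealPowers.
Context {R : realType}.

(** It amounts to s ln (y / s) <= y, and turns the exponential integrability of an entry into
    moments growing like s^s. *)
Lemma powR_le_expR (y s : R) : 0 <= y -> 0 < s -> y `^ s <= s `^ s * expR y.
Proof.
move=> y0 s0; move: y0; rewrite le_eqVlt => /orP[/eqP <-|y0].
  by rewrite powR0 ?gt_eqF // mulr_ge0 ?powR_ge0 ?expR_ge0.
rewrite /powR !gt_eqF // -expRD ler_expR.
have h := ltW (ln_sublinear (divr_gt0 y0 s0)); rewrite ln_div ?posrE // in h.
have := ler_wpM2l (ltW s0) h; rewrite mulrBr [s * (y / s)]mulrC divfK ?gt_eqF //; lra.
Qed.

Lemma exprDn_le (x y : R) n : 0 <= x -> 0 <= y ->
  (x + y) ^+ n <= 2 ^+ n * (x ^+ n + y ^+ n).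
Proof.
wlog xy : x y / x <= y.
  move=> H x0 y0; case/orP: (le_total x y) => xy; first exact: H.
  by rewrite addrC [X in _ * X]addrC; exact: H.
move=> x0 y0; apply: (@le_trans _ _ ((2 * y) ^+ n)).
  by rewrite lerXn2r ?nnegrE ?addr_ge0 ?mulr_ge0 //; lra.
by rewrite exprMn ler_wpM2l ?exprn_ge0 // lerDr exprn_ge0.
Qed.

Lemma exprn_superadd (x y : R) n : (0 < n)%N -> 0 <= x -> 0 <= y ->
  x ^+ n + y ^+ n <= (x + y) ^+ n.
Proof.
case: n => // n _ x0 y0; rewrite !exprS mulrDl; apply: lerD; apply: ler_wpM2l => //;
  by rewrite lerXn2r ?nnegrE ?addr_ge0 // ?lerDl ?lerDr.
Qed.

End RealPowers.

Section Entry.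
Context d (T : measurableType d) (R : realType) (P : probability T R).
Variables (alpha kappa : R) (X : T -> R) (sig : R).
Hypothesis alpha0 : 0 < alpha.
Hypothesis mX : measurable_fun setT X.
Hypothesis EX : ('E_P[X] = 0)%E.
Hypothesis sig0 : 0 <= sig.
Hypothesis VX : ('V_P[X] <= (sig ^+ 2)%:E)%E.
Hypothesis psiX : (psi_norm P alpha (fun w => (X w / sig)%R) <= kappa%:E)%E.

Let K : R := `|kappa| + 1.

(** The infimum may fail to be attained, but [K] is strictly above it, so some admissible [x] is at
    most [K]. *)
Lemma psi_norm_tail : exists x : R, [/\ 0 < x, x <= K &
  (\int[P]_w (expR ((`|X w / sig| / x) `^ alpha))%:E <= 2%:E)%E].
Proof.
have : (psi_norm P alpha (fun w => (X w / sig)%R) < K%:E)%E.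
  by apply: le_lt_trans psiX _; rewrite lte_fin /K (le_lt_trans (ler_norm _)) // ltrDl.
move=> /ereal_inf_lt[_ [x [x0 hx] <-]]; rewrite lte_fin => xK.
by exists x; split => //; exact: ltW.
Qed.

(** When [sig] is 0 the quotient [X w / sig] is 0 by convention and [psiX] carries no information on
    [X]; the variance bound makes [X] vanish almost everywhere. *)
Lemma entry_zero n : sig = 0 -> (0 < n)%N ->
  ae_eq P setT (fun w => (`|X w| ^+ n)%:E) (cst 0%E).
Proof.
move=> s0 n0.
have mX2 : measurable_fun setT (fun w => (X w ^+ 2)%:E).
  by apply/measurable_EFinP; exact: measurable_funX.
have E2 : (\int[P]_w `|(X w ^+ 2)%:E| = 0)%E.
  apply/eqP; rewrite eq_le integral_ge0 // andbT.
  move: VX; rewrite s0 expr0n /= /variance unlock unlock /= => h.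
  move: EX; rewrite unlock => EX'; move: h; rewrite EX' /=; apply: le_trans.
  rewrite le_eqVlt; apply/orP; left; apply/eqP; apply: eq_integral => w _.
  by rewrite /= ger0_norm ?sqr_ge0 // [RHS](_ : _ = ((X w - 0) * (X w - 0))%:E) // subr0 expr2.
have := (ae_eq_integral_abs P measurableT mX2).1 E2.
apply: filterS => w /= h _; have := h Logic.I => -[] /eqP.
by rewrite sqrf_eq0 => /eqP ->; rewrite normr0 expr0n gtn_eqF.
Qed.

Lemma entry_abs_moment n : (0 < n)%N ->
  P.-integrable setT (EFin \o (fun w => `|X w| ^+ n)) /\
  \int[P]_w (`|X w| ^+ n) <= 2 * (sig * K) ^+ n * (n%:R / alpha) `^ (n%:R / alpha).
Proof.
move=> n0; set s : R := n%:R / alpha.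
have s0 : 0 < s by rewrite divr_gt0 ?ltr0n.
have K0 : 0 < K by rewrite /K ltr_wpDl.
have mXn : measurable_fun setT (fun w => `|X w| ^+ n).
  by apply: measurable_funX; exact: measurableT_comp.
have mEXn : measurable_fun setT (EFin \o (fun w => `|X w| ^+ n)) by exact/measurable_EFinP.
suff H : (\int[P]_w (`|X w| ^+ n)%:E <= (2 * (sig * K) ^+ n * s `^ s)%:E)%E.
  have iX : P.-integrable setT (EFin \o (fun w => `|X w| ^+ n)).
    apply/integrableP; split => //=.
    under eq_integral => w _ do rewrite ger0_norm ?exprn_ge0 //.
    by apply: le_lt_trans H _; rewrite ltry.
  split => //; have fX := integrable_fin_num measurableT iX.
  by rewrite -lee_fin /Rintegral fineK.
have [sz|sn] := eqVneq sig 0.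
  have := (ae_eq_integral_abs P measurableT mEXn).2 (entry_zero sz n0).
  under eq_integral => w _ do rewrite /= ger0_norm ?exprn_ge0 //.
  by move=> ->; rewrite lee_fin mulr_ge0 ?powR_ge0 // mulr_ge0 // exprn_ge0 // mulr_ge0 // ltW.
have sp : 0 < sig by rewrite lt_def sn.
have [x [x0 xK hx]] := psi_norm_tail.
have me : measurable_fun setT (fun w => expR ((`|X w / sig| / x) `^ alpha)).
  have m1 : measurable_fun setT (fun w => `|X w / sig| / x).
    by apply: measurable_funM => //; apply: measurableT_comp => //; exact: measurable_funM.
  have m2 := measurableT_comp (@measurable_powR R alpha) m1.
  exact: (measurableT_comp (@measurable_expR R) m2).
apply: (@le_trans _ _ (\int[P]_w (((sig * K) ^+ n * s `^ s) *
    expR ((`|X w / sig| / x) `^ alpha))%:E)%E).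
  apply: ge0_le_integral => //.
    by apply/measurable_EFinP; exact: measurable_funM.
  move=> w _; rewrite lee_fin; set u := `|X w / sig| / x.
  have u0 : 0 <= u by rewrite divr_ge0 // ltW.
  have Xu : `|X w| = sig * x * u.
    rewrite /u normrM normfV (gtr0_norm sp); field.
    by rewrite !gt_eqF.
  rewrite Xu exprMn -mulrA; apply: ler_pM; rewrite ?(exprn_ge0 _ u0) ?exprn_ge0 ?(mulr_ge0 sig0 (ltW x0)) //.
    by rewrite lerXn2r ?nnegrE ?mulr_ge0 ?(ltW x0) ?(ltW K0) // ler_wpM2l.
  (* The order n / alpha in the variable u^alpha is the source of the growth n^(n / alpha). *)
  have -> : u ^+ n = (u `^ alpha) `^ s.
    rewrite -powRrM /s mulrC divfK ?gt_eqF //.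
    by rewrite powR_mulrn.
  by apply: powR_le_expR => //; exact: powR_ge0.
under eq_integral => w _ do rewrite EFinM.
have c0 : 0 <= (sig * K) ^+ n * s `^ s.
  by rewrite mulr_ge0 ?powR_ge0 // exprn_ge0 // mulr_ge0 // ltW.
rewrite ge0_integralZl_EFin //; last exact/measurable_EFinP.
apply: le_trans (lee_wpmul2l _ hx) _; first by rewrite lee_fin.
by rewrite -EFinM lee_fin mulrC mulrA.
Qed.

Definition entry_var : R := \int[P]_w (X w ^+ 2).
(** The outer 2 is that of [exprDn_le], the first summand comes from the absolute moments, and the
    other two form a multiple of [sig] whose square dominates [entry_var]. *)
Definition moment_const : R :=
  2 * (2 * K * (alpha^-1 `^ alpha^-1) + 1 + 2 * K ^+ 2 * (2 / alpha) `^ (2 / alpha)).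

Lemma K_gt0 : 0 < K.
Proof. by rewrite /K ltr_wpDl. Qed.

Lemma entry_var_ge0 : 0 <= entry_var.
Proof. by apply: Rintegral_ge0 => w _; exact: sqr_ge0. Qed.

Lemma entry_var_le : entry_var <= sig ^+ 2 * (2 * K ^+ 2 * (2 / alpha) `^ (2 / alpha)).
Proof.
have [_] := @entry_abs_moment 2 isT; rewrite /entry_var.
under eq_Rintegral => w _ do rewrite -normrX ger0_norm ?sqr_ge0 //.
by move=> h; apply: le_trans h _; rewrite exprMn le_eqVlt; apply/orP; left; apply/eqP; ring.
Qed.

Lemma moment_const_ge0 : 0 <= moment_const.
Proof.
have K0 := ltW K_gt0.
by rewrite /moment_const !(mulr_ge0, addr_ge0) ?powR_ge0 ?exprn_ge0.
Qed.

Lemma entry_moment_le a b : (0 < a + b.*2)%N ->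
  P.-integrable setT (EFin \o (fun w => X w ^+ a * (X w ^+ 2 - entry_var) ^+ b)) /\
  `|\int[P]_w (X w ^+ a * (X w ^+ 2 - entry_var) ^+ b)| <=
  (moment_const * sig * (a + b.*2)%:R `^ alpha^-1) ^+ (a + b.*2).
Proof.
set n := (a + b.*2)%N => n0.
have K0 := K_gt0.
pose m2 := 2 * K ^+ 2 * (2 / alpha) `^ (2 / alpha).
have m20 : 0 <= m2 by rewrite !mulr_ge0 ?powR_ge0 ?exprn_ge0 // ltW.
pose M := 1 + m2.
have M0 : 0 <= M by rewrite addr_ge0.
have v0 := entry_var_ge0; have vle := entry_var_le; rewrite -/m2 in vle.
have [iXn eXn] := entry_abs_moment n0.
have mg : measurable_fun setT (fun w => X w ^+ a * (X w ^+ 2 - entry_var) ^+ b).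
  apply: measurable_funM; first exact: measurable_funX.
  by apply: measurable_funX; apply: measurable_funB => //; exact: measurable_funX.
(* Both |X| and the square root of |X^2 - [entry_var]| are at most |X| + sig M, so the mixed moment
   is controlled by a power of degree n. *)
have pw w : `|X w ^+ a * (X w ^+ 2 - entry_var) ^+ b| <=
    2 ^+ n * (`|X w| ^+ n + (sig * M) ^+ n).
  have sM : 0 <= sig * M by rewrite mulr_ge0.
  apply: le_trans (exprDn_le n (normr_ge0 (X w)) sM).
  rewrite normrM !normrX /n exprD -mul2n exprM.
  apply: ler_pM; rewrite ?exprn_ge0 //.
    by rewrite lerXn2r ?nnegrE ?addr_ge0 // lerDl.
  rewrite lerXn2r ?nnegrE ?exprn_ge0 ?addr_ge0 //.
  have : X w ^+ 2 = `|X w| ^+ 2 by rewrite -normrX ger0_norm // sqr_ge0.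
  set y := `|X w|; have y0 : 0 <= y by exact: normr_ge0.
  move=> ->; have h : sig ^+ 2 * m2 <= (sig * M) ^+ 2.
    by rewrite exprMn ler_wpM2l ?sqr_ge0 // /M; nra.
  have h' : 0 <= y * (sig * M) by exact: mulr_ge0.
  have y2 := sqr_ge0 y.
  by rewrite ler_norml; apply/andP; split; rewrite sqrrD; lra.
have ic : P.-integrable setT (EFin \o (fun _ : T => (sig * M) ^+ n)).
  exact: finite_measure_integrable_cst.
have ig : P.-integrable setT (EFin \o (fun w => 2 ^+ n * (`|X w| ^+ n + (sig * M) ^+ n))).
  by apply: integrable_scale; exact: integrable_add.
have ii := integrable_dominated mg pw ig; split => //.
apply: le_trans (le_normr_Rintegral measurableT ii) _.
apply: le_trans (le_Rintegral measurableT (integrable_normr ii) ig (fun w _ => pw w)) _.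
rewrite RintegralZl //; last exact: integrable_add.
rewrite RintegralD // Rintegral_cst //= probability_setT mulr1.
have n1 : 1 <= n%:R :> R by rewrite ler1n.
set q := n%:R `^ alpha^-1.
have q1 : 1 <= q.
  by rewrite -(powRr0 n%:R) ler_powR // invr_ge0 ltW.
have -> : moment_const = 2 * (2 * K * (alpha^-1 `^ alpha^-1) + M).
  by rewrite /moment_const /M -/m2; ring.
set A := alpha^-1 `^ alpha^-1 in eXn *.
have A0 : 0 <= A by exact: powR_ge0.
have sE : (n%:R / alpha) `^ (n%:R / alpha) = (q * A) ^+ n.
  rewrite [X in _ `^ X]mulrC powRrM powR_mulrn ?powR_ge0 //.
  by rewrite powRM // invr_ge0 ltW.
rewrite sE in eXn.
have KA0 : 0 <= 2 * K * A by rewrite !mulr_ge0 // ltW.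
apply: (@le_trans _ _ (2 ^+ n * (sig ^+ n * q ^+ n * ((2 * K * A) ^+ n + M ^+ n)))).
  rewrite ler_wpM2l ?exprn_ge0 // [leRHS]mulrDr; apply: lerD.
    apply: le_trans eXn _; rewrite !exprMn.
    have -> : 2 * (sig ^+ n * K ^+ n) * (q ^+ n * A ^+ n) =
      sig ^+ n * q ^+ n * (2 * K ^+ n * A ^+ n) by ring.
    rewrite ler_wpM2l ?mulr_ge0 ?exprn_ge0 ?(le_trans ler01 q1) //.
    rewrite -!mulrA ler_wpM2r ?mulr_ge0 ?exprn_ge0 ?(ltW K0) //.
    by case: (n) n0 => // k _; rewrite exprS ler_peMr // exprn_ege1 // ler1n.
  rewrite exprMn ler_wpM2r ?exprn_ge0 // ler_peMr ?exprn_ge0 //.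
  exact: exprn_ege1.
have -> : 2 * (2 * K * A + M) * sig * q = 2 * (sig * q * (2 * K * A + M)) by ring.
rewrite [leRHS]exprMn ler_wpM2l ?exprn_ge0 // !(exprMn n (sig * q)) (exprMn n sig).
rewrite ler_wpM2l ?mulr_ge0 ?exprn_ge0 ?(le_trans ler01 q1) //.
exact: exprn_superadd.
Qed.

End Entry.

(** [j.+2] is the integer square root of n rounded up, the atom of the comparison law at which a
    moment of order n is read off; atoms start at 2. *)
Lemma sqrt_ceil n : (2 <= n)%N -> exists j, (n <= j.+2 ^ 2 <= 4 * n)%N.
Proof.
move=> n2; have ex : exists j, (n <= j.+2 ^ 2)%N by exists n; lia.
exists (ex_minn ex); case: ex_minnP => j jn jmin; rewrite jn /=.
case: j jn jmin => [|j] jn jmin; first by lia.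
have : ~~ (n <= j.+2 ^ 2)%N by apply/negP => /jmin; rewrite ltnn.
lia.
Qed.

Section EntryLaw.
Context d (T : measurableType d) (R : realType) (P : probability T R).
Variables (alpha kappa : R) (X : T -> R) (sig : R).
Hypothesis alpha0 : 0 < alpha.
Hypothesis alpha1 : alpha <= 1.
Hypothesis mX : measurable_fun setT X.
Hypothesis iX : P.-integrable setT (EFin \o X).
Hypothesis EX : ('E_P[X] = 0)%E.
Hypothesis sig0 : 0 <= sig.
Hypothesis VX : ('V_P[X] <= (sig ^+ 2)%:E)%E.
Hypothesis psiX : (psi_norm P alpha (fun w => (X w / sig)%R) <= kappa%:E)%E.

Let beta : R := alpha^-1 - 2^-1.
Local Notation mu := (entry_var P X).

(** 128 undoes the loss in [law_moment_ge_term]; the square of 2^beta pays for the two powers of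
    n^beta that [B] does not absorb. *)
Definition comparison_const : R := 128 * moment_const alpha kappa * (2 `^ beta) ^+ 2.

Lemma comparison_const_ge0 : 0 <= comparison_const.
Proof.
apply: mulr_ge0; last by rewrite exprn_ge0 // powR_ge0.
by apply: mulr_ge0 => //; exact: moment_const_ge0.
Qed.

Lemma beta_ge0 : 0 <= beta.
Proof.
have : 1 <= alpha^-1 by rewrite -[1]invr1 lef_pV2 ?posrE.
by rewrite /beta; lra.
Qed.

Lemma entry_mean0 : \int[P]_w X w = 0.
Proof. by move: EX; rewrite unlock /Rintegral => ->. Qed.

Lemma entry_var_centered : \int[P]_w (X w ^+ 2 - mu) = 0.
Proof.
have [i2 _] := entry_moment_le alpha0 mX EX sig0 VX psiX (isT : (0 < 2 + 0.*2)%N).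
have i2' : P.-integrable setT (EFin \o (fun w => X w ^+ 2)).
  apply: eq_integrable i2 => // w _ /=; by rewrite expr0 mulr1.
rewrite RintegralB //; last exact: finite_measure_integrable_cst.
by rewrite Rintegral_cst //= probability_setT mulr1 subrr.
Qed.

(* n^(1/alpha) = n^beta * sqrt n: the first factor is absorbed by B up to the two
   powers paid for sig^2, the second is the growth of the moments of the law. *)
Lemma entry_moment_law q B a b : (0 < q)%N -> 0 < B ->
  sig * (q.*2)%:R `^ beta <= B -> (0 < a + b.*2 <= q.*2)%N ->
  `|\int[P]_w (X w ^+ a * (X w ^+ 2 - mu) ^+ b)| <=
  (comparison_const * B) ^+ (a + b.*2) * ((sig / B) ^+ 2 * law_moment (8 * q) a b).
Proof.
move=> q0 B0 sB /andP[n0 nq].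
have L0 : (0 < 8 * q)%N by rewrite muln_gt0.
have C0 := comparison_const_ge0.
have [ab|ab] := leqP 2 (a + b); last first.
  rewrite [X in `|X|](_ : _ = 0); last first.
    case: a b n0 nq ab => [|[|a]] [|[|b]] // _ _ _.
      by under eq_Rintegral => w _ do rewrite expr0 mul1r expr1; exact: entry_var_centered.
    by under eq_Rintegral => w _ do rewrite expr0 mulr1 expr1; exact: entry_mean0.
  rewrite normr0; apply: mulr_ge0.
    by apply: exprn_ge0; apply: mulr_ge0 => //; exact: ltW.
  by apply: mulr_ge0; [exact: sqr_ge0|exact: law_moment_ge0].
have [_ H] := entry_moment_le alpha0 mX EX sig0 VX psiX n0.
apply: le_trans H _; set n := (a + b.*2)%N in n0 nq *.
have n2 : (2 <= n)%N by rewrite /n; lia.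
have [j /andP[nj jn]] := sqrt_ceil n2.
(* [8 * q] atoms suffice: r = [j.+2] satisfies r <= r^2 <= 4 n <= 8 q. *)
have jL : (j < 8 * q)%N.
  have : (j.+2 <= j.+2 ^ 2)%N by rewrite expnS expn1 leq_pmulr.
  lia.
have G := @law_moment_ge_term R (8 * q) L0 a b j ab jL jn; rewrite -/n in G.
set Mc := moment_const alpha kappa.
have Mc0 : 0 <= Mc by exact: moment_const_ge0.
set nb := n%:R `^ beta; have nb0 : 0 <= nb by exact: powR_ge0.
have nR0 : 0 < n%:R :> R by rewrite ltr0n.
have E1 : n%:R `^ alpha^-1 = nb * Num.sqrt n%:R.
  rewrite -powR12_sqrt // /nb -powRD; last by rewrite (gt_eqF nR0) implybT.
  by rewrite /beta subrK.
have rj : Num.sqrt n%:R <= j.+2%:R :> R.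
  rewrite -(@ler_pXn2r _ 2) ?nnegrE ?sqrtr_ge0 // sqr_sqrtr // -natrX ler_nat.
  exact: nj.
have nbB : sig * nb <= B.
  apply: le_trans sB; rewrite ler_wpM2l // ge0_ler_powR ?nnegrE ?beta_ge0 //.
  by rewrite ler_nat.
set tb := 2 `^ beta; have tb0 : 0 <= tb by exact: powR_ge0.
have nbt : nb <= tb ^+ n.
  rewrite -powR_mulrn // /tb -powRrM mulrC powRrM powR_mulrn //.
  rewrite ge0_ler_powR ?nnegrE ?beta_ge0 ?exprn_ge0 //.
  by rewrite -natrX ler_nat ltnW // ltn_expl.
(* Of the n factors sig n^beta, n - 2 are bounded by [B]; the other two keep sig^2 and leave n^(2
   beta), at most 4^(beta n). *)
have key : (sig * nb) ^+ n <= (tb ^+ 2) ^+ n * (sig / B) ^+ 2 * B ^+ n.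
  have -> : n = (2 + (n - 2))%N by rewrite subnKC.
  rewrite exprD -!exprM [in X in _ <= X * _ * _]subnKC // [in X in _ <= _ * X]exprD.
  have -> : tb ^+ (2 * n) * (sig / B) ^+ 2 * (B ^+ 2 * B ^+ (n - 2)) =
      (sig ^+ 2 * (tb ^+ n) ^+ 2) * B ^+ (n - 2).
    rewrite -exprM [(n * 2)%N]mulnC; field.
    by rewrite gt_eqF.
  rewrite exprMn; apply: ler_pM; rewrite ?mulr_ge0 ?exprn_ge0 ?mulr_ge0 //.
    by rewrite ler_wpM2l ?sqr_ge0 // lerXn2r ?nnegrE ?exprn_ge0.
  by rewrite lerXn2r ?nnegrE ?mulr_ge0 ?(ltW B0).
have CE : comparison_const = 128 * Mc * tb ^+ 2 by [].
clearbody Mc tb nb.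
rewrite E1; apply: (@le_trans _ _ ((Mc * 128) ^+ n * (sig * nb) ^+ n * (j.+2%:R / 128) ^+ n)).
  rewrite -!exprMn lerXn2r ?nnegrE ?mulr_ge0 ?sqrtr_ge0 //.
  rewrite [leRHS](_ : _ = Mc * sig * (nb * j.+2%:R)); last by field.
  by rewrite ler_wpM2l ?mulr_ge0 // ler_wpM2l.
apply: (@le_trans _ _ ((Mc * 128) ^+ n * ((tb ^+ 2) ^+ n * (sig / B) ^+ 2 * B ^+ n) *
    law_moment (8 * q) a b)).
  apply: ler_pM; rewrite ?mulr_ge0 ?exprn_ge0 ?mulr_ge0 //.
  by rewrite ler_wpM2l // exprn_ge0 // mulr_ge0.
rewrite le_eqVlt; apply/orP; left; apply/eqP.
by rewrite CE !exprMn; ring.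
Qed.

End EntryLaw.

(** * Moments of the trace *)

Section WalkSumLinear.
Context {R : realType} {I J : finType}.

Lemma walk_sum_scale (c : R) (f : seq I -> seq J -> R) n x y :
  walk_sum (fun x y => c * f x y) n x y = c * walk_sum f n x y.
Proof.
elim: n x y => [//|n IH] x y /=; rewrite mulr_sumr; apply: eq_bigr => i _.
by rewrite mulr_sumr; apply: eq_bigr => j _.
Qed.

Lemma mean_walk_sum (Om : finType) (p : Om -> R) (F : seq I -> seq J -> Om -> R) n x y :
  \sum_w p w * walk_sum (fun x y => F x y w) n x y =
  walk_sum (fun x y => \sum_w p w * F x y w) n x y.
Proof.
elim: n x y => [//|n IH] x y /=.
under eq_bigr => w _ do rewrite mulr_sumr.
rewrite exchange_big /=; apply: eq_bigr => i _.
under eq_bigr => w _ do rewrite mulr_sumr.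
by rewrite exchange_big /=; apply: eq_bigr => j _.
Qed.

Context d (T : measurableType d) (P : probability T R).

Lemma integrable_walk_sum (F : seq I -> seq J -> T -> R) n x y :
  (forall x y, P.-integrable setT (EFin \o F x y)) ->
  P.-integrable setT (EFin \o (fun w => walk_sum (fun x y => F x y w) n x y)).
Proof.
move=> FI; elim: n x y => [|n IH] x y /=; first exact: FI.
by apply: integrable_sum_EFin => i; apply: integrable_sum_EFin.
Qed.

Lemma Rintegral_walk_sum (F : seq I -> seq J -> T -> R) n x y :
  (forall x y, P.-integrable setT (EFin \o F x y)) ->
  \int[P]_w walk_sum (fun x y => F x y w) n x y =
  walk_sum (fun x y => \int[P]_w F x y w) n x y.
Proof.
move=> FI; elim: n x y => [//|n IH] x y /=.
rewrite Rintegral_sum => [|i]; last first.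
  by apply: integrable_sum_EFin => j; exact: integrable_walk_sum.
apply: eq_bigr => i _; rewrite Rintegral_sum => [|j]; last exact: integrable_walk_sum.
by apply: eq_bigr.
Qed.

End WalkSumLinear.

Section HomogeneousWalks.
Context {R : realType} (L m n : nat).
Hypothesis L0 : (0 < L)%N.

Let y (w : 'I_L.+1) : R := law_val w.
Let p (w : 'I_L.+1) : R := law_prob L w.
Let v : R := law_var L.

Let h (w : {ffun 'I_n -> {ffun 'I_m -> 'I_L.+1}}) (i : 'I_m) (j : 'I_n) (k : 'I_m) : R :=
  if i == k then y (w j i) ^+ 2 - v else y (w j i) * y (w j k).

Lemma mean_triples (s : seq ('I_m * 'I_n * 'I_m)) :
  \sum_w mx_prob p w * \prod_(t <- s) h w t.1.1 t.1.2 t.2 = shape_prod (law_moment L) s.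
Proof.
rewrite -shape_prod_fin; last exact: law_moment00.
pose G (e : 'I_m * 'I_n) (o : 'I_L.+1) : R :=
  y o ^+ nsingle s e * (y o ^+ 2 - v) ^+ ndouble s e.
have E w : \prod_(t <- s) h w t.1.1 t.1.2 t.2 = \prod_j \prod_i G (i, j) (w j i).
  rewrite (prod_triples_edges (fun i j => y (w j i)) (fun _ _ => v)).
  by rewrite exchange_big /= pair_big; apply: eq_bigr => -[].
under eq_bigr => w _ do rewrite E.
rewrite (mean_prod (col_prob p) (fun j c => \prod_i G (i, j) (c i))).
rewrite [RHS](eq_bigr (fun e => \sum_o p o * G e o)) //.
rewrite (eq_bigr (fun j => \prod_i \sum_o p o * G (i, j) o)) => [|j _]; last first.
  by rewrite /col_prob (mean_prod p (fun i o => G (i, j) o)).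
by rewrite exchange_big /= pair_big; apply: eq_bigr => -[].
Qed.

Lemma mean_trace_row q :
  \sum_(w : {ffun 'I_n -> {ffun 'I_m -> 'I_L.+1}}) mx_prob p w * \tr (@centered_gram R 'I_L.+1 y v m n w ^+ q.+1) =
  \sum_(i < m) \sum_(j < n) walk_sum (fun x z =>
    shape_prod (law_moment L) (triples x z (rot 1 x))) q [:: i] [:: j].
Proof.
under eq_bigr => w _ do rewrite (trace_exp_walk_row (h w)) mulr_sumr.
rewrite exchange_big /=; apply: eq_bigr => i _.
under eq_bigr => w _ do rewrite mulr_sumr.
rewrite exchange_big /=; apply: eq_bigr => j _.
rewrite (mean_walk_sum (mx_prob p) (fun x z w =>
  \prod_(t <- triples x z (rot 1 x)) h w t.1.1 t.1.2 t.2)).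
by apply: walk_sum_eq => x z; exact: mean_triples.
Qed.

Lemma mean_trace_col q :
  \sum_(w : {ffun 'I_n -> {ffun 'I_m -> 'I_L.+1}}) mx_prob p w * \tr (@centered_gram R 'I_L.+1 y v m n w ^+ q.+1) =
  \sum_(j < n) \sum_(i < m) walk_sum (fun z x =>
    shape_prod (law_moment L) (triples (rotr 1 x) z x)) q [:: j] [:: i].
Proof.
under eq_bigr => w _ do rewrite (trace_exp_walk_col (h w)) mulr_sumr.
rewrite exchange_big /=; apply: eq_bigr => i _.
under eq_bigr => w _ do rewrite mulr_sumr.
rewrite exchange_big /=; apply: eq_bigr => j _.
rewrite (mean_walk_sum (mx_prob p) (fun z x w =>
  \prod_(t <- triples (rotr 1 x) z x) h w t.1.1 t.1.2 t.2)).
by apply: walk_sum_eq => x z; exact: mean_triples.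
Qed.

Lemma mean_trace_le q k : (0 < k)%N -> ~~ odd q.+1 -> m = (q.+1 * k)%N -> (m <= n)%N ->
  \sum_(w : {ffun 'I_n -> {ffun 'I_m -> 'I_L.+1}}) mx_prob p w * \tr (@centered_gram R 'I_L.+1 y v m n w ^+ q.+1) <=
  m%:R * (trace_const * Num.sqrt (m * n)%:R) ^+ q.+1.
Proof.
move=> k0 qe mqk mn.
apply: (@trace_centered_gram_le R 'I_L.+1 p y v) k0 _ qe mqk mn => //.
- by move=> w; exact: law_prob_ge0.
- exact: law_prob_sum.
- exact: law_centered.
- exact: law_var_le.
- exact: law_exp_sqr_le.
Qed.

End HomogeneousWalks.

Section TraceMoment.
Context {R : realType} (alpha kappa : R) (p1 p2 : nat).
Context d (T : measurableType d) (P : probability T R).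
Variables (Z : 'I_p1 -> 'I_p2 -> T -> R) (sigma : 'I_p1 -> 'I_p2 -> R).
Hypothesis alpha0 : 0 < alpha.
Hypothesis alpha1 : alpha <= 1.
Hypothesis mZ : forall i j, measurable_fun setT (Z i j).
Hypothesis indep : mutually_independent P (fun ij : 'I_p1 * 'I_p2 => Z ij.1 ij.2).
Hypothesis iZ : forall i j, P.-integrable setT (EFin \o Z i j).
Hypothesis EZ : forall i j, ('E_P[Z i j] = 0)%E.
Hypothesis sigma0 : forall i j, 0 <= sigma i j.
Hypothesis VZ : forall i j, ('V_P[Z i j] <= (sigma i j ^+ 2)%R%:E)%E.
Hypothesis psiZ : forall i j,
  (psi_norm P alpha (fun w => (Z i j w / sigma i j)%R) <= kappa%:E)%E.

Local Notation mu i j := (entry_var P (Z i j)).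

Definition centered_entry (w : T) (i : 'I_p1) (j : 'I_p2) (k : 'I_p1) : R :=
  if i == k then Z i j w ^+ 2 - mu i j else Z i j w * Z k j w.

Definition centered_ZZt (w : T) : 'M[R]_p1 :=
  \matrix_(i, k) \sum_j centered_entry w i j k.

Let mom (a b : nat) (e : 'I_p1 * 'I_p2) (x : R) : R :=
  x ^+ a * (x ^+ 2 - mu e.1 e.2) ^+ b.

Lemma integrable_mom a b (e : 'I_p1 * 'I_p2) :
  P.-integrable setT (EFin \o (fun w => mom a b e (Z e.1 e.2 w))).
Proof.
case: (posnP (a + b.*2)) => [/eqP|ab]; last first.
  by have [] := entry_moment_le alpha0 (mZ e.1 e.2) (EZ e.1 e.2) (sigma0 e.1 e.2)
    (VZ e.1 e.2) (psiZ e.1 e.2) ab.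
rewrite addn_eq0 double_eq0 => /andP[/eqP -> /eqP ->].
rewrite (_ : _ \o _ = EFin \o (fun _ => 1)); last first.
  by apply/funext => w /=; rewrite /mom !expr0 mulr1.
exact: finite_measure_integrable_cst.
Qed.

Lemma measurable_mom a b e : measurable_fun setT (mom a b e).
Proof.
have mX2 k : measurable_fun setT (fun x : R => x ^+ k) by exact: measurable_funX.
have m3 : measurable_fun setT (fun x : R => x ^+ 2 - mu e.1 e.2) by exact: measurable_funB.
by apply: measurable_funM => //; exact: measurable_funX m3.
Qed.

Section Walk.
Variable s : seq ('I_p1 * 'I_p2 * 'I_p1).

Let walkE w : \prod_(t <- s) centered_entry w t.1.1 t.1.2 t.2 =
  \prod_e mom (nsingle s e) (ndouble s e) e (Z e.1 e.2 w).
Proof. exact: (prod_triples_edges (fun i j => Z i j w) (fun i j => mu i j)). Qed.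

Lemma integrable_walk :
  P.-integrable setT (EFin \o (fun w => \prod_(t <- s) centered_entry w t.1.1 t.1.2 t.2)).
Proof.
rewrite (_ : (fun w => _) = fun w =>
  \prod_e mom (nsingle s e) (ndouble s e) e (Z e.1 e.2 w)); last exact/funext.
have mX (e : 'I_p1 * 'I_p2) : measurable_fun setT (Z e.1 e.2) by exact: mZ.
exact: (integrable_prod_indep mX indep (fun e => measurable_mom _ _ e)
  (fun e => integrable_mom _ _ e)).
Qed.

Lemma Rintegral_walk :
  \int[P]_w \prod_(t <- s) centered_entry w t.1.1 t.1.2 t.2 =
  \prod_e \int[P]_w mom (nsingle s e) (ndouble s e) e (Z e.1 e.2 w).
Proof.
under eq_Rintegral => w _ do rewrite walkE.
have mX (e : 'I_p1 * 'I_p2) : measurable_fun setT (Z e.1 e.2) by exact: mZ.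
exact: (Rintegral_prod_indep mX indep (fun e => measurable_mom _ _ e)
  (fun e => integrable_mom _ _ e)).
Qed.

End Walk.

Variables (q : nat) (B : R).
Hypothesis B0 : 0 < B.
Hypothesis sB : forall i j, sigma i j * (q.+1.*2)%:R `^ (alpha^-1 - 2^-1) <= B.

Local Notation C := (comparison_const alpha kappa).
Local Notation L := (8 * q.+1)%N.
Let s2 i j : R := (sigma i j / B) ^+ 2.

Lemma walk_moment_le (s : seq ('I_p1 * 'I_p2 * 'I_p1)) : size s = q.+1 ->
  \int[P]_w \prod_(t <- s) centered_entry w t.1.1 t.1.2 t.2 <=
  (C * B) ^+ q.+1.*2 * (edge_weight s2 (edges_of s) * shape_prod (law_moment L) s).
Proof.
move=> sq; rewrite Rintegral_walk.
have L0 : (0 < L)%N by rewrite muln_gt0.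
pose nn e := (nsingle s e + (ndouble s e).*2)%N.
have nq e : (nn e <= q.+1.*2)%N.
  by rewrite -sq -sum_counts (bigD1 e) //= leq_addr.
apply: le_trans (ler_norm _) _; rewrite normr_prod.
apply: (@le_trans _ _ (\prod_(e : 'I_p1 * 'I_p2) ((C * B) ^+ nn e *
    ((if e \in edges_of s then s2 e.1 e.2 else 1) *
     law_moment L (nsingle s e) (ndouble s e))))).
  apply: ler_prod => e _; rewrite normr_ge0 /=.
  case: ifPn => es; last first.
    have [-> ->] := counts_notin es.
    rewrite /nn; have [-> ->] := counts_notin es.
    rewrite law_moment00 // !mulr1 expr0.
    under eq_Rintegral => w _ do rewrite /mom !expr0 mulr1.
    by rewrite Rintegral_cst //= probability_setT mulr1 normr1.
  apply: (entry_moment_law (q := q.+1) alpha0 alpha1 (mZ _ _) (iZ _ _) (EZ _ _)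
    (sigma0 _ _) (VZ _ _) (psiZ _ _)) => //.
  have := counts_in es; have := nq e; rewrite /nn => -> /=.
  by case: (nsingle s e) => //= /[!add0n]; case: (ndouble s e).
rewrite !big_split /=.
have -> : \prod_e (C * B) ^+ nn e = (C * B) ^+ q.+1.*2.
  by rewrite prodrXr /nn sum_counts sq.
rewrite shape_prod_fin; last exact: law_moment00.
by rewrite /edge_weight [in leRHS]big_mkcond.
Qed.

Lemma integrable_trace :
  P.-integrable setT (EFin \o (fun w => \tr (centered_ZZt w ^+ q.+1))).
Proof.
rewrite (_ : (fun w => _) = fun w => \sum_i \sum_j walk_sum (fun x y =>
    \prod_(t <- triples x y (rot 1 x)) centered_entry w t.1.1 t.1.2 t.2) q [:: i] [:: j]).
  apply: integrable_sum_EFin => i; apply: integrable_sum_EFin => j.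
  by apply: integrable_walk_sum => x y; exact: integrable_walk.
by apply/funext => w; exact: trace_exp_walk_row.
Qed.

Lemma Rintegral_trace_row :
  \int[P]_w \tr (centered_ZZt w ^+ q.+1) = \sum_i \sum_j walk_sum (fun x y =>
    \int[P]_w \prod_(t <- triples x y (rot 1 x)) centered_entry w t.1.1 t.1.2 t.2)
    q [:: i] [:: j].
Proof.
under eq_Rintegral => w _ do rewrite (trace_exp_walk_row (centered_entry w)).
rewrite Rintegral_sum => [|i]; last first.
  apply: integrable_sum_EFin => j.
  by apply: integrable_walk_sum => x y; exact: integrable_walk.
apply: eq_bigr => i _; rewrite Rintegral_sum => [|j]; last first.
  by apply: integrable_walk_sum => x y; exact: integrable_walk.
apply: eq_bigr => j _; rewrite (Rintegral_walk_sum (F := fun x y w =>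
  \prod_(t <- triples x y (rot 1 x)) centered_entry w t.1.1 t.1.2 t.2)) // => x y.
exact: integrable_walk.
Qed.

Lemma Rintegral_trace_col :
  \int[P]_w \tr (centered_ZZt w ^+ q.+1) = \sum_j \sum_i walk_sum (fun y x =>
    \int[P]_w \prod_(t <- triples (rotr 1 x) y x) centered_entry w t.1.1 t.1.2 t.2)
    q [:: j] [:: i].
Proof.
under eq_Rintegral => w _ do rewrite (trace_exp_walk_col (centered_entry w)).
rewrite Rintegral_sum => [|i]; last first.
  apply: integrable_sum_EFin => j.
  by apply: integrable_walk_sum => x y; exact: integrable_walk.
apply: eq_bigr => i _; rewrite Rintegral_sum => [|j]; last first.
  by apply: integrable_walk_sum => x y; exact: integrable_walk.
apply: eq_bigr => j _; rewrite (Rintegral_walk_sum (F := fun y x w =>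
  \prod_(t <- triples (rotr 1 x) y x) centered_entry w t.1.1 t.1.2 t.2)) // => x y.
exact: integrable_walk.
Qed.

Section TraceBound.
Variables (k m1 m2 : nat).
Hypothesis k0 : (0 < k)%N.
Hypothesis qe : ~~ odd q.+1.
Hypothesis m1E : m1 = (q.+1 * k)%N.
Hypothesis m12 : (m1 <= m2)%N.
Hypothesis sum_col : forall j, \sum_i s2 i j <= m1%:R - q.+1%:R.
Hypothesis sum_row : forall i, \sum_j s2 i j <= m2%:R - q.+1%:R.

Let D : R := Num.sqrt (m1 * m2)%:R.
Let bound : R := (C * B) ^+ 2 * (trace_const * D).

Let s2_ge0 i j : 0 <= s2 i j.
Proof. exact: sqr_ge0. Qed.

Let s2_le1 i j : s2 i j <= 1.
Proof.
rewrite exprn_ile1 ?divr_ge0 ?(ltW B0) // ler_pdivrMr // mul1r.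
apply: le_trans (sB i j); rewrite ler_peMr // -[leLHS](powRr0 q.+1.*2%:R).
by rewrite ler_powR ?ler1n ?double_gt0 // beta_ge0.
Qed.

Let qm1 : (q.+1 <= m1)%N.
Proof. by rewrite m1E leq_pmulr. Qed.

Let L0 : (0 < L)%N. Proof. by rewrite muln_gt0. Qed.

Let CB0 : 0 < (C * B) ^+ q.+1.*2.
Proof.
rewrite exprn_gt0 // mulr_gt0 //.
apply: mulr_gt0; last by rewrite exprn_gt0 // powR_gt0.
apply: mulr_gt0 => //; apply: mulr_gt0 => //.
apply: ltr_wpDr; first by rewrite mulr_ge0 ?powR_ge0 // mulr_ge0 // exprn_ge0 // addr_ge0.
by apply: ltr_wpDl => //; rewrite mulr_ge0 ?powR_ge0 // mulr_ge0 // addr_ge0.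
Qed.

Let boundE : bound ^+ q.+1 = (C * B) ^+ q.+1.*2 * (trace_const * D) ^+ q.+1.
Proof. by rewrite /bound exprMn -exprM -mul2n. Qed.

Lemma trace_moment_row :
  \int[P]_w \tr (centered_ZZt w ^+ q.+1) <= p1%:R * bound ^+ q.+1.
Proof.
have m10 : 0 < m1%:R :> R by rewrite ltr0n (leq_trans _ qm1).
pose f x y := ((C * B) ^+ q.+1.*2)^-1 *
  \int[P]_w \prod_(t <- triples x y (rot 1 x)) centered_entry w t.1.1 t.1.2 t.2.
have := @shape_comparison_row R p1 p2 m1 m2 s2 (law_moment L) q.+1 q s2_ge0 s2_le1
  (law_moment_ge0 L0) qm1 (leq_trans qm1 m12) sum_col sum_row (ltnSn q) f.
rewrite -(mean_trace_row m1 m2 L0 q) => H.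
have {}H := H _; have : forall x y, size x = size y -> size x = q.+1 ->
    f x y <= edge_weight s2 (edges_of (triples x y (rot 1 x))) *
             shape_prod (law_moment L) (triples x y (rot 1 x)).
  move=> x y sxy sxq; rewrite /f ler_pdivrMl //; apply: walk_moment_le.
  by rewrite !size_zip size_rot -sxy !minnn.
move=> /H {H}.
under eq_bigr => i _ do under eq_bigr => j _ do rewrite walk_sum_scale.
under eq_bigr => i _ do rewrite -mulr_sumr.
rewrite -mulr_sumr -Rintegral_trace_row => H.
have H2 := @mean_trace_le R _ _ _ L0 _ _ k0 qe m1E m12.
have p10 : 0 <= p1%:R :> R by [].
have H3 := le_trans H (ler_wpM2l p10 H2).
rewrite [leRHS]mulrCA ler_pM2l // ler_pdivrMl // in H3.
by rewrite boundE mulrCA.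
Qed.

(** The comparison yields p2 / m2 where the homogeneous bound carries m1, and m1 <= m2 absorbs the
    quotient. *)
Lemma trace_moment_col :
  \int[P]_w \tr (centered_ZZt w ^+ q.+1) <= p2%:R * bound ^+ q.+1.
Proof.
have m20 : 0 < m2%:R :> R by rewrite ltr0n (leq_trans _ m12) // (leq_trans _ qm1).
pose f y x := ((C * B) ^+ q.+1.*2)^-1 *
  \int[P]_w \prod_(t <- triples (rotr 1 x) y x) centered_entry w t.1.1 t.1.2 t.2.
have := @shape_comparison_col R p1 p2 m1 m2 s2 (law_moment L) q.+1 q s2_ge0 s2_le1
  (law_moment_ge0 L0) qm1 (leq_trans qm1 m12) sum_col sum_row (ltnSn q) f.
rewrite -(mean_trace_col m1 m2 L0 q) => H.
have : forall y x, size y = size x -> size y = q.+1 ->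
    f y x <= edge_weight s2 (edges_of (triples (rotr 1 x) y x)) *
             shape_prod (law_moment L) (triples (rotr 1 x) y x).
  move=> x y sxy sxq; rewrite /f ler_pdivrMl //; apply: walk_moment_le.
  by rewrite !size_zip size_rotr -sxy !minnn.
move=> /H {H}.
under eq_bigr => i _ do under eq_bigr => j _ do rewrite walk_sum_scale.
under eq_bigr => i _ do rewrite -mulr_sumr.
rewrite -mulr_sumr -Rintegral_trace_col => H.
have H2 := @mean_trace_le R _ _ _ L0 _ _ k0 qe m1E m12.
have p20 : 0 <= p2%:R :> R by [].
have tD0 : 0 <= (trace_const * D) ^+ q.+1.
  by rewrite exprn_ge0 // mulr_ge0 ?sqrtr_ge0 // trace_const_ge0.
have H3 : m1%:R * (trace_const * D) ^+ q.+1 <= m2%:R * (trace_const * D) ^+ q.+1.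
  by rewrite ler_wpM2r // ler_nat.
have H4 := le_trans H (ler_wpM2l p20 (le_trans H2 H3)).
rewrite [leRHS]mulrCA ler_pM2l // ler_pdivrMl // in H4.
by rewrite boundE mulrCA.
Qed.

End TraceBound.

End TraceMoment.

(** * From the trace to the spectral norm *)

(** The integral of a nonnegative function is a supremum over the simple functions below it, hence
    monotone without measurability. It is applied to the spectral norm, a supremum over uncountably
    many vectors. *)
Lemma ge0_le_integral_any d (T : measurableType d) (R : realType)
    (mu : {measure set T -> \bar R}) (f g : T -> \bar R) :
  (forall x, 0 <= f x)%E -> (forall x, f x <= g x)%E ->
  (\int[mu]_x f x <= \int[mu]_x g x)%E.
Proof.
move=> f0 fg; have g0 x : (0 <= g x)%E := le_trans (f0 x) (fg x).
rewrite !ge0_integralTE //; apply: ereal_sup_le => _ [h hf <-].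
by exists h => // x; exact: le_trans (hf x) (fg x).
Qed.

Section SpectralNorm.
Context {R : realType}.

Lemma enorm2 n (x : 'cV[R]_n) : enorm x ^+ 2 = nrm2 x.
Proof. by rewrite sqr_sqrtr // nrm2_ge0. Qed.

Lemma enorm_ge0 n (x : 'cV[R]_n) : 0 <= enorm x.
Proof. exact: sqrtr_ge0. Qed.

Lemma enorm1_nrm2 n (x : 'cV[R]_n) : enorm x = 1 -> nrm2 x = 1.
Proof. by rewrite -enorm2 => ->; rewrite expr1n. Qed.

Lemma specnorm_ge0 m n (A : 'M[R]_(m, n)) : 0 <= specnorm A.
Proof.
rewrite /specnorm; set S := [set _ | _ in _].
(* In dimension 0 there is no unit vector, and [sup] of the empty set is 0. *)
have [[y Sy]|/set0P/negP/negPn/eqP ->] := pselect (S !=set0); last by rewrite sup0.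
have ubS : has_ubound S.
  exists (Num.sqrt (\sum_i \sum_j A i j ^+ 2)) => _ [x /= x1 <-].
  have := nrm2_mulmx_le A x; rewrite (enorm1_nrm2 x1) mulr1 => h.
  by rewrite /enorm ler_sqrt //; apply: le_trans h; exact: nrm2_ge0.
apply: le_trans (ub_le_sup ubS Sy); case: Sy => x _ <-; exact: enorm_ge0.
Qed.

(** Being linear in e^(n+1), this can be integrated directly; if the mean of e^(n+1) is at most
    t^(n+1), the result is 2 t. *)
Lemma le_expn_split (e t : R) n : 0 <= e -> 0 < t -> e <= t + t ^- n * e ^+ n.+1.
Proof.
move=> e0 t0; have [et|te] := leP e t.
  apply: le_trans et _; rewrite lerDl mulr_ge0 ?exprn_ge0 //.
  by rewrite invr_ge0 exprn_ge0 // ltW.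
have tn : 0 < t ^+ n by exact: exprn_gt0.
apply: (@le_trans _ _ (t ^- n * e ^+ n.+1)); last by rewrite lerDr ltW.
rewrite mulrC ler_pdivlMr // exprSr mulrC ler_wpM2r //.
by rewrite lerXn2r ?nnegrE ?(ltW t0) // ltW.
Qed.

Lemma specnorm_trace_le n (M : 'M[R]_n) j q t : M^T = M -> q.+1 = (2 ^ j.+1)%N -> 0 < t ->
  specnorm M <= t + t ^- q * \tr (M ^+ q.+1).
Proof.
move=> Ms qE t0.
have tq : 0 <= t ^- q by rewrite invr_ge0 exprn_ge0 // ltW.
have tr0 : 0 <= \tr (M ^+ q.+1).
  rewrite qE expnS mul2n trace_exp_double //.
  by apply: sumr_ge0 => i _; apply: sumr_ge0 => k _; exact: sqr_ge0.
rewrite /specnorm; set S := [set _ | _ in _].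
have [S0|/set0P/negP/negPn/eqP ->] := pselect (S !=set0); last first.
  by rewrite sup0 addr_ge0 ?mulr_ge0 // ltW.
apply: ge_sup => // _ [x /= x1 <-].
apply: le_trans (le_expn_split q (enorm_ge0 _) t0) _.
rewrite lerD2l ler_wpM2l // {1}qE expnS exprM enorm2 qE.
by apply: nrm2_mulmx_trace => //; exact: enorm1_nrm2.
Qed.

End SpectralNorm.

Section Sigmas.
Context {R : realType} {p1 p2 : nat}.
Variable sigma : 'I_p1 -> 'I_p2 -> R.

Lemma sigmaC2 j : \sum_i sigma i j ^+ 2 <= sigmaC sigma ^+ 2.
Proof.
rewrite sqr_sqrtr; first exact: (le_bigmax _ (fun j => \sum_i sigma i j ^+ 2)).
exact: bigmax_ge_id.
Qed.

Lemma sigmaR2 i : \sum_j sigma i j ^+ 2 <= sigmaR sigma ^+ 2.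
Proof.
rewrite sqr_sqrtr; first exact: (le_bigmax _ (fun i => \sum_j sigma i j ^+ 2)).
exact: bigmax_ge_id.
Qed.

Lemma sigmaStar_ub i j : 0 <= sigma i j -> sigma i j <= sigmaStar sigma.
Proof.
move=> s0; rewrite -(ger0_norm s0) -sqrtr_sqr ler_sqrt ?sqr_ge0 //.
  apply: le_trans (le_bigmax _ (fun i => \big[Num.max/0]_(j < p2) sigma i j ^+ 2) i).
  exact: (le_bigmax _ (fun j => sigma i j ^+ 2)).
exact: bigmax_ge_id.
Qed.

Lemma sigmaStar_le_sigmaC : sigmaStar sigma <= sigmaC sigma.
Proof.
rewrite ler_sqrt; last exact: bigmax_ge_id.
apply: bigmax_le => [|i _]; first exact: bigmax_ge_id.
apply: bigmax_le => [|j _]; first exact: bigmax_ge_id.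
apply: le_trans (le_bigmax _ (fun j => \sum_i sigma i j ^+ 2) j).
by rewrite (bigD1 i) //= lerDl sumr_ge0 // => k _; exact: sqr_ge0.
Qed.

Lemma sigmaC_ge0 : 0 <= sigmaC sigma. Proof. exact: sqrtr_ge0. Qed.
Lemma sigmaR_ge0 : 0 <= sigmaR sigma. Proof. exact: sqrtr_ge0. Qed.
Lemma sigmaStar_ge0 : 0 <= sigmaStar sigma. Proof. exact: sqrtr_ge0. Qed.

End Sigmas.

Section MainBound.
Context {R : realType} (alpha kappa : R) (p1 p2 : nat).
Context d (T : measurableType d) (P : probability T R).
Variables (Z : 'I_p1 -> 'I_p2 -> T -> R) (sigma : 'I_p1 -> 'I_p2 -> R).
Hypothesis alpha0 : 0 < alpha.
Hypothesis alpha1 : alpha <= 1.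
Hypothesis mZ : forall i j, measurable_fun setT (Z i j).
Hypothesis indep : mutually_independent P (fun ij : 'I_p1 * 'I_p2 => Z ij.1 ij.2).
Hypothesis iZ : forall i j, P.-integrable setT (EFin \o Z i j).
Hypothesis EZ : forall i j, ('E_P[Z i j] = 0)%E.
Hypothesis sigma0 : forall i j, 0 <= sigma i j.
Hypothesis VZ : forall i j, ('V_P[Z i j] <= (sigma i j ^+ 2)%R%:E)%E.
Hypothesis psiZ : forall i j,
  (psi_norm P alpha (fun w => (Z i j w / sigma i j)%R) <= kappa%:E)%E.

Lemma integrable_entry_mul i j k : P.-integrable setT (EFin \o (fun w => Z i j w * Z k j w)).
Proof.
have [<-|ik] := eqVneq i k.
  have := integrable_mom alpha0 mZ EZ sigma0 VZ psiZ 2 0 (i, j).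
  rewrite (_ : (fun w => _) = fun w => Z i j w * Z i j w) //.
  by apply/funext => w /=; rewrite expr0 mulr1 expr2.
have := integrable_walk alpha0 mZ indep EZ sigma0 VZ psiZ [:: (i, j, k)].
rewrite (_ : (fun w => _) = fun w => Z i j w * Z k j w) //.
by apply/funext => w /=; rewrite big_seq1 /centered_entry /= (negbTE ik).
Qed.

Lemma Rintegral_entry_mul i j k :
  \int[P]_w (Z i j w * Z k j w) = (i == k)%:R * entry_var P (Z i j).
Proof.
have [<-|ik] := eqVneq i k.
  by rewrite mul1r; apply: eq_Rintegral => w _; rewrite expr2.
have := Rintegral_walk alpha0 mZ indep EZ sigma0 VZ psiZ [:: (i, j, k)].
under eq_Rintegral => w _ do rewrite big_seq1 /centered_entry /= (negbTE ik).
move=> ->; rewrite mul0r (bigD1 (i, j)) //=.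
rewrite /nsingle /ndouble !big_seq1 /= ik (negbTE ik) eqxx /=.
have -> : ((i, j) == (k, j)) = false by rewrite xpair_eqE (negbTE ik).
under eq_Rintegral => w _ do rewrite expr0 mulr1 mul1n addn0 expr1.
by rewrite (entry_mean0 (EZ i j)) mul0r.
Qed.

Lemma ZZt_centered w : ZZt Z w - EZZt P Z = centered_ZZt P Z w.
Proof.
apply/matrixP => i k; rewrite !mxE.
have -> : fine ('E_P[fun w => ZZt Z w i k]) = \sum_j (i == k)%:R * entry_var P (Z i j).
  rewrite unlock -/(Rintegral P setT (fun w => ZZt Z w i k)).
  under eq_Rintegral => w' _ do rewrite /ZZt mxE.
  rewrite Rintegral_sum => [|j].
    apply: eq_bigr => j _; rewrite -Rintegral_entry_mul.
    by apply: eq_Rintegral => w' _; rewrite !mxE.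
  rewrite (_ : (fun w' => _) = fun w' => Z i j w' * Z k j w').
    exact: integrable_entry_mul.
  by apply/funext => w'; rewrite !mxE.
rewrite -sumrB; apply: eq_bigr => j _; rewrite !mxE /centered_entry.
by have [->|_] := eqVneq i k; rewrite ?mul1r ?expr2 // mul0r subr0.
Qed.

Lemma centered_ZZt_sym w : (centered_ZZt P Z w)^T = centered_ZZt P Z w.
Proof.
apply/matrixP => i k; rewrite !mxE; apply: eq_bigr => j _.
by rewrite /centered_entry eq_sym; case: eqP => [->//|_]; rewrite mulrC.
Qed.

Definition main_const : R :=
  expR 1 * comparison_const alpha kappa ^+ 2 * trace_const.

Lemma main_const_ge0 : 0 <= main_const.
Proof.
apply: mulr_ge0; last exact: trace_const_ge0.
by apply: mulr_ge0; [exact: expR_ge0|exact: sqr_ge0].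
Qed.

(* y absorbs the rounding of the dimensions m1 and m2 of the homogeneous model, which
   exceed sigmaC^2 / B^2 and sigmaR^2 / B^2 by multiples of the exponent 2^(j+1). *)
Lemma specnorm_bound j B t :
  (minn p1 p2)%:R <= expR (2 ^ j.+1)%:R :> R -> 0 < B ->
  (forall i k, sigma i k * ((2 ^ j.+1).*2)%:R `^ (alpha^-1 - 2^-1) <= B) ->
  0 < t ->
  let y := 2 * Num.sqrt (2 ^ j.+1)%:R * B in
  main_const * ((sigmaC sigma + y) * (sigmaC sigma + sigmaR sigma + y)) <= t ->
  (\int[P]_w (specnorm (ZZt Z w - EZZt P Z))%:E <= (2 * t)%:E)%E.
Proof.
move=> pq B0 sB t0 y ht.
pose q := (2 ^ j.+1).-1; have qE : q.+1 = (2 ^ j.+1)%N by rewrite /q prednK // expn_gt0.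
have qe : ~~ odd q.+1 by rewrite qE expnS oddM.
rewrite -qE in pq sB y ht.
have B2 : 0 < B ^+ 2 by exact: exprn_gt0.
have sC := sigmaC_ge0 sigma; have sR := sigmaR_ge0 sigma.
have qR : 1 <= q.+1%:R :> R by rewrite ler1n.
have qp : 0 < q.+1%:R :> R by rewrite ltr0n.
pose SC := sigmaC sigma ^+ 2 / B ^+ 2; pose SR := sigmaR sigma ^+ 2 / B ^+ 2.
have SC0 : 0 <= SC by rewrite divr_ge0 ?sqr_ge0.
have SR0 : 0 <= SR by rewrite divr_ge0 ?sqr_ge0.
(* Rounding down and adding 1 would cover SC; the second unit makes room for the q + 1 vertices
   already visited, which are subtracted in [m1lo]. In m2 that room is provided by m1. *)
pose k := (Num.truncn (SC / q.+1%:R)).+2.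
pose m1 := (q.+1 * k)%N; pose m2 := (m1 + (Num.truncn SR).+1)%N.
have SCq0 : 0 <= SC / q.+1%:R by rewrite divr_ge0.
have /andP[k1 k2] := truncn_itv SCq0; have /andP[r1 r2] := truncn_itv SR0.
have m1R : m1%:R = q.+1%:R * ((Num.truncn (SC / q.+1%:R))%:R + 2) :> R.
  by rewrite natrM /k -addn2 natrD.
have m2R : m2%:R = m1%:R + (Num.truncn SR)%:R + 1 :> R.
  by rewrite /m2 natrD -[X in _ + X = _]natr1 addrA.
rewrite -[X in _ < X]natr1 in k2; rewrite -[X in _ < X]natr1 in r2.
have m1lo : SC <= m1%:R - q.+1%:R.
  have -> : m1%:R - q.+1%:R = q.+1%:R * ((Num.truncn (SC / q.+1%:R))%:R + 1) :> R.
    by rewrite m1R; ring.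
  by rewrite -ler_pdivrMl // [_^-1 * SC]mulrC ltW.
have m1hi : m1%:R <= SC + 2 * q.+1%:R.
  rewrite m1R mulrDr [_ * 2]mulrC lerD2r; apply: le_trans (ler_wpM2l (ltW qp) k1) _.
  by rewrite mulrC divfK ?gt_eqF.
have m2lo : SR <= m2%:R - q.+1%:R by rewrite m2R; lra.
have m2hi : m2%:R <= SC + SR + 3 * q.+1%:R by rewrite m2R; lra.
have scol (l : 'I_p2) : \sum_i (sigma i l / B) ^+ 2 <= m1%:R - q.+1%:R.
  apply: le_trans m1lo; under eq_bigr => i _ do rewrite expr_div_n.
  by rewrite -mulr_suml ler_wpM2r ?invr_ge0 ?(ltW B2) // sigmaC2.
have srow (i : 'I_p1) : \sum_l (sigma i l / B) ^+ 2 <= m2%:R - q.+1%:R.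
  apply: le_trans m2lo; under eq_bigr => l _ do rewrite expr_div_n.
  by rewrite -mulr_suml ler_wpM2r ?invr_ge0 ?(ltW B2) // sigmaR2.
have m12 : (m1 <= m2)%N by rewrite leq_addr.
have Hr := trace_moment_row alpha0 alpha1 mZ indep iZ EZ sigma0 VZ psiZ B0 sB
  (isT : (0 < k)%N) qe (erefl m1) m12 scol srow.
have Hc := trace_moment_col alpha0 alpha1 mZ indep iZ EZ sigma0 VZ psiZ B0 sB
  (isT : (0 < k)%N) qe (erefl m1) m12 scol srow.
set bd := (_ ^+ 2 * _) in Hr Hc.
have bd0 : 0 <= bd.
  apply: mulr_ge0; first exact: sqr_ge0.
  by apply: mulr_ge0; [exact: trace_const_ge0|exact: sqrtr_ge0].
have Hm : \int[P]_w \tr (centered_ZZt P Z w ^+ q.+1) <= (minn p1 p2)%:R * bd ^+ q.+1.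
  by rewrite /minn; case: ifP.
(* As y^2 = 4 (q + 1) B^2 exceeds the rounding terms 2 (q + 1) B^2 and 3 (q + 1) B^2, B^2 m1 and B^2
   m2 are at most (sigma_C + y)^2 and (sigma_C + sigma_R + y)^2; their geometric mean gives the
   product in [ht]. *)
have bdt : expR 1 * bd <= t.
  apply: le_trans ht; rewrite /bd.
  have y0 : 0 <= y by rewrite !mulr_ge0 ?sqrtr_ge0 // ltW.
  have y2 : y ^+ 2 = 4 * q.+1%:R * B ^+ 2.
    by rewrite /y !exprMn sqr_sqrtr //; ring.
  have h1 : B ^+ 2 * m1%:R <= (sigmaC sigma + y) ^+ 2.
    apply: le_trans (ler_wpM2l (ltW B2) m1hi) _.
    rewrite mulrDr /SC mulrCA divff ?gt_eqF // mulr1 sqrrD y2.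
    have : 0 <= sigmaC sigma * y by exact: mulr_ge0.
    have : 0 <= q.+1%:R * B ^+ 2 by rewrite mulr_ge0 // ltW.
    nra.
  have h2 : B ^+ 2 * m2%:R <= (sigmaC sigma + sigmaR sigma + y) ^+ 2.
    apply: le_trans (ler_wpM2l (ltW B2) m2hi) _.
    have -> : B ^+ 2 * (SC + SR + 3 * q.+1%:R) =
        sigmaC sigma ^+ 2 + sigmaR sigma ^+ 2 + 3 * (q.+1%:R * B ^+ 2).
      by rewrite /SC /SR; field; rewrite gt_eqF.
    have -> : (sigmaC sigma + sigmaR sigma + y) ^+ 2 = sigmaC sigma ^+ 2 +
        sigmaR sigma ^+ 2 + y ^+ 2 + 2 * (sigmaC sigma * sigmaR sigma) +
        2 * (sigmaC sigma * y) + 2 * (sigmaR sigma * y) by ring.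
    have : 0 <= sigmaC sigma * y by exact: mulr_ge0.
    have : 0 <= sigmaR sigma * y by exact: mulr_ge0.
    have : 0 <= sigmaC sigma * sigmaR sigma by exact: mulr_ge0.
    have : 0 <= q.+1%:R * B ^+ 2 by rewrite mulr_ge0 // ltW.
    rewrite y2; lra.
  have h3 : B ^+ 2 * Num.sqrt (m1 * m2)%:R <=
      (sigmaC sigma + y) * (sigmaC sigma + sigmaR sigma + y).
    rewrite -(@ler_pXn2r _ 2) ?nnegrE ?(mulr_ge0 (ltW B2) (sqrtr_ge0 _)) //; last first.
      by apply: mulr_ge0; rewrite !addr_ge0.
    rewrite !exprMn sqr_sqrtr // natrM.
    have -> : (B ^+ 2) ^+ 2 * (m1%:R * m2%:R) = B ^+ 2 * m1%:R * (B ^+ 2 * m2%:R) by ring.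
    by apply: ler_pM => //; rewrite mulr_ge0 // ltW.
  apply: (@le_trans _ _ (main_const * (B ^+ 2 * Num.sqrt (m1 * m2)%:R))); last first.
    by rewrite ler_wpM2l // main_const_ge0.
  by rewrite le_eqVlt; apply/orP; left; apply/eqP; rewrite /main_const; ring.
have Ht : \int[P]_w \tr (centered_ZZt P Z w ^+ q.+1) <= t ^+ q.+1.
  (* The dimension is at most exp(q + 1), so one factor e per power absorbs it. *)
  apply: le_trans Hm _; apply: (@le_trans _ _ ((expR 1 * bd) ^+ q.+1)); last first.
    by rewrite lerXn2r ?nnegrE ?(ltW t0) // mulr_ge0 // expR_ge0.
  rewrite [leRHS]exprMn ler_wpM2r ?(exprn_ge0 _ bd0) //; apply: le_trans pq _.
  by rewrite -expRM_natl mulr1.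
have it := integrable_trace alpha0 mZ indep EZ sigma0 VZ psiZ q.
have tq : 0 <= t ^- q by rewrite invr_ge0 exprn_ge0 // ltW.
have ib : P.-integrable setT (EFin \o (fun w =>
    t + t ^- q * \tr (centered_ZZt P Z w ^+ q.+1))).
  apply: integrable_add; first exact: finite_measure_integrable_cst.
  exact: integrable_scale.
apply: (@le_trans _ _ (\int[P]_w (t + t ^- q * \tr (centered_ZZt P Z w ^+ q.+1))%:E)%E).
  apply: ge0_le_integral_any => w; first by rewrite lee_fin specnorm_ge0.
  rewrite lee_fin ZZt_centered; apply: specnorm_trace_le qE t0.
  exact: centered_ZZt_sym.
rewrite -[leLHS]fineK; last exact: integrable_fin_num.
rewrite lee_fin -/(Rintegral P setT _) RintegralD //; last 2 first.
- exact: finite_measure_integrable_cst.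
- exact: integrable_scale.
rewrite Rintegral_cst //= probability_setT mulr1 RintegralZl //.
have -> : 2 * t = t + t ^- q * t ^+ q.+1.
  by rewrite exprSr mulrA mulVf ?mul1r ?expf_neq0 ?gt_eqF // mulr2n mulrDl mul1r.
by rewrite lerD2l ler_wpM2l.
Qed.

End MainBound.

(** * Choice of the exponent and the final constant *)

Lemma exp2_between {R : realType} (l : R) : 0 <= l ->
  exists j, l <= (2 ^ j.+1)%:R <= 2 * l + 2.
Proof.
move=> l0.
have ex : exists j, l <= (2 ^ j.+1)%:R.
  exists (Num.truncn l); have /andP[_ h] := truncn_itv l0; apply: le_trans (ltW h) _.
  by rewrite ler_nat ltnW // ltn_expl.
exists (ex_minn ex); case: ex_minnP => j jl jmin; rewrite jl /=.
case: j jl jmin => [|j] jl jmin; first by rewrite expn1; lra.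
have : ~~ (l <= (2 ^ j.+1)%:R) by apply/negP => /jmin; rewrite ltnn.
by rewrite -ltNge => h; rewrite expnS natrM; lra.
Qed.

Lemma ln_nat_ge_half {R : realType} n : (2 <= n)%N -> 2^-1 <= ln n%:R :> R.
Proof.
move=> n2; have h : ln (1 + - 2^-1) <= - 2^-1 :> R by apply: le_ln1Dx; lra.
have e : 1 + - 2^-1 = 2^-1 :> R by field.
rewrite e lnV ?posrE // lerN2 in h; apply: le_trans h _.
by rewrite ler_ln ?posrE ?ltr0n ?(ler_nat R 2) // (leq_trans _ n2).
Qed.

Lemma ln_nat_ge0 {R : realType} n : 0 <= ln n%:R :> R.
Proof. by case: n => [|n]; [rewrite ln0|rewrite ln_ge0 // ler1n]. Qed.

Lemma nat_le_expR {R : realType} n (x : R) : ln n%:R <= x -> n%:R <= expR x.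
Proof.
case: n => [|n] h; first exact: expR_ge0.
by rewrite -[leLHS]lnK ?posrE // ler_expR.
Qed.

(** If the smaller dimension is at least 2, then l >= 1/2 and 2 r <= 4 l + 4 <= 12 l. Otherwise the
    logarithm is 0 and the summand 1 takes over; multiplied by sigma_* it is at most sigma_C. *)
Lemma scale_le {R : realType} (alpha : R) (p q j : nat) :
  0 < alpha -> alpha <= 1 ->
  let r := (2 ^ j.+1)%:R : R in
  r <= 2 * ln (minn p q)%:R + 2 ->
  Num.sqrt r * ((2 ^ j.+1).*2)%:R `^ (alpha^-1 - 2^-1) <=
  12 `^ alpha^-1 * (1 + ln (minn p q)%:R `^ 2^-1 * ln (maxn p q)%:R `^ (alpha^-1 - 2^-1)).
Proof.
move=> a0 a1 r hr; set l := ln _ in hr *; set l' := ln (maxn p q)%:R.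
have b0 : 0 <= alpha^-1 - 2^-1 := beta_ge0 a0 a1.
have r1 : 1 <= r by rewrite ler1n expn_gt0.
have rE : ((2 ^ j.+1).*2)%:R = 2 * r :> R by rewrite -mul2n natrM.
have ia0 : 0 <= alpha^-1 by rewrite invr_ge0 ltW.
have LL0 : 0 <= l `^ 2^-1 * l' `^ (alpha^-1 - 2^-1) by rewrite mulr_ge0 ?powR_ge0.
have c0 : 0 <= (12 : R) `^ alpha^-1 by exact: powR_ge0.
apply: (@le_trans _ _ ((2 * r) `^ alpha^-1)).
  rewrite rE; set u := 2 * r; have u0 : 0 < u by rewrite /u; lra.
  have -> : u `^ alpha^-1 = u `^ 2^-1 * u `^ (alpha^-1 - 2^-1).
    rewrite -powRD; first by congr (_ `^ _); ring.
    by rewrite (gt_eqF u0) implybT.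
  rewrite ler_wpM2r ?powR_ge0 // powR12_sqrt ?(ltW u0) // ler_sqrt ?(ltW u0) //.
  by rewrite /u; lra.
have l0 : 0 <= l by exact: ln_nat_ge0.
have [m2|m1] := leqP 2 (minn p q).
  have lh : 2^-1 <= l by exact: ln_nat_ge_half.
  have lp : 0 < l by lra.
  have ll : l <= l'.
    have m0 : (0 < minn p q)%N by exact: leq_trans m2.
    have mm : (minn p q <= maxn p q)%N by rewrite geq_min leq_max leqnn.
    by rewrite ler_ln ?posrE ?ltr0n ?ler_nat ?m0 ?(leq_trans m0 mm).
  apply: (@le_trans _ _ ((12 * l) `^ alpha^-1)).
    by rewrite ge0_ler_powR ?nnegrE ?mulr_ge0 ?(le_trans ler01 r1) //; lra.
  rewrite powRM // ler_wpM2l //.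
  have -> : l `^ alpha^-1 = l `^ 2^-1 * l `^ (alpha^-1 - 2^-1).
    rewrite -powRD; first by congr (_ `^ _); ring.
    by rewrite (gt_eqF lp) implybT.
  apply: (@le_trans _ _ (l `^ 2^-1 * l' `^ (alpha^-1 - 2^-1))); last by rewrite lerDr.
  rewrite ler_wpM2l ?powR_ge0 // ge0_ler_powR ?nnegrE //.
  exact: le_trans ll.
have lz : l = 0.
  rewrite /l; case: (minn p q) m1 => [|[|n]] // _; [exact: ln0|exact: ln1].
rewrite mulrDr mulr1; apply: (@le_trans _ _ (12 `^ alpha^-1)); last by rewrite lerDl mulr_ge0.
by rewrite ge0_ler_powR ?nnegrE ?mulr_ge0 ?(le_trans ler01 r1) //; lra.
Qed.

Unset Implicit Arguments.

Theorem theorem3p1 (R : realType) (alpha kappa : R) :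
  0 < alpha -> alpha <= 1 ->
  exists C : R, 0 < C /\
  forall (p1 p2 : nat) (d : measure_display) (T : measurableType d)
         (P : probability T R) (Z : 'I_p1 -> 'I_p2 -> T -> R)
         (sigma : 'I_p1 -> 'I_p2 -> R),
    (forall i j, measurable_fun setT (Z i j)) ->
    mutually_independent P (fun ij : 'I_p1 * 'I_p2 => Z ij.1 ij.2) ->
    (forall i j, P.-integrable setT (EFin \o Z i j)) ->
    (forall i j, ('E_P[Z i j] = 0)%E) ->
    (forall i j, 0 <= sigma i j) ->
    (forall i j, ('V_P[Z i j] <= (sigma i j ^+ 2)%R%:E)%E) ->
    (forall i j, (psi_norm P alpha (fun w => (Z i j w / sigma i j)%R) <= kappa%:E)%E) ->
    (\int[P]_w (specnorm (ZZt Z w - EZZt P Z))%:E <=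
      (C * ((sigmaC sigma + sigmaR sigma
             + sigmaStar sigma * (ln (minn p1 p2)%:R) `^ (2^-1)
                               * (ln (maxn p1 p2)%:R) `^ (alpha^-1 - 2^-1)) ^+ 2
            - sigmaR sigma ^+ 2))%:E)%E.
Proof.
move=> alpha0 alpha1; set beta := alpha^-1 - 2^-1.
have mc0 := main_const_ge0 alpha kappa; set mc := main_const alpha kappa in mc0.
pose cy : R := 2 * 12 `^ alpha^-1; have cy0 : 0 <= cy by rewrite mulr_ge0 ?powR_ge0.
(* The 2 is that of [specnorm_bound]; y <= cy * x bounds each of its two factors at the cost of 1 +
   cy; [mc + 1] is positive. *)
exists (2 * ((mc + 1) * (1 + cy) ^+ 2)); split.
  by rewrite mulr_gt0 // mulr_gt0 ?exprn_gt0 //; lra.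
move=> p1 p2 d T P Z sigma mZ indep iZ EZ sigma0 VZ psiZ.
have C0 := sigmaC_ge0 sigma; have R0 := sigmaR_ge0 sigma.
have S0 := sigmaStar_ge0 sigma; have SC := sigmaStar_le_sigmaC sigma.
have b0 : 0 <= beta := beta_ge0 alpha0 alpha1.
pose mp : R := ln (minn p1 p2)%:R `^ 2^-1 * ln (maxn p1 p2)%:R `^ beta.
have mp0 : 0 <= mp by rewrite mulr_ge0 ?powR_ge0.
rewrite -[sigmaStar sigma * _ * _]mulrA -/mp.
set sC := sigmaC sigma in C0 SC *; set sR := sigmaR sigma in R0 *.
set sS := sigmaStar sigma in S0 SC *.
pose x := sC + sS * mp; have x0 : 0 <= x by rewrite addr_ge0 // mulr_ge0.
(* As a product, the right-hand side can be matched factor by factor with (sC + y) (sC + sR + y) in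
   [specnorm_bound]. *)
have -> : (sC + sR + sS * mp) ^+ 2 - sR ^+ 2 = x * (x + 2 * sR) by rewrite /x; ring.
have xR0 : 0 <= x * (x + 2 * sR) by rewrite mulr_ge0 // addr_ge0 // mulr_ge0.
have [j /andP[jlo jhi]] := exp2_between (ln_nat_ge0 (minn p1 p2) : 0 <= _ :> R).
set r : R := (2 ^ j.+1)%:R in jlo jhi.
have pq : (minn p1 p2)%:R <= expR r by exact: nat_le_expR.
have r0 : 0 < r by rewrite ltr0n expn_gt0.
have main := @specnorm_bound R alpha kappa p1 p2 d T P Z sigma alpha0 alpha1
  mZ indep iZ EZ sigma0 VZ psiZ j.
have [Sz|Sn] := eqVneq sS 0.
  have sz i k : sigma i k = 0.
    by apply/eqP; rewrite eq_le sigma0 andbT -Sz; exact: sigmaStar_ub.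
  have Cz : sC = 0.
    rewrite /sC /sigmaC (_ : \big[Num.max/0]_(k < p2) _ = 0) ?sqrtr0 //.
    apply: (big_ind (fun z => z = 0)) => // [a b -> ->|k _]; first exact: maxxx.
    by rewrite big1 // => i _; rewrite sz expr0n.
  have Rz : sR = 0.
    rewrite /sR /sigmaR (_ : \big[Num.max/0]_(k < p1) _ = 0) ?sqrtr0 //.
    apply: (big_ind (fun z => z = 0)) => // [a b -> ->|k _]; first exact: maxxx.
    by rewrite big1 // => i _; rewrite sz expr0n.
  (* If all sigma vanish, B can be taken arbitrarily small. *)
  apply/lee_addgt0Pr => e e0; apply: (@le_trans _ _ (e%:E)%E); last first.
    by rewrite -EFinD lee_fin lerDr mulr_ge0 // mulr_ge0 // mulr_ge0 ?sqr_ge0 //; lra.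
  (* With B = sqrt b and all sigma zero, y^2 = 4 r b and the requirement is mc * 4 r b <= e / 2. *)
  pose b := e / (8 * r * (mc + 1)).
  have bp : 0 < b by rewrite divr_gt0 // !mulr_gt0 //; lra.
  have -> : e = 2 * (e / 2) by field.
  apply: (main (Num.sqrt b)) => //.
  - by rewrite sqrtr_gt0.
  - by move=> i k; rewrite sz mul0r sqrtr_ge0.
  - by rewrite divr_gt0.
  rewrite -/sC -/sR Cz Rz !add0r -expr2 !exprMn !sqr_sqrtr ?(ltW r0) ?(ltW bp) // -/mc.
  have -> : mc * (2 ^+ 2 * r * b) = mc / (mc + 1) * (e / 2).
    by rewrite /b; field; rewrite !gt_eqF //; lra.
  rewrite ler_piMl ?divr_ge0 ?(ltW e0) // ler_pdivrMr; lra.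
have Sp : 0 < sS by rewrite lt_def Sn.
have Cp : 0 < sC by exact: lt_le_trans SC.
have xp : 0 < x by rewrite ltr_pwDl // mulr_ge0.
rewrite -mulrA; set t := (mc + 1) * _ * _.
have tp : 0 < t.
  rewrite mulr_gt0 //; first by rewrite mulr_gt0 ?exprn_gt0 //; lra.
  by rewrite mulr_gt0 // ltr_pwDl // mulr_ge0.
(* The least scale that [specnorm_bound] allows for all entries at once. *)
pose B := sS * ((2 ^ j.+1).*2)%:R `^ beta.
have sc := scale_le (p := p1) (q := p2) (j := j) alpha0 alpha1 jhi.
apply: (main B) => //.
- by rewrite mulr_gt0 // powR_gt0 // ltr0n double_gt0 expn_gt0.
- by move=> i k; rewrite /B ler_wpM2r ?powR_ge0 // sigmaStar_ub.
set y := 2 * _ * B; rewrite -/sC -/sR -/mc.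
have y0 : 0 <= y by rewrite !mulr_ge0 ?sqrtr_ge0 ?powR_ge0.
have yx : y <= cy * x.
  have -> : y = 2 * sS * (Num.sqrt r * ((2 ^ j.+1).*2)%:R `^ beta).
    by rewrite /y /B; ring.
  apply: le_trans (ler_wpM2l _ sc) _; first by rewrite mulr_ge0.
  rewrite -/mp /cy.
  have -> : 2 * sS * (12 `^ alpha^-1 * (1 + mp)) = 2 * 12 `^ alpha^-1 * (sS + sS * mp).
    by ring.
  by rewrite ler_wpM2l // /x lerD2r.
have sx : sC <= x by rewrite /x lerDl mulr_ge0.
apply: (@le_trans _ _ ((mc + 1) * (((1 + cy) * x) * ((1 + cy) * (x + 2 * sR))))); last first.
  by rewrite le_eqVlt; apply/orP; left; apply/eqP; rewrite /t; ring.
have cyR : 0 <= cy * sR by exact: mulr_ge0.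
apply: ler_pM => //; first by rewrite !mulr_ge0 ?addr_ge0.
  by lra.
by apply: ler_pM; rewrite ?addr_ge0 //; lra.
Qed.
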